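(* Let $(d_n)_{n\in\mathbb{N}}$ be a sequence of natural numbers with $d_n\to\infty$. Let $Z_i$, $i\in\mathbb{N}$, be i.i.d. random variables on $(\Omega,\mathcal{A},\mathbb{P})$ with values in $l^2$ such that $\mathbb{E}[Z_1]=0$ and $\mathbb{E}[\|Z_1\|^2]<\infty$. Put $X_{ni}:=(Z_i^{(1)},\ldots,Z_i^{(d_n)})$ for $1\le i\le n$, $\overline{X}_n:=n^{-1}\sum_{i=1}^nX_{ni}$, $V_n(d_n):=n\|\overline{X}_n\|_{d_n}^2$, and let $W_n^*(\omega)$ be the bootstrap version of $V_n(d_n)$. Then $$\sup_{x\in\mathbb{R}}|\mathbb{P}^*(W_n^*(\omega)\le x)-\mathbb{P}(V_n(d_n)\le x)|\to0,\quad n\to\infty,\quad\text{for }\mathbb{P}\text{-almost all }\omega\in\Omega.$$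
   Context: $l^2$ is the Hilbert space of square-summable real sequences $x=(x^{(i)})_{i\in\mathbb{N}}$ with norm $\|\cdot\|$; $\|\cdot\|_d$ is the Euclidean norm on $\mathbb{R}^d$. Bootstrap construction: for every $n\in\mathbb{N}$ let $i_{n1},\ldots,i_{nn}$ be random variables on some probability space $(\Omega^*,\mathcal{A}^*,\mathbb{P}^* )$ that are $\mathbb{P}^*$-independent and each uniformly distributed on $\{1,\ldots,n\}$. For $\omega\in\Omega$ and $1\le k\le n$ define $\xi_{nk}(\omega):\Omega^*\to\mathbb{R}^{d_n}$ by $\xi_{nk}(\omega)(\omega^* ):=X_{n\,i_{nk}(\omega^* )}(\omega)$. Put $\overline{\xi}_n(\omega):=n^{-1}\sum_{k=1}^n(\xi_{nk}(\omega)-\overline{X}_n(\omega))$ and $W_n^*(\omega):=n\|\overline{\xi}_n(\omega)\|_{d_n}^2$; for each fixed $\omega$, $W_n^*(\omega)$ is a random variable on $(\Omega^*,\mathcal{A}^*,\mathbb{P}^* )$. *)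

(* Defs.v *)
From HB Require Import structures.
From mathcomp Require Import all_boot all_order all_algebra ring.
From mathcomp Require Import all_classical all_reals all_analysis.

Set Implicit Arguments.
Unset Strict Implicit.
Unset Printing Implicit Defensive.

Import Order.TTheory GRing.Theory Num.Theory.
Import numFieldNormedType.Exports.

Local Open Scope classical_set_scope.
Local Open Scope ring_scope.

Definition square_summable (R : realType) : {pred nat -> R} :=
  fun x => `[< cvgn (series (fun k => x k ^+ 2)) >].

Lemma square_summable_comb (R : realType) (a b : R) (x y : nat -> R) :
  cvgn (series (fun k => x k ^+ 2)) -> cvgn (series (fun k => y k ^+ 2)) ->
  cvgn (series (fun k => a * x k ^+ 2 + b * y k ^+ 2)) /\
  limn (series (fun k => a * x k ^+ 2 + b * y k ^+ 2)) =
  a * limn (series (fun k => x k ^+ 2)) + b * limn (series (fun k => y k ^+ 2)).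
Proof.
move=> cx cy.
have -> : (fun k => a * x k ^+ 2 + b * y k ^+ 2) =
    a *: (fun k => x k ^+ 2) + b *: (fun k => y k ^+ 2) by [].
have ca := @is_cvg_seriesZ _ _ a cx; have cb := @is_cvg_seriesZ _ _ b cy.
split; first exact: is_cvg_seriesD ca cb.
by rewrite (lim_seriesD ca cb) (lim_seriesZ _ cx) (lim_seriesZ _ cy).
Qed.

Lemma square_summable_submod_closed (R : realType) :
  submod_closed (@square_summable R).
Proof.
split=> [|a x y].
  apply/asboolP; have -> : series (fun k => (0 : nat -> R) k ^+ 2) = cst 0.
    by apply/funext => n; rewrite /series/= big1// => k _; rewrite expr0n.
  exact: is_cvg_cst.
move=> /asboolP cx /asboolP cy; apply/asboolP.
have [cxy _] := square_summable_comb (2 * a ^+ 2) 2 cx cy.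
apply: series_le_cvg cxy => k.
- exact: sqr_ge0.
- by rewrite addr_ge0// mulr_ge0 ?sqr_ge0// mulr_ge0 ?sqr_ge0.
- have -> : (a *: x + y) k = a * x k + y k by [].
  rewrite -subr_ge0.
  by rewrite (_ : _ - _ = (a * x k - y k) ^+ 2) ?sqr_ge0//; ring.
Qed.

HB.instance Definition _ (R : realType) :=
  GRing.isSubmodClosed.Build R (nat -> R) (@square_summable R)
    (@square_summable_submod_closed R).

Record l2 (R : realType) := L2 {
  l2_coord :> nat -> R;
  l2_coordP : l2_coord \in @square_summable R }.

HB.instance Definition _ (R : realType) := [isSub for @l2_coord R].
HB.instance Definition _ (R : realType) := [Choice of l2 R by <:].
HB.instance Definition _ (R : realType) :=
  [SubChoice_isSubLmodule of l2 R by <:].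

Section l2_normed.
Variable R : realType.
Implicit Types x y : l2 R.

Definition l2_sqnorm x : R := limn (series (fun k => x k ^+ 2)).

Definition l2_norm x : R := Num.sqrt (l2_sqnorm x).

Let l2_cvg x : cvgn (series (fun k => x k ^+ 2)).
Proof. exact/asboolP/(l2_coordP x). Qed.

Let partial_le x n : series (fun k => x k ^+ 2) n <= l2_sqnorm x.
Proof.
apply: nondecreasing_cvgn_le => //.
by apply/nondecreasing_series => k _ _; exact: sqr_ge0.
Qed.

Let l2_sqnorm_ge0 x : 0 <= l2_sqnorm x.
Proof. by apply: le_trans (partial_le x 0); rewrite /series/= big_nat big1. Qed.

Let sqr_l2_norm x : l2_norm x ^+ 2 = l2_sqnorm x.
Proof. by rewrite sqr_sqrtr. Qed.

Let l2_norm0_eq0 x : l2_norm x = 0 -> x = 0.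
Proof.
move=> x0; apply/val_inj/funext => k /=.
have := partial_le x k.+1; rewrite -sqr_l2_norm x0 expr0n/= => h.
apply/eqP; rewrite -sqrf_eq0 eq_le sqr_ge0 andbT; apply: le_trans h.
rewrite /series/= big_nat_recr//= lerDr sumr_ge0// => i _; exact: sqr_ge0.
Qed.

Let l2_norm_0 : l2_norm 0 = 0.
Proof.
rewrite /l2_norm /l2_sqnorm.
have -> : series (fun k => (0 : l2 R) k ^+ 2) = cst 0.
  by apply/funext => n; rewrite /series/= big1// => k _; rewrite expr0n.
by rewrite lim_cst ?sqrtr0.
Qed.

Let l2_normZ (a : R) x : l2_norm (a *: x) = `|a| * l2_norm x.
Proof.
rewrite /l2_norm -sqrtr_sqr -sqrtrM ?sqr_ge0//; congr Num.sqrt.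
rewrite /l2_sqnorm -[RHS](lim_seriesZ _ (@l2_cvg x)); congr (limn (series _)).
by apply/funext => k; exact: exprMn.
Qed.

Let l2_normD x y : l2_norm (x + y) <= l2_norm x + l2_norm y.
Proof.
have [/eqP|x0] := eqVneq (l2_norm x) 0.
  by move=> /eqP/l2_norm0_eq0->; rewrite l2_norm_0 !add0r.
have [/eqP|y0] := eqVneq (l2_norm y) 0.
  by move=> /eqP/l2_norm0_eq0->; rewrite l2_norm_0 !addr0.
rewrite -(@ler_pXn2r _ 2)// ?nnegrE ?addr_ge0 ?sqrtr_ge0//.
set a := l2_norm x in x0 *; set b := l2_norm y in y0 *.
have a0 : 0 < a by rewrite lt0r x0 sqrtr_ge0.
have b0 : 0 < b by rewrite lt0r y0 sqrtr_ge0.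
have [c l] := square_summable_comb (1 + b / a) (1 + a / b) (@l2_cvg x) (@l2_cvg y).
have -> : (a + b) ^+ 2 = (1 + b / a) * l2_sqnorm x + (1 + a / b) * l2_sqnorm y.
  by rewrite -!sqr_l2_norm -/a -/b; field; rewrite x0 y0.
rewrite sqr_l2_norm -[leRHS]l; apply: lim_series_le => // k.
have -> : (x + y) k = x k + y k by [].
rewrite -subr_ge0.
rewrite (_ : _ - _ = (b * x k - a * y k) ^+ 2 / (a * b)); last first.
  by field; rewrite x0 y0.
by rewrite divr_ge0 ?sqr_ge0// mulr_ge0// ltW.
Qed.

HB.instance Definition _ := Lmodule_isNormed.Build R (l2 R)
  l2_normD l2_normZ l2_norm0_eq0.

End l2_normed.

HB.instance Definition _ (R : realType) :=
  Measurable.copy (l2 R) (g_sigma_algebraType (@open (l2 R))).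

Section probability_notions.
Context d (T : measurableType d) (R : realType) (P : probability T R).

Definition mutually_independent d' (T' : measurableType d') (I : choiceType)
    (X : I -> {RV P >-> T'}) : Prop :=
  forall (J : seq I) (A : I -> set T'), uniq J ->
    (forall i, measurable (A i)) ->
    P (\bigcap_(i in [set` J]) (X i @^-1` A i)) =
    (\prod_(i <- J) P (X i @^-1` A i))%E.

Definition identically_distributed d' (T' : measurableType d') (I : Type)
    (X : I -> {RV P >-> T'}) : Prop :=
  forall (i j : I) (A : set T'), measurable A ->
    distribution P (X i) A = distribution P (X j) A.

(* Expectation of a vector-valued function in the weak (Pettis) sense: m is
   characterized by its image under every continuous linear functional. *)
Definition has_expectation (V : normedModType R) (X : T -> V) (m : V) : Prop :=
  forall f : {linear V -> R^o}, continuous f ->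
    P.-integrable setT (EFin \o (f \o X)) /\ ('E_P[f \o X] = (f m)%:E)%E.

(* Uniform distribution on the n indices, numbered 0, ..., n-1. *)
Definition uniform_index (n : nat) (X : {RV P >-> nat}) : Prop :=
  forall j : nat, (j < n)%N -> P (X @^-1` [set j]) = (n%:R^-1)%:E.

End probability_notions.

(* The library norm on row vectors is the sup norm. *)
Definition euclidean_norm (R : realType) (m : nat) (x : 'rV[R]_m) : R :=
  Num.sqrt (\sum_(j < m) x ord0 j ^+ 2).

Definition arith_mean (R : realType) (m n : nat) (x : 'I_n -> 'rV[R]_m) :
    'rV[R]_m :=
  n%:R^-1 *: \sum_(i < n) x i.

(* Samples are numbered from 0: Z 0, ..., Z (n-1) stand for Z_1, ..., Z_n, and
   likewise the coordinates of l2 start at 0. *)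
Section bootstrap.
Context (R : realType) (T Tstar : Type) (dim : nat -> nat).
Variables (Z : nat -> T -> l2 R) (idx : forall n, 'I_n -> Tstar -> nat).

Definition sample (n i : nat) (w : T) : 'rV[R]_(dim n) :=
  \row_(j < dim n) Z i w j.

Definition sample_mean (n : nat) (w : T) : 'rV[R]_(dim n) :=
  arith_mean (fun i : 'I_n => sample n i w).

Definition V_stat (n : nat) (w : T) : R :=
  n%:R * euclidean_norm (sample_mean n w) ^+ 2.

Definition resample (n : nat) (k : 'I_n) (w : T) (ws : Tstar) :
    'rV[R]_(dim n) :=
  sample n (idx k ws) w.

Definition resample_mean (n : nat) (w : T) (ws : Tstar) : 'rV[R]_(dim n) :=
  arith_mean (fun k : 'I_n => resample k w ws - sample_mean n w).

Definition W_stat (n : nat) (w : T) (ws : Tstar) : R :=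
  n%:R * euclidean_norm (resample_mean n w ws) ^+ 2.

End bootstrap.

(* Main.v *)
(* Both statistics are squared norms of sums of n small independent centred steps:
   the steps Z_i / sqrt n for V_n and, for fixed data, steps uniform on the n points
   (Z_i - mean) / sqrt n for W_n.  By the strong law, for almost every sample the
   empirical means, covariances and second moments converge, and two applications of
   Lindeberg's replacement, written for the commuting averaging operators
   g |-> E g(. + step), show that smooth functions of the first m coordinates have
   asymptotically equal means, whatever the common limit.  The coordinates beyond m
   carry little variance, uniformly in n.

   Passing from smooth cutoffs to distribution functions needs a bound on the mass
   that the law of |S|^2 puts on short intervals.  If some coordinate j0 has positive
   variance, the step may be replaced by one with the same covariance that contains an
   independent fair sign times the regression vector on coordinate j0, and the central
   binomial coefficient bounds the concentration of a sum of n such signs along this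
   vector.  If no coordinate has positive variance, both statistics vanish almost
   surely.

   The strong law is proved for bounded variables along the squares, and the unbounded
   remainder is controlled by a bound along powers of 2 that loses a factor 2. *)
From HB Require Import structures.
Require Import Defs.
From mathcomp Require Import all_boot all_order all_algebra ring lra zify.
From mathcomp Require Import all_classical all_reals all_analysis measurable_realfun.

Set Implicit Arguments.
Unset Strict Implicit.
Unset Printing Implicit Defensive.

Import Order.TTheory GRing.Theory Num.Theory.
Import numFieldNormedType.Exports.

Local Open Scope classical_set_scope.
Local Open Scope ring_scope.

(** * Averaging operators *)

(** The delicate point is uniformity in x. The expansion constants of a cutoff hold for all
    thresholds a <= M at once, negative ones included, because a cutoff vanishes once |u|^2 exceeds
    M + 3e; thresholds above M are settled by Markov's inequality, since both laws have bounded
    second moments. The anticoncentration bound is proved for the bootstrap law only: each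
    distribution function is squeezed between cutoffs, and the passage from one cutoff to the next
    can always be made on the bootstrap side. There the steps are finitely valued and the largest of
    them tends to 0, so that they stay small after a sign has been split off. The order of choices
    is eta, e, m, n. The window bound is of order sqrt e with a constant that depends only on the
    coordinate j0 and not on m; the discarded variance is divided by e, so m must come after e; the
    replacement errors vanish in n for fixed e and m. Only second moments are available, which is
    why all remainders have the form |h|^2 min(1, |h|). *)

Section averaging.
Context {R : realType} {V : zmodType}.

(* The n-th iterate of [avg p x] at [u] is the mean of [g] at [u] plus n independent
   steps, each equal to [x i] with probability [p i]. *)
Definition avg (I : finType) (p : I -> R) (x : I -> V) (g : V -> R) (u : V) : R :=
  \sum_i p i * g (u + x i).

Definition weights (I : finType) (p : I -> R) :=
  (forall i, 0 <= p i) /\ \sum_i p i = 1.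

Variables (I : finType) (p : I -> R) (x : I -> V).

Lemma avgB (g h : V -> R) u :
  avg p x g u - avg p x h u = avg p x (fun v => g v - h v) u.
Proof. by rewrite /avg -sumrB; apply: eq_bigr => i _; rewrite mulrBr. Qed.

Lemma avgC (J : finType) (q : J -> R) (y : J -> V) g :
  avg q y (avg p x g) = avg p x (avg q y g).
Proof.
apply/funext => u; rewrite /avg.
under eq_bigr do rewrite mulr_sumr.
rewrite exchange_big; apply: eq_bigr => i _.
rewrite mulr_sumr; apply: eq_bigr => j _.
by rewrite mulrCA addrAC.
Qed.

Lemma iter_avgC (J : finType) (q : J -> R) (y : J -> V) n g :
  avg q y (iter n (avg p x) g) = iter n (avg p x) (avg q y g).
Proof. by elim: n => //= n IH; rewrite avgC IH. Qed.

Hypothesis p1 : weights p.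

Lemma le_avg (g h : V -> R) : (forall v, g v <= h v) ->
  forall u, avg p x g u <= avg p x h u.
Proof.
by move=> gh u; apply: ler_sum => i _; rewrite ler_wpM2l// p1.1.
Qed.

Lemma avg_cst c u : avg p x (fun=> c) u = c.
Proof. by rewrite /avg -mulr_suml p1.2 mul1r. Qed.

Lemma le_iter_avg n (g h : V -> R) : (forall v, g v <= h v) ->
  forall u, iter n (avg p x) g u <= iter n (avg p x) h u.
Proof. by move=> gh; elim: n => //= n IH; apply: le_avg. Qed.

Lemma iter_avg_cst n c u : iter n (avg p x) (fun=> c) u = c.
Proof.
elim: n u => //= n IH u; rewrite -[RHS](avg_cst c u).
by congr (avg _ _ _ _); apply/funext.
Qed.

Lemma iter_avg_le n g c : (forall v, g v <= c) ->
  forall u, iter n (avg p x) g u <= c.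
Proof.
by move=> gc u; rewrite -[leRHS](iter_avg_cst n c u); apply: le_iter_avg.
Qed.

Lemma iter_avg_ge n g c : (forall v, c <= g v) ->
  forall u, c <= iter n (avg p x) g u.
Proof.
by move=> gc u; rewrite -[leLHS](iter_avg_cst n c u); apply: le_iter_avg.
Qed.

Lemma avgD (g h : V -> R) u :
  avg p x (fun v => g v + h v) u = avg p x g u + avg p x h u.
Proof. by rewrite /avg -big_split; apply: eq_bigr => i _; rewrite mulrDr. Qed.

Lemma avgZ c (g : V -> R) u :
  avg p x (fun v => c * g v) u = c * avg p x g u.
Proof. by rewrite /avg mulr_sumr; apply: eq_bigr => i _; rewrite mulrCA. Qed.

Lemma iter_avgD n (g h : V -> R) u :
  iter n (avg p x) (fun v => g v + h v) u =
  iter n (avg p x) g u + iter n (avg p x) h u.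
Proof.
elim: n u => //= n IH u; rewrite -avgD.
by congr (avg _ _ _ _); apply/funext.
Qed.

Lemma iter_avgZ n c (g : V -> R) u :
  iter n (avg p x) (fun v => c * g v) u = c * iter n (avg p x) g u.
Proof.
elim: n u => //= n IH u; rewrite -avgZ.
by congr (avg _ _ _ _); apply/funext.
Qed.

Lemma normr_avg_le g c : (forall v, `|g v| <= c) ->
  forall u, `|avg p x g u| <= c.
Proof.
move=> gc u; rewrite ler_norml; apply/andP; split.
- rewrite -[leLHS](avg_cst _ u); apply: le_avg => v.
  by have := gc v; rewrite ler_norml => /andP[].
- rewrite -[leRHS](avg_cst _ u); apply: le_avg => v.
  by have := gc v; rewrite ler_norml => /andP[].
Qed.

End averaging.

(* Trotter's form of the Lindeberg replacement: the operators commute, so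
   [T^n - S^n] telescopes with each factor applied to [T f - S f]. *)
Lemma iter_avg_close {R : realType} {V : zmodType} (I J : finType)
    (p : I -> R) (x : I -> V) (q : J -> R) (y : J -> V) (f : V -> R) (d : R) n :
  weights p -> weights q ->
  (forall u, `|avg p x f u - avg q y f u| <= d) ->
  forall u, `|iter n (avg p x) f u - iter n (avg q y) f u| <= n%:R * d.
Proof.
move=> p1 q1 fd; elim: n => [|n IH] u; first by rewrite subrr normr0 mul0r.
rewrite [iter n.+1 _ _ u]/= [iter n.+1 (avg q y) _ u]/=.
rewrite -(subrKA (avg p x (iter n (avg q y) f) u)) -natr1 mulrDl mul1r.
apply: le_trans (ler_normD _ _) _; apply: lerD.
  by rewrite avgB; apply: normr_avg_le.
rewrite iter_avgC; change (avg q y (iter n (avg q y) f) u) with (iter n.+1 (avg q y) f u).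
rewrite iterSr.
have E : iter n (avg q y) (avg p x f) u - iter n (avg q y) (avg q y f) u =
  iter n (avg q y) (fun v => avg p x f v + -1 * avg q y f v) u.
  by rewrite iter_avgD// iter_avgZ// mulN1r.
rewrite E ler_norml; apply/andP; split.
- apply: iter_avg_ge => // v; rewrite mulN1r.
  by have := fd v; rewrite ler_norml => /andP[].
- apply: iter_avg_le => // v; rewrite mulN1r.
  by have := fd v; rewrite ler_norml => /andP[].
Qed.

(** * Smooth cutoffs *)

Section smooth_step.
Context {R : realType}.
Implicit Types s t y a e : R.

Definition ramp t : R := Num.max t 0.

(* Integral of the quadratic B-spline with knots 0, 1, 2, 3. *)
Definition step t : R :=
  1 - (ramp t ^+ 3 - 3 * ramp (t - 1) ^+ 3 + 3 * ramp (t - 2) ^+ 3 - ramp (t - 3) ^+ 3) / 6.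
Definition step1 t : R :=
  - (ramp t ^+ 2 - 3 * ramp (t - 1) ^+ 2 + 3 * ramp (t - 2) ^+ 2 - ramp (t - 3) ^+ 2) / 2.
Definition step2 t : R :=
  - (ramp t - 3 * ramp (t - 1) + 3 * ramp (t - 2) - ramp (t - 3)).

Lemma ramp_id t : 0 <= t -> ramp t = t.
Proof. by rewrite /ramp /Num.max; case: ltrP => //; lra. Qed.
Lemma ramp_0 t : t <= 0 -> ramp t = 0.
Proof. by rewrite /ramp /Num.max; case: ltrP => //; lra. Qed.

(** Closed forms on the five pieces between the knots, so that a bound on [step] becomes polynomial
    arithmetic on one piece. *)
Variant step_spec t : R -> R -> R -> Prop :=
| Step0 of t <= 0 : step_spec t 1 0 0
| Step1 of 0 <= t & t <= 1 : step_spec t (1 - t ^+ 3 / 6) (- t ^+ 2 / 2) (- t)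
| Step2 of 1 <= t & t <= 2 : step_spec t (1 - (t ^+ 3 - 3 * (t - 1) ^+ 3) / 6)
   (- (t ^+ 2 - 3 * (t - 1) ^+ 2) / 2) (2 * t - 3)
| Step3 of 2 <= t & t <= 3 : step_spec t ((3 - t) ^+ 3 / 6) (- (3 - t) ^+ 2 / 2) (3 - t)
| Step4 of 3 <= t : step_spec t 0 0 0.

Lemma stepP t : step_spec t (step t) (step1 t) (step2 t).
Proof.
have [t0|t0] := leP t 0.
  have [-> -> ->] : [/\ step t = 1, step1 t = 0 & step2 t = 0].
    by rewrite /step /step1 /step2 !ramp_0; try lra; split; field.
  exact: Step0.
have [t1|t1] := leP t 1.
  have [-> -> ->] : [/\ step t = 1 - t ^+ 3 / 6, step1 t = - t ^+ 2 / 2 & step2 t = - t].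
    by rewrite /step /step1 /step2 [ramp t]ramp_id ?ramp_0; try lra; split; field.
  by apply: Step1; lra.
have [t2|t2] := leP t 2.
  have [-> -> ->] : [/\ step t = 1 - (t ^+ 3 - 3 * (t - 1) ^+ 3) / 6,
      step1 t = - (t ^+ 2 - 3 * (t - 1) ^+ 2) / 2 & step2 t = 2 * t - 3].
    rewrite /step /step1 /step2 [ramp t]ramp_id ?[ramp (t - 1)]ramp_id ?ramp_0; try lra.
    by split; field.
  by apply: Step2; lra.
have [t3|t3] := leP t 3.
  have [-> -> ->] : [/\ step t = (3 - t) ^+ 3 / 6,
      step1 t = - (3 - t) ^+ 2 / 2 & step2 t = 3 - t].
    rewrite /step /step1 /step2 [ramp t]ramp_id ?[ramp (t - 1)]ramp_id
      ?[ramp (t - 2)]ramp_id ?ramp_0; try lra.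
    by split; field.
  by apply: Step3; lra.
have [-> -> ->] : [/\ step t = 0, step1 t = 0 & step2 t = 0].
  by rewrite /step /step1 /step2 !ramp_id; try lra; split; field.
by apply: Step4; lra.
Qed.

Lemma step_ge0 t : 0 <= step t.
Proof.
case: stepP => // [t0 t1|t1 t2|t2 t3].
- have : t ^+ 3 <= 1 by rewrite exprn_ile1.
  by lra.
- have : 0 <= (t - 2) ^+ 2 * (t + 1) by rewrite mulr_ge0 ?sqr_ge0//; lra.
  have : 0 <= (t - 1) * (2 - t) by rewrite mulr_ge0//; lra.
  by nra.
- by rewrite divr_ge0// exprn_ge0//; lra.
Qed.

Lemma step_le1 t : step t <= 1.
Proof.
case: stepP => // [t0 t1|t1 t2|t2 t3].
- by have := exprn_ge0 3 t0; lra.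
- have : (t - 1) ^+ 3 <= 1 by rewrite exprn_ile1//; lra.
  by have := sqr_ge0 (t - 1); nra.
- have : (3 - t) ^+ 3 <= 1 by rewrite exprn_ile1//; lra.
  by lra.
Qed.

Lemma step_id t : t <= 0 -> step t = 1.
Proof. by move=> t0; rewrite /step !ramp_0; try lra; field. Qed.

Lemma step_out t : 3 <= t -> [/\ step t = 0, step1 t = 0 & step2 t = 0].
Proof.
by move=> t3; rewrite /step /step1 /step2 !ramp_id; try lra; split; field.
Qed.

Lemma step1_le t : `|step1 t| <= 1.
Proof. by case: stepP => *; rewrite ler_norml; apply/andP; split; try lra; nra. Qed.

Lemma step2_le t : `|step2 t| <= 1.
Proof. by case: stepP => *; rewrite ler_norml; apply/andP; split; try lra; nra. Qed.

(** The second derivative of the cubed ramp is Lipschitz with constant 6, which gives the remainder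
    |s|^3; the cases are whether t and t + s lie on the same side of the kink. *)
Lemma ramp_taylor t s :
  `|ramp (t + s) ^+ 3 - ramp t ^+ 3 - 3 * ramp t ^+ 2 * s - 3 * ramp t * s ^+ 2| <= `|s| ^+ 3.
Proof.
have [t0|t0] := leP 0 t; have [ts|ts] := leP 0 (t + s).
- rewrite !ramp_id// (_ : _ - _ = s ^+ 3); last by ring.
  by rewrite normrX.
- rewrite [ramp t]ramp_id// [ramp (t + s)]ramp_0; last exact: ltW.
  rewrite (_ : _ - _ = s ^+ 3 - (t + s) ^+ 3); last by ring.
  rewrite (ltr0_norm (_ : s < 0)); last lra.
  have r0 : 0 <= (- (t + s)) ^+ 3 by rewrite exprn_ge0//; lra.
  have rs : (- (t + s)) ^+ 3 <= (- s) ^+ 3 by rewrite lerXn2r ?nnegrE; lra.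
  rewrite (_ : s ^+ 3 - (t + s) ^+ 3 = (- (t + s)) ^+ 3 - (- s) ^+ 3); last by ring.
  by rewrite ler_norml; apply/andP; split; lra.
- rewrite [ramp (t + s)]ramp_id// [ramp t]ramp_0; last exact: ltW.
  rewrite (_ : _ - _ = (t + s) ^+ 3); last by ring.
  rewrite ger0_norm ?exprn_ge0// (@gtr0_norm _ s); last lra.
  by rewrite lerXn2r ?nnegrE; lra.
- rewrite !ramp_0; try exact: ltW.
  by rewrite (_ : _ - _ = 0) ?normr0 ?exprn_ge0//; ring.
Qed.

(** Four shifted copies of the ramp remainder enter with coefficients of total size 8 / 6, which is
    below 2. *)
Lemma step_taylor t s :
  `|step (t + s) - step t - step1 t * s - step2 t * s ^+ 2 / 2| <= 2 * `|s| ^+ 3.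
Proof.
set D := fun t => ramp (t + s) ^+ 3 - ramp t ^+ 3 - 3 * ramp t ^+ 2 * s - 3 * ramp t * s ^+ 2.
have -> : step (t + s) - step t - step1 t * s - step2 t * s ^+ 2 / 2 =
  - (D t - 3 * D (t - 1) + 3 * D (t - 2) - D (t - 3)) / 6.
  by rewrite /step /step1 /step2 /D !(addrAC t s); field.
have := ramp_taylor t s; have := ramp_taylor (t - 1) s.
have := ramp_taylor (t - 2) s; have := ramp_taylor (t - 3) s.
rewrite -!/(D _) !ler_norml => /andP[? ?] /andP[? ?] /andP[? ?] /andP[? ?].
by apply/andP; split; lra.
Qed.

End smooth_step.

(** * Expansion of a cutoff of the squared norm *)

Section inner_product.
Context {R : realType}.
Implicit Types u v h : nat -> R.

Definition dot m u v : R := \sum_(j < m) u j * v j.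

Lemma dotC m u v : dot m u v = dot m v u.
Proof. by apply: eq_bigr => j _; rewrite mulrC. Qed.

Lemma dotDl m u v h : dot m (u + v) h = dot m u h + dot m v h.
Proof. by rewrite /dot -big_split; apply: eq_bigr => j _; exact: mulrDl. Qed.

Lemma dotDr m u v h : dot m h (u + v) = dot m h u + dot m h v.
Proof. by rewrite dotC dotDl !(dotC _ h). Qed.

Lemma dotZl m c u v : dot m (c \*o u) v = c * dot m u v.
Proof. by rewrite /dot mulr_sumr; apply: eq_bigr => j _; rewrite mulrA. Qed.

Lemma dotZr m c u v : dot m u (c \*o v) = c * dot m u v.
Proof. by rewrite dotC dotZl dotC. Qed.

Lemma dot_ge0 m u : 0 <= dot m u u.
Proof. by apply: sumr_ge0 => j _; rewrite -expr2 sqr_ge0. Qed.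

Lemma dot_sqrD m u h : dot m (u + h) (u + h) = dot m u u + (2 * dot m u h + dot m h h).
Proof. by rewrite !dotDl !dotDr (dotC _ h u); ring. Qed.

Lemma dot_cauchy m u v : dot m u v ^+ 2 <= dot m u u * dot m v v.
Proof.
(* This is the squared norm of |x|^2 y - <x, y> x; it settles the claim as soon as one of the two
   vectors has positive norm. *)
have H x y : 0 <= dot m x x * (dot m x x * dot m y y - dot m x y ^+ 2).
  have := dot_ge0 m (dot m x x \*o y + (- dot m x y) \*o x).
  by rewrite dot_sqrD !(dotZl, dotZr) (dotC m y x); congr (0 <= _); ring.
have y0 := dot_ge0 m u; have v0 := dot_ge0 m v.
move: (y0); rewrite le_eqVlt => /orP[/eqP u0|u0]; last first.
  by rewrite -subr_ge0 -(pmulr_rge0 _ u0) H.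
move: (v0); rewrite le_eqVlt => /orP[/eqP v00|v00]; last first.
  by rewrite -subr_ge0 -(pmulr_rge0 _ v00) [dot m u u * _]mulrC dotC H.
(* Both norms vanish here, and the squared norms of u + v and u - v force <u, v> = 0. *)
have := dot_ge0 m (u + v); have := dot_ge0 m (u + (-1) \*o v).
rewrite !dot_sqrD !(dotZl, dotZr) -u0 -v00 => h1 h2.
by rewrite (_ : dot m u v = 0) ?expr0n ?mulr0//; lra.
Qed.

(* Scalar core of the second order expansion of [step ((|u + h|^2 - a) / e)]:
   [y], [d], [q] stand for [|u|^2], [<u, h>], [|h|^2]. *)
Lemma step_quadratic (e M : R) : 0 < e -> exists2 K, 0 <= K &
  forall a y d q : R, a <= M -> 0 <= y -> 0 <= q -> d ^+ 2 <= y * q ->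
  let t := (y - a) / e in
  [/\ `|step ((y + (2 * d + q) - a) / e) - step t - 2 * (step1 t / e) * d
      - (step1 t / e * q + 2 * (step2 t / e ^+ 2) * d ^+ 2)|
      <= K * (q * Num.min 1 (Num.sqrt q)),
    `|step1 t / e| <= K,
    `|step2 t / e ^+ 2| * y <= K &
    `|step1 t / e| * y <= K].
Proof.
move=> e0.
(* Every cutoff with threshold at most [M] is zero from [A] on. *)
have [A A0 AM] : exists2 A, 0 <= A & M + 3 * e <= A.
  by exists (Num.max (M + 3 * e) 0); rewrite le_max lexx ?orbT.
(* If y >= [Y] and q <= 1, then |d| <= y / 4 + q gives y + 2 d + q >= y / 2 - q >= [A], so the
   cutoff vanishes at both ends of the step. *)
have [Y YE Y0] : exists2 Y, Y = 2 * (A + 1) & 0 <= Y by eexists; first by []; lra.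
have [w w0 w2] : exists2 w, 0 <= w & w ^+ 2 = Y.
  by exists (Num.sqrt Y); rewrite ?sqrtr_ge0 ?sqr_sqrtr.
have ei0 : 0 <= e^-1 by rewrite invr_ge0 ltW.
have [K1 EK1 K10] : exists2 K1,
    K1 = 2 * (e^-1 * (2 * w + 1)) ^+ 3 + e^-1 ^+ 2 * (2 * w + 1) & 0 <= K1.
  by eexists; first by []; do ?[apply: addr_ge0|apply: mulr_ge0|apply: exprn_ge0].
have [K2 EK2 K20] : exists2 K2,
    K2 = 1 + 2 * (e^-1 * w) + e^-1 + 2 * (e^-1 ^+ 2 * Y) & 0 <= K2.
  by eexists; first by []; do ?[apply: addr_ge0|apply: mulr_ge0|apply: exprn_ge0].
have [K3 EK3 K30] : exists2 K3, K3 = e^-1 + e^-1 * Y + e^-1 ^+ 2 * Y & 0 <= K3.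
  by eexists; first by []; do ?[apply: addr_ge0|apply: mulr_ge0|apply: exprn_ge0].
exists (K1 + K2 + K3); first by apply: addr_ge0 => //; apply: addr_ge0.
move=> a y d q aM y0 q0 dyq t.
have tout x : A <= x -> 3 <= (x - a) / e.
  by move=> Ax; rewrite ler_pdivlMr//; lra.
have s1 : `|step1 t / e| <= e^-1.
  by rewrite normrM (ger0_norm ei0) ler_piMl// step1_le.
have s2 : `|step2 t / e ^+ 2| <= e^-1 ^+ 2.
  have e2 : 0 <= e ^- 2 by rewrite invr_ge0 exprn_ge0// ltW.
  by rewrite exprVn normrM (ger0_norm e2) ler_piMl// step2_le.
set r := Num.sqrt q.
have r0 : 0 <= r by rewrite sqrtr_ge0.
have qr : q = r ^+ 2 by rewrite sqr_sqrtr.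
have [yY|yY] := leP Y y.
  have [st st1 st2] : [/\ step t = 0, step1 t = 0 & step2 t = 0].
    by apply: step_out; apply: tout; lra.
  rewrite st st1 st2 !(mul0r, mulr0) normr0 mul0r subr0 addr0 !subr0.
  have K0 : 0 <= K1 + K2 + K3 by apply: addr_ge0 => //; apply: addr_ge0.
  split=> //.
  have [r1|r1] := leP r 1.
    rewrite (_ : step _ = 0) ?normr0 ?mulr_ge0//.
    have [|//] := @step_out _ ((y + (2 * d + q) - a) / e); apply: tout.
    have q1 : q <= 1 by rewrite qr expr_le1.
    have : `|d| <= y / 4 + q.
      rewrite -(@ler_pXn2r _ 2)// ?nnegrE ?addr_ge0 ?divr_ge0// real_normK ?num_real//.
      by apply: le_trans dyq _; have := sqr_ge0 (y / 4 - q); nra.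
    by rewrite ler_norml => /andP[? ?]; lra.
  (* A long step: the error is at most 1, hence at most q. *)
  rewrite mulr1 ger0_norm ?step_ge0//; apply: le_trans (step_le1 _) _.
  have q1 : 1 <= q by rewrite qr expr_ge1//  ltW.
  have : 1 <= K2 by rewrite EK2 -!addrA lerDl;
    do ?[apply: addr_ge0|apply: mulr_ge0|apply: exprn_ge0].
  by nra.
have dw : `|d| <= w * r.
  rewrite -(@ler_pXn2r _ 2)// ?nnegrE ?mulr_ge0// real_normK ?num_real//.
  by apply: le_trans dyq _; rewrite exprMn w2 -qr ler_wpM2r// ltW.
have s1y : `|step1 t / e| * y <= e^-1 * Y by rewrite ler_pM// ltW.
have s2y : `|step2 t / e ^+ 2| * y <= e^-1 ^+ 2 * Y by rewrite ler_pM// ltW.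
have Yi1 : 0 <= e^-1 * Y by rewrite mulr_ge0.
have Yi2 : 0 <= e^-1 ^+ 2 * Y by rewrite mulr_ge0 ?exprn_ge0.
split; try lra.
(* In the bounded region, a step with r > 1 has every term bounded by a multiple of q; for r <= 1
   the cubic Taylor bound applies, as |2 d + q| <= (2 w + 1) r. *)
rewrite -/r; have [r1|r1] := leP r 1; last first.
  rewrite mulr1.
  have rq : r <= q by rewrite qr expr2 ler_peMl// ltW.
  have q1 : 1 <= q by lra.
  have B0 : `|step ((y + (2 * d + q) - a) / e) - step t| <= q.
    apply: le_trans q1; rewrite ler_norml; apply/andP.
    have := @step_ge0 _ t; have := @step_le1 _ t.
    have := step_ge0 ((y + (2 * d + q) - a) / e).
    have := step_le1 ((y + (2 * d + q) - a) / e).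
    by split; lra.
  have B1 : `|2 * (step1 t / e) * d| <= 2 * (e^-1 * w) * q.
    rewrite normrM (normrM 2) (ger0_norm (_ : 0 <= 2 :> R))// -!(mulrA 2) ler_wpM2l//.
    by rewrite -mulrA ler_pM// (le_trans dw)// ler_wpM2l.
  have B2 : `|step1 t / e * q| <= e^-1 * q.
    by rewrite normrM (ger0_norm q0) ler_wpM2r.
  have B3 : `|2 * (step2 t / e ^+ 2) * d ^+ 2| <= 2 * (e^-1 ^+ 2 * Y) * q.
    rewrite normrM (normrM 2) (ger0_norm (_ : 0 <= 2 :> R))// -!(mulrA 2) ler_wpM2l//.
    rewrite normrX real_normK ?num_real// -mulrA ler_pM// ?sqr_ge0//.
    by apply: le_trans dyq _; rewrite ler_wpM2r// ltW.
  apply: (@le_trans _ _ (K2 * q)); last by rewrite ler_wpM2r//; lra.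
  clear -B0 B1 B2 B3 EK2; move: B0 B1 B2 B3; rewrite EK2.
  by rewrite !ler_norml => /andP[? ?] /andP[? ?] /andP[? ?] /andP[? ?]; apply/andP; split; lra.
pose s := 2 * d + q.
have sr : `|s| <= (2 * w + 1) * r.
  rewrite (le_trans (ler_normD _ _))// normrM (ger0_norm (_ : 0 <= 2 :> R))// (ger0_norm q0).
  have : q <= r by rewrite qr expr2 ler_piMr.
  by lra.
have T3 : `|step ((y + s - a) / e) - step t - step1 t * (s / e) - step2 t * (s / e) ^+ 2 / 2|
   <= 2 * (e^-1 * (2 * w + 1)) ^+ 3 * (q * r).
  rewrite (_ : (y + s - a) / e = t + s / e); last by rewrite /t -mulrDl addrAC.
  apply: le_trans (step_taylor _ _) _; rewrite -mulrA ler_wpM2l//.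
  rewrite (_ : q * r = r ^+ 3) ?qr -?exprSr// -exprMn lerXn2r ?nnegrE ?normr_ge0//.
    by rewrite !mulr_ge0//; lra.
  by rewrite normrM (ger0_norm ei0) mulrC -mulrA ler_wpM2l.
(* Replacing (2 d + q)^2 / 2 by 2 d^2 leaves 2 d q + q^2 / 2, which is of third order in r. *)
have T2 : `|step2 t / e ^+ 2 * (2 * d * q + q ^+ 2 / 2)| <= e^-1 ^+ 2 * (2 * w + 1) * (q * r).
  rewrite normrM -(mulrA (e^-1 ^+ 2)) ler_pM//.
  rewrite (_ : 2 * d * q + q ^+ 2 / 2 = q * (2 * d + q / 2)); last by field.
  rewrite normrM (ger0_norm q0) mulrCA ler_wpM2l//.
  rewrite (le_trans (ler_normD _ _))// normrM (ger0_norm (_ : 0 <= 2 :> R))//.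
  rewrite (ger0_norm (_ : 0 <= q / 2)) ?divr_ge0//.
  have : q <= r by rewrite qr expr2 ler_piMr.
  by lra.
apply: (@le_trans _ _ (K1 * (q * r))); last by rewrite ler_wpM2r ?mulr_ge0//; lra.
rewrite EK1 (mulrDl (2 * _)); apply: le_trans _ (lerD T3 T2).
rewrite (le_trans _ (ler_normD _ _))//; rewrite le_eqVlt; apply/orP; left; apply/eqP.
congr (`| _ |).
by rewrite -/s /s; field; rewrite gt_eqF.
Qed.

End inner_product.

Section cutoff.
Context {R : realType}.
Implicit Types u v h : nat -> R.

Definition cutoff m (a e : R) u : R := step ((dot m u u - a) / e).

(* Parts of the expansion of [cutoff m a e (u + h)]; the matrix [c] stands for
   [h j * h k] or for its mean. *)
Definition cutoff1 m (a e : R) u h : R :=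
  2 * (step1 ((dot m u u - a) / e) / e) * dot m u h.
Definition cutoff2 m (a e : R) u (c : nat -> nat -> R) : R :=
  step1 ((dot m u u - a) / e) / e * (\sum_(j < m) c j j)
  + 2 * (step2 ((dot m u u - a) / e) / e ^+ 2)
    * (\sum_(j < m) \sum_(k < m) u j * u k * c j k).

Lemma cutoff_ge0 m a e u : 0 <= cutoff m a e u. Proof. exact: step_ge0. Qed.
Lemma cutoff_le1 m a e u : cutoff m a e u <= 1. Proof. exact: step_le1. Qed.

Lemma cutoff_id m a e u : 0 < e -> dot m u u <= a -> cutoff m a e u = 1.
Proof.
by move=> e0 ua; apply: step_id; rewrite pmulr_lle0 ?invr_gt0// subr_le0.
Qed.

Lemma cutoff_out m a e u : 0 < e -> a + 3 * e <= dot m u u -> cutoff m a e u = 0.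
Proof.
move=> e0 ua; rewrite /cutoff; have [|//] := @step_out _ ((dot m u u - a) / e).
by rewrite ler_pdivlMr// lerBrDl.
Qed.

Lemma dot_tensor m u h :
  \sum_(j < m) \sum_(k < m) u j * u k * (h j * h k) = dot m u h ^+ 2.
Proof.
rewrite expr2 /dot big_distrlr; apply: eq_bigr => j _; apply: eq_bigr => k _ /=.
by rewrite mulrACA.
Qed.

Lemma cutoff2B m a e u c d :
  cutoff2 m a e u c - cutoff2 m a e u d = cutoff2 m a e u (fun j k => c j k - d j k).
Proof.
rewrite /cutoff2 sumrB.
have -> : \sum_(j < m) \sum_(k < m) u j * u k * (c j k - d j k) =
  \sum_(j < m) \sum_(k < m) u j * u k * c j k - \sum_(j < m) \sum_(k < m) u j * u k * d j k.
  rewrite -sumrB; apply: eq_bigr => j _; rewrite -sumrB; apply: eq_bigr => k _.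
  by rewrite mulrBr.
by ring.
Qed.

(** The three bounds serve, in this order, the replacement of a step, the comparison of two
    covariances, and the continuity needed for rounding. They are uniform in u because both
    derivatives vanish outside a bounded region, which absorbs the factors [u j * u k]. *)
Lemma cutoff_taylor m (e M : R) : 0 < e -> exists2 K, 0 <= K &
  forall a, a <= M -> forall u h c,
  [/\ `|cutoff m a e (u + h) - cutoff m a e u - cutoff1 m a e u h
       - cutoff2 m a e u (fun j k => h j * h k)|
      <= K * (dot m h h * Num.min 1 (Num.sqrt (dot m h h))),
    `|cutoff2 m a e u c| <= K * \sum_(j < m) \sum_(k < m) `|c j k| &
    `|cutoff m a e (u + h) - cutoff m a e u|
      <= K * (Num.sqrt (dot m h h) + dot m h h)].
Proof.
move=> e0; have [K K0 HK] := step_quadratic M e0.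
exists (4 * K) => [|a aM u h c]; first by rewrite mulr_ge0.
have q0 := dot_ge0 m h; have y0 := dot_ge0 m u; have dyq := dot_cauchy m u h.
have := HK a (dot m u u) (dot m u h) (dot m h h) aM y0 q0 dyq.
rewrite -dot_sqrD -/(cutoff m a e (u + h)) -/(cutoff m a e u) -/(cutoff1 m a e u h).
rewrite /cutoff2 dot_tensor -/(dot m h h) /cutoff1.
move: (step1 _ / e) (step2 _ / e ^+ 2) => s1 s2 [T0 T1 T2 T3].
set q := dot m h h in q0 dyq T0 *; set y := dot m u u in y0 dyq T2 T3 *.
set d := dot m u h in dyq T0 *.
set r := Num.sqrt q in T0 *.
have r0 : 0 <= r by rewrite sqrtr_ge0.
have qr : q = r ^+ 2 by rewrite sqr_sqrtr.
have qm0 : 0 <= q * Num.min 1 r by rewrite mulr_ge0// le_min ler01.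
have qm : q * Num.min 1 r <= q by rewrite ler_piMr// ge_min lexx.
have B1 : `|2 * s1 * d| <= 2 * K * r.
  rewrite -mulrA normrM (ger0_norm (_ : 0 <= 2 :> R))// -mulrA ler_wpM2l//.
  rewrite -(@ler_pXn2r _ 2)// ?nnegrE ?mulr_ge0// real_normK ?num_real//.
  rewrite !exprMn -qr; apply: (@le_trans _ _ (s1 ^+ 2 * (y * q))).
    by rewrite ler_wpM2l ?sqr_ge0.
  rewrite mulrA ler_wpM2r// -(real_normK (num_real s1)) !expr2 -mulrA.
  by rewrite ler_pM// mulr_ge0.
have B2 : `|s1 * q + 2 * s2 * d ^+ 2| <= 3 * K * q.
  apply: le_trans (ler_normD _ _) _.
  rewrite -mulrA (normrM 2) (ger0_norm (_ : 0 <= 2 :> R))// (normrM s1) (normrM s2) normrX.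
  rewrite real_normK ?num_real// (ger0_norm q0).
  have : `|s1| * q <= K * q by rewrite ler_wpM2r.
  have : `|s2| * d ^+ 2 <= K * q.
    apply: (@le_trans _ _ (`|s2| * (y * q))); first by rewrite ler_wpM2l.
    by rewrite mulrA ler_wpM2r.
  by lra.
have Kqm0 : 0 <= K * (q * Num.min 1 r) by rewrite mulr_ge0.
have Kqm : K * (q * Num.min 1 r) <= K * q by rewrite ler_wpM2l.
have Kr : 0 <= K * r by rewrite mulr_ge0.
split.
- by apply: le_trans T0 _; rewrite -mulrA; lra.
- set S2 := (X in _ <= _ * X); set S1 := (X in 2 * s2 * X).
  set S := (X in s1 * X).
  have S20 : 0 <= S2 by apply: sumr_ge0 => j _; apply: sumr_ge0.
  have H1 : `|S| <= S2.
    apply: le_trans (ler_norm_sum _ _ _) _; apply: ler_sum => j _.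
    by rewrite (bigD1 j)//= lerDl sumr_ge0.
  have uy (j : 'I_m) : `|u j| ^+ 2 <= y.
    rewrite real_normK ?num_real// /y /dot (bigD1 j)//= -expr2 lerDl.
    by apply: sumr_ge0 => k _; rewrite -expr2 sqr_ge0.
  have H2 : `|S1| <= y * S2.
    rewrite /S2 mulr_sumr; apply: le_trans (ler_norm_sum _ _ _) _; apply: ler_sum => j _.
    rewrite mulr_sumr; apply: le_trans (ler_norm_sum _ _ _) _; apply: ler_sum => k _.
    rewrite normrM ler_wpM2r// normrM.
    by have := uy j; have := uy k; have := sqr_ge0 (`|u j| - `|u k|); nra.
  apply: le_trans (ler_normD _ _) _.
  rewrite -mulrA (normrM 2) (ger0_norm (_ : 0 <= 2 :> R))// !normrM.
  have : `|s1| * `|S| <= K * S2 by rewrite ler_pM.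
  have : `|s2| * `|S1| <= K * S2.
    apply: (@le_trans _ _ (`|s2| * (y * S2))); first by rewrite ler_wpM2l.
    by rewrite mulrA ler_wpM2r.
  have : 0 <= K * S2 by rewrite mulr_ge0.
  by lra.
- move: T0 B1 B2; move: (cutoff _ _ _ (u + h) - cutoff _ _ _ u) => b.
  rewrite !ler_norml => /andP[? ?] /andP[? ?] /andP[? ?].
  have Kq : 0 <= K * q by rewrite mulr_ge0.
  by apply/andP; split; lra.
Qed.

(** Centring removes the first-order part; up to the Lindeberg remainder, one averaging step sees
    its law only through the covariance. *)
Lemma avg_cutoff (I : finType) (p : I -> R) (x : I -> nat -> R) m (e M K : R) :
  weights p ->
  (forall a, a <= M -> forall u h,
    `|cutoff m a e (u + h) - cutoff m a e u - cutoff1 m a e u h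
       - cutoff2 m a e u (fun j k => h j * h k)|
      <= K * (dot m h h * Num.min 1 (Num.sqrt (dot m h h)))) ->
  (forall j, (j < m)%N -> \sum_i p i * x i j = 0) ->
  forall a, a <= M -> forall u,
  `|avg p x (cutoff m a e) u - cutoff m a e u
     - cutoff2 m a e u (fun j k => \sum_i p i * (x i j * x i k))| <=
  K * \sum_i p i * (dot m (x i) (x i) * Num.min 1 (Num.sqrt (dot m (x i) (x i)))).
Proof.
move=> [p0 p1] HK x0 a aM u.
have E1 : \sum_i p i * cutoff1 m a e u (x i) = 0.
  rewrite /cutoff1; under eq_bigr do rewrite mulrCA.
  rewrite -mulr_sumr (_ : \sum_i p i * dot m u (x i) = 0) ?mulr0//.
  transitivity (\sum_(j < m) u j * \sum_i p i * x i j).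
    under [RHS]eq_bigr do rewrite mulr_sumr.
    rewrite exchange_big; apply: eq_bigr => i _; rewrite mulr_sumr.
    by apply: eq_bigr => j _; rewrite mulrCA.
  by rewrite big1// => j _; rewrite x0 ?mulr0.
have E2 : \sum_i p i * cutoff2 m a e u (fun j k => x i j * x i k) =
    cutoff2 m a e u (fun j k => \sum_i p i * (x i j * x i k)).
  rewrite /cutoff2; move: (step1 _ / e) (2 * _) => s1 s2.
  under eq_bigr do rewrite mulrDr.
  have pull (s : R) (F : I -> R) : \sum_i p i * (s * F i) = s * \sum_i p i * F i.
    by rewrite mulr_sumr; apply: eq_bigr => i _; rewrite mulrCA.
  have swap (F : I -> 'I_m -> R) :
      \sum_i p i * (\sum_j F i j) = \sum_j \sum_i p i * F i j.
    by rewrite exchange_big; apply: eq_bigr => i _; rewrite mulr_sumr.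
  rewrite big_split !pull !swap; congr (_ + _ * _).
  apply: eq_bigr => j _; rewrite swap; apply: eq_bigr => k _; exact: pull.
have -> : avg p x (cutoff m a e) u - cutoff m a e u
     - cutoff2 m a e u (fun j k => \sum_i p i * (x i j * x i k)) =
  \sum_i p i * (cutoff m a e (u + x i) - cutoff m a e u - cutoff1 m a e u (x i) -
     cutoff2 m a e u (fun j k => x i j * x i k)).
  transitivity (\sum_i (p i * cutoff m a e (u + x i) - p i * cutoff m a e u
      - p i * cutoff1 m a e u (x i) - p i * cutoff2 m a e u (fun j k => x i j * x i k))).
    by rewrite 3!sumrB E1 E2 -mulr_suml p1 mul1r subr0.
  by apply: eq_bigr => i _; rewrite -!mulrBr.
rewrite mulr_sumr; apply: le_trans (ler_norm_sum _ _ _) _; apply: ler_sum => i _.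
by rewrite normrM (ger0_norm (p0 i)) mulrCA ler_wpM2l// HK.
Qed.

End cutoff.

(** * Anticoncentration *)

Section central_binomial.
Local Open Scope nat_scope.

Lemma bin_double_le_mid m k : 'C(m.*2, k) <= 'C(m.*2, m).
Proof.
have up j : (j <= m)%N -> 'C(m.*2, m - j) <= 'C(m.*2, m).
  elim: j => [|j IH] jm; first by rewrite subn0.
  apply: leq_trans (IH (ltnW jm)).
  rewrite -(@leq_pmul2l (m - j)) ?subn_gt0//.
  have E := mul_bin_left m.*2 (m - j.+1).
  have e1 : (m - j.+1).+1 = m - j by lia.
  rewrite e1 in E; rewrite E leq_mul2r; apply/orP; right; lia.
have [km|mk] := leqP k m.
  by have := up (m - k) (leq_subr _ _); rewrite subKn.
have [km2|mk2] := leqP k m.*2; last by rewrite bin_small.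
rewrite -bin_sub//; have := up (k - m).
have -> : m - (k - m) = m.*2 - k by lia.
apply; lia.
Qed.

(** Consecutive central coefficients have ratio 2 (2m + 1) / (m + 1), and the induction closes
    because (2m + 1) (2m + 3) <= 4 (m + 1)^2. *)
Lemma bin_mid_sqr m : 'C(m.*2, m) ^ 2 * m.*2.+1 <= 16 ^ m.
Proof.
elim: m => [|m IH]; first by rewrite bin0.
have E : 'C(m.+1.*2, m.+1) * m.+1 = 'C(m.*2, m) * (2 * m.*2.+1).
  have e1 := mul_bin_left m.*2.+1 m; have e2 := mul_bin_diag m.*2.+1 m.
  have e3 := mul_bin_diag m.*2 m; have e4 := mul_bin_down m.*2.+1 m.
  rewrite /= in e1 e2 e3 e4.
  rewrite doubleS binS.
  have -> : 'C(m.*2.+1, m.+1) = 'C(m.*2.+1, m).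
    by rewrite -bin_sub ?ltnS -?addnn ?leq_addr//; congr ('C(_, _)); lia.
  move: e4; have -> : m.*2.+1 - m = m.+1 by lia.
  lia.
rewrite -(@leq_pmul2r (m.+1 ^ 2)) ?expn_gt0// mulnAC -expnMn E.
have -> : ('C(m.*2, m) * (2 * m.*2.+1)) ^ 2 * m.+1.*2.+1 =
    'C(m.*2, m) ^ 2 * m.*2.+1 * (4 * (m.*2.+1 * m.+1.*2.+1)).
  by move: 'C(_, _) m.*2.+1 m.+1.*2.+1 => x y z; rewrite -!mulnn; lia.
have -> : 16 ^ m.+1 * m.+1 ^ 2 = 16 ^ m * (4 * (4 * m.+1 ^ 2)) by rewrite expnS; lia.
apply: leq_mul => //; rewrite leq_mul2l/= -!mul2n -mulnn; lia.
Qed.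

(** For even n the middle coefficient is the largest; an odd row is compared with the even row
    before it by Pascal's rule. After a square root, every atom of the fair binomial law has mass at
    most 1 / sqrt n. *)
Lemma bin_sqr_le n k : 'C(n, k) ^ 2 * n <= 4 ^ n.
Proof.
have M m : 'C(m.*2, m) ^ 2 * m.*2.+1 <= 4 ^ m.*2.
  by rewrite -[X in 4 ^ X]mul2n expnM; exact: bin_mid_sqr.
rewrite -(odd_double_half n); set m := n./2.
case: (odd n); rewrite ?add0n ?add1n.
  have B : 'C(m.*2.+1, k) <= 2 * 'C(m.*2, m).
    case: k => [|k]; first by rewrite bin0; have := bin_double_le_mid m 0; rewrite bin0; lia.
    by rewrite binS [leqRHS]mul2n -[leqRHS]addnn leq_add// bin_double_le_mid.
  rewrite [leqRHS]expnS; have := M m.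
  have : 'C(m.*2.+1, k) ^ 2 <= (2 * 'C(m.*2, m)) ^ 2 by rewrite leq_exp2r.
  rewrite expnMn => h1 h2; apply: leq_trans (leq_mul h1 (leqnn _)) _; rewrite -mulnA.
exact: leq_mul (leqnn 4) h2.
apply: leq_trans (M m); apply: leq_mul; last exact: leqnSn.
by rewrite leq_exp2r// bin_double_le_mid.
Qed.

Lemma card_window n (A : {set 'I_n}) D :
  (forall i j, i \in A -> j \in A -> (i <= j)%N -> j - i <= D) -> #|A| <= D.+1.
Proof.
move=> AD; have [->|[i0 i0A]] := set_0Vmem A; first by rewrite cards0.
case: (arg_minnP (fun i : 'I_n => (i : nat)) i0A) => i iA imin.
rewrite cardE -(size_map val) -(size_iota i D.+1); apply: uniq_leq_size.
  by rewrite map_inj_uniq ?enum_uniq//; exact: val_inj.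
move=> _ /mapP[j jA ->]; rewrite mem_enum in jA.
rewrite mem_iota; have ij := imin _ jA; have := AD _ _ iA jA ij.
by rewrite ij/=; lia.
Qed.

End central_binomial.

Section signs.
Context {R : realType}.
Implicit Types c u : nat -> R.

Definition coin (b : bool) : R := 2^-1.
Definition signed c (b : bool) : nat -> R := (if b then 1 else -1) \*o c.

Lemma coin_weights : weights coin.
Proof. by split=> [b|]; [rewrite /coin invr_ge0|rewrite big_bool /coin /=; field]. Qed.

(** With k positive signs among n the sum is 2k - n, and the recursion in n is Pascal's rule. *)
Lemma iter_signed c n (g : (nat -> R) -> R) u :
  iter n (avg coin (signed c)) g u =
  \sum_(k < n.+1) 'C(n, k)%:R / 2 ^+ n * g (u + ((2 * k%:R - n%:R) \*o c)).
Proof.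
elim: n u => [|n IH] u.
  rewrite big_ord_recl big_ord0 /= bin0 expr0 divr1 mul1r addr0; congr g.
  apply/funext => j; transitivity (u j + (2 * 0%:R - 0%:R) * c j); last by [].
  by rewrite mulr0 subr0 mul0r addr0.
pose G k := g (u + ((2 * k%:R - n.+1%:R) \*o c)).
have G1 (k : nat) b : g (u + signed c b + ((2 * k%:R - n%:R) \*o c)) = G (k + b)%N.
  rewrite /G -addrA; congr (g (_ + _)); apply/funext => j.
  rewrite /signed /= -[n.+1]addn1 !natrD -[LHS]mulrDl; congr (_ * _).
  by case: b => /=; ring.
have S b : iter n (avg coin (signed c)) g (u + signed c b) =
    \sum_(k < n.+1) ('C(n, k)%:R / 2 ^+ n * G (k + b)%N).
  by rewrite IH; apply: eq_bigr => k _; rewrite G1.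
rewrite iterS {1}/avg big_bool !S /coin.
transitivity (\sum_(k < n.+2) ('C(n.+1, k)%:R / 2 ^+ n.+1 * G k)); last by [].
have E k : 'C(n.+1, k.+1)%:R / 2 ^+ n.+1 * G k.+1 =
   2^-1 * ('C(n, k.+1)%:R / 2 ^+ n * G k.+1) + 2^-1 * ('C(n, k)%:R / 2 ^+ n * G k.+1).
  rewrite binS natrD exprS; field.
  by rewrite expf_neq0// pnatr_eq0.
rewrite [RHS]big_ord_recl.
under [in RHS]eq_bigr do rewrite lift0 E.
rewrite big_split addrA; rewrite [RHS]addrC; congr (_ + _).
  by rewrite mulr_sumr; apply: eq_bigr => k _; rewrite addn1.
under [in LHS]eq_bigr do rewrite addn0.
rewrite -mulr_sumr.
have -> : 'C(n.+1, 0)%:R / 2 ^+ n.+1 * G 0%N = 2^-1 * ('C(n, 0)%:R / 2 ^+ n * G 0%N).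
  by rewrite !bin0 exprS; field; rewrite expf_neq0// pnatr_eq0.
rewrite -mulrDr; congr (_ * _).
rewrite [LHS]big_ord_recl; congr (_ + _).
rewrite [RHS]big_ord_recr /= bin_small// mul0r mul0r addr0.
by apply: eq_bigr.
Qed.

Lemma bin_half_le n k : (0 < n)%N -> 'C(n, k)%:R / 2 ^+ n <= (Num.sqrt n%:R)^-1 :> R.
Proof.
move=> n0; have n0R : 0 < n%:R :> R by rewrite ltr0n.
have s0 : 0 < Num.sqrt n%:R :> R by rewrite sqrtr_gt0.
rewrite ler_pdivrMr ?exprn_gt0// mulrC ler_pdivlMr//.
rewrite -(@ler_pXn2r _ 2) ?nnegrE ?exprn_ge0 ?mulr_ge0 ?sqrtr_ge0//.
rewrite exprMn sqr_sqrtr ?ler0n// exprAC.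
have := bin_sqr_le n k; rewrite -(ler_nat R) natrM !natrX.
by rewrite (_ : 2 ^+ 2 = 4 :> R)//; ring.
Qed.

(* On either side of the vertex of the parabola [r |-> |u + r c|^2], two points
   at distance [d] have values at least [|c|^2 d^2] apart. *)
Lemma signed_anticoncentration m c n a b u :
  (0 < n)%N -> 0 < dot m c c -> a <= b ->
  iter n (avg coin (signed c)) (fun v => (a <= dot m v v <= b)%R%:R) u <=
  2 * (Num.sqrt ((b - a) / (4 * dot m c c)) + 1) / Num.sqrt n%:R.
Proof.
move=> n0 c0 ab; rewrite iter_signed.
set s := Num.sqrt (_ / _).
pose r (k : nat) : R := 2 * k%:R - n%:R.
pose inside (k : 'I_n.+1) := a <= dot m (u + (r k \*o c)) (u + (r k \*o c)) <= b.
(* Half the derivative in r of the parabola |u + r c|^2; its sign tells the side of the vertex. *)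
pose right (k : 'I_n.+1) := 0 <= r k * dot m c c + dot m u c.
pose A1 := [set k | inside k && right k]%SET; pose A2 := [set k | inside k && ~~ right k]%SET.
pose D := Num.truncn s.
have s0 : 0 <= s by rewrite sqrtr_ge0.
have Ds : D%:R <= s by rewrite truncn_le.
have main (k l : 'I_n.+1) : (k <= l)%N -> inside k -> inside l -> right k = right l ->
    (l - k <= D)%N.
  move=> kl /andP[ka kb] /andP[la lb] E.
  rewrite truncn_ge_nat// -(@ler_pXn2r _ 2) ?nnegrE ?ler0n// sqr_sqrtr; last first.
    by rewrite divr_ge0 ?subr_ge0// mulr_ge0// ltW.
  rewrite ler_pdivlMr ?mulr_gt0// natrB//.
  move: ka kb la lb; rewrite !dot_sqrD !(dotZl, dotZr) => ka kb la lb.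
  (* Neighbouring positions differ by 2, which is the source of the factor 4 in the statement. *)
  have rkl : r l - r k = 2 * (l%:R - k%:R) by rewrite /r; ring.
  have lk0 : 0 <= l%:R - k%:R :> R by rewrite subr_ge0 ler_nat.
  set G := dot m c c in c0 ka kb la lb E *; set d := dot m u c in ka kb la lb E *.
  have : 0 <= (r k * G + d) * (r l - r k) \/ 0 <= - (r l * G + d) * (r l - r k).
    move: E; rewrite /right -/G -/d; case: (leP 0 (r k * G + d)) => h.
      by left; rewrite rkl mulr_ge0 ?mulr_ge0.
    by move/esym/negbT; rewrite -ltNge => h2; right; rewrite rkl mulr_ge0 ?mulr_ge0// oppr_ge0 ltW.
  move: rkl; move: (r k) (r l) ka kb la lb => x y ka kb la lb rkl.
  rewrite (_ : (l%:R - k%:R) ^+ 2 * (4 * G) = (y - x) ^+ 2 * G); last by rewrite rkl; ring.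
  by case=> h; nra.
have cA : (#|A1| + #|A2| <= 2 * D.+1)%N.
  rewrite mul2n -addnn leq_add// card_window// => i j; rewrite !inE => /andP[i1 i2] /andP[j1 j2] ij.
    by apply: main; rewrite ?i2 ?j2.
  by apply: main => //; rewrite (negbTE i2) (negbTE j2).
(* At most [D.+1] indices lie on each side of the vertex, each with mass at most 1 / sqrt n. *)
apply: (@le_trans _ _ (\sum_(k in A1 :|: A2) (Num.sqrt n%:R)^-1)).
  rewrite [leRHS]big_mkcond /=; apply: ler_sum => k _.
  rewrite -/(r k) -/(inside k) !inE.
  case: (inside k) => /=; last by rewrite mulr0.
  by rewrite orbN mulr1 bin_half_le.
rewrite sumr_const -[leLHS]mulr_natl ler_wpM2r ?invr_ge0 ?sqrtr_ge0//.
apply: (@le_trans _ _ (2 * D.+1)%:R).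
  by rewrite ler_nat (leq_trans _ cA)// cardsU leq_subr.
by rewrite natrM ler_wpM2l// -natr1 lerD2r.
Qed.

End signs.

Section product_law.
Context {R : realType} {V : zmodType} (I J : finType).
Variables (p : I -> R) (x : I -> V) (q : J -> R) (y : J -> V).

Definition pair_weight (a : I * J) : R := p a.1 * q a.2.
Definition pair_step (a : I * J) : V := x a.1 + y a.2.

Lemma sum_pair (F : I * J -> R) :
  \sum_a F a = \sum_i \sum_j F (i, j).
Proof. by rewrite pair_big; apply: eq_bigr => -[i j]. Qed.

Lemma pair_weights : weights p -> weights q -> weights pair_weight.
Proof.
move=> [p0 p1] [q0 q1]; split=> [[i j]|]; first by rewrite mulr_ge0.
rewrite sum_pair /pair_weight /= -[RHS]p1; apply: eq_bigr => i _.
by rewrite -mulr_sumr q1 mulr1.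
Qed.

Lemma avg_pair g : avg pair_weight pair_step g = avg p x (avg q y g).
Proof.
apply/funext => u; rewrite {1}/avg sum_pair {1}/avg; apply: eq_bigr => i _.
by rewrite /avg mulr_sumr; apply: eq_bigr => j _; rewrite mulrA addrA.
Qed.

(** When a step is a sum of two independent parts, commutation allows all averages over one part to
    be carried out before those over the other. *)
Lemma iter_avg_pair n g :
  iter n (avg pair_weight pair_step) g = iter n (avg p x) (iter n (avg q y) g).
Proof.
elim: n g => //= n IH g; rewrite avg_pair IH; congr (avg p x _).
elim: n {IH} (iter _ _ g) => //= n IH h.
by rewrite avgC -IH.
Qed.

Lemma iter_iter_avgC n k g :
  iter k (avg p x) (iter n (avg q y) g) = iter n (avg q y) (iter k (avg p x) g).
Proof. by elim: k g => //= k IH g; rewrite IH iter_avgC. Qed.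

End product_law.

(** * Splitting an independent sign off a step *)

Section regression.
Context {R : realType}.
Variables (I : finType) (p : I -> R) (x : I -> nat -> R) (m j0 : nat).

(** The Lindeberg remainder of a single step, in the form in which [avg_cutoff] produces it. *)
Definition mean_min (I : finType) (p : I -> R) (x : I -> nat -> R) : R :=
  \sum_i p i * (dot m (x i) (x i) * Num.min 1 (Num.sqrt (dot m (x i) (x i)))).

Definition cov (I : finType) (p : I -> R) (x : I -> nat -> R) (j k : nat) : R :=
  \sum_i p i * (x i j * x i k).

Lemma mean_min_le (J : finType) (q : J -> R) (y : J -> nat -> R) r :
  weights q -> (forall i, dot m (y i) (y i) <= r) ->
  mean_min q y <= Num.sqrt r * \sum_(j < m) cov q y j j.
Proof.
move=> [q0 _] yr.
rewrite [leRHS](_ : _ = \sum_i Num.sqrt r * (q i * dot m (y i) (y i))); last first.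
  rewrite -mulr_sumr; congr (_ * _); rewrite /cov exchange_big; apply: eq_bigr => i _.
  by rewrite mulr_sumr.
apply: ler_sum => i _; rewrite mulrA mulrC ler_pM ?mulr_ge0 ?dot_ge0//.
by rewrite ge_min ler_wsqrtr ?orbT.
Qed.

Hypothesis p1 : weights p.
Hypothesis x0 : forall j, (j < m)%N -> \sum_i p i * x i j = 0.
Hypothesis j0m : (j0 < m)%N.
Let s2 := cov p x j0 j0.
Hypothesis s20 : 0 < s2.
Let s := Num.sqrt s2.

(** [slope] is the covariance of the step with its normalised coordinate x j0 / s, that is, the
    regression vector; [residual] is uncorrelated with that coordinate. *)
Definition slope j : R := cov p x j j0 / s.
Definition residual i j : R := x i j - x i j0 / s * slope j.
(** The random coefficient x j0 / s of [slope] is exchanged for an independent fair sign. Both have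
    mean 0 and variance 1, so the covariance of the step is preserved. *)
Let q : bool * I -> R := pair_weight coin p.
Let y : bool * I -> nat -> R := pair_step (signed slope) residual.

Let s0 : 0 < s. Proof. by rewrite sqrtr_gt0. Qed.
Let ss : s ^+ 2 = s2. Proof. by rewrite sqr_sqrtr// ltW. Qed.

Lemma residual_mean j : (j < m)%N -> \sum_i p i * residual i j = 0.
Proof.
move=> jm; rewrite /residual.
transitivity (\sum_i p i * x i j - slope j / s * \sum_i p i * x i j0).
  by rewrite mulr_sumr -sumrB; apply: eq_bigr => i _; ring.
by rewrite !x0// mulr0 subr0.
Qed.

Lemma residual_cov j k :
  \sum_i p i * (residual i j * residual i k) = cov p x j k - slope j * slope k.
Proof.
transitivity (cov p x j k - slope k / s * cov p x j j0 - slope j / s * cov p x k j0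
    + slope j * slope k / s2 * cov p x j0 j0).
  rewrite /cov !mulr_sumr -!sumrB -big_split; apply: eq_bigr => i _ /=.
  by rewrite /residual -ss; field; rewrite gt_eqF.
have E l : cov p x l j0 = slope l * s by rewrite /slope divfK ?gt_eqF.
rewrite divfK ?gt_eqF// !E.
by field; rewrite gt_eqF.
Qed.

Lemma split_weights : weights q.
Proof. exact: pair_weights coin_weights p1. Qed.

Lemma split_mean j : (j < m)%N -> \sum_a q a * y a j = 0.
Proof.
move=> jm; rewrite sum_pair big_bool /q /y /pair_weight /pair_step /=.
rewrite -big_split /=.
transitivity (\sum_i p i * residual i j); last exact: residual_mean.
apply: eq_bigr => i _; rewrite /coin.
change (2^-1 * p i * (1 * slope j + residual i j) +
  2^-1 * p i * (- 1 * slope j + residual i j) = p i * residual i j).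
by field.
Qed.

Lemma split_cov j k : cov q y j k = cov p x j k.
Proof.
rewrite /cov sum_pair big_bool -big_split /=.
transitivity (\sum_i (p i * (slope j * slope k) + p i * (residual i j * residual i k))).
  apply: eq_bigr => i _; rewrite /q /y /pair_weight /pair_step /coin /=.
  change (2^-1 * p i * ((1 * slope j + residual i j) * (1 * slope k + residual i k)) +
  2^-1 * p i * ((- 1 * slope j + residual i j) * (- 1 * slope k + residual i k)) =
  p i * (slope j * slope k) + p i * (residual i j * residual i k)).
  by field.
by rewrite big_split /= residual_cov -mulr_suml p1.2 mul1r addrC subrK.
Qed.

Lemma cov_cauchy j k : cov p x j k ^+ 2 <= cov p x j j * cov p x k k.
Proof.
have c0 l : 0 <= cov p x l l.
  by apply: sumr_ge0 => i _; rewrite mulr_ge0 ?p1.1// -expr2 sqr_ge0.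
have H a b : 0 <= a ^+ 2 * cov p x j j + 2 * (a * b) * cov p x j k + b ^+ 2 * cov p x k k.
  rewrite /cov !mulr_sumr -!big_split; apply: sumr_ge0 => i _ /=.
  rewrite (_ : _ + _ = p i * (a * x i j + b * x i k) ^+ 2); last by ring.
  by rewrite mulr_ge0 ?p1.1 ?sqr_ge0.
move: (c0 j) (c0 k) H; move: (cov _ _ j j) (cov _ _ k k) (cov _ _ j k) => A B D A0 B0 H.
have [BA|BA] := eqVneq (A + B) 0.
  have [-> ->] : A = 0 /\ B = 0 by split; lra.
  have := H 1 1; have := H 1 (-1); have := H 1 (- D); have := H 1 D.
  by nra.
(* The two choices give B (A B - D^2) >= 0 and A (A B - D^2) >= 0; their sum needs only A + B >
   0. *)
have H1 := H B (- D); have H2 := H (- D) A.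
have AB : 0 < A + B by lra.
have : 0 <= (A + B) * (A * B - D ^+ 2) by nra.
by rewrite pmulr_rge0// subr_ge0.
Qed.

Lemma slope_sqr_ge : s2 <= dot m slope slope.
Proof.
rewrite /dot (bigD1 (Ordinal j0m))//= (_ : slope j0 * slope j0 = s2).
  by rewrite lerDl sumr_ge0// => j _; rewrite -expr2 sqr_ge0.
by rewrite /slope -/s2 -ss; field; rewrite gt_eqF.
Qed.

Lemma slope_sqr_le : dot m slope slope <= \sum_(j < m) cov p x j j.
Proof.
apply: ler_sum => j _; rewrite -expr2 /slope exprMn exprVn ss ler_pdivrMr//.
exact: cov_cauchy.
Qed.

(** The inequality |u + v|^2 <= 2 |u|^2 + 2 |v|^2 is used twice, with |slope|^2 at most the total
    variance and the squared coordinate j0 at most r. The bound tends to 0 with r and the total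
    variance as long as the ratio of that variance to [s2] stays bounded. *)
Lemma split_bound r : (forall i, dot m (x i) (x i) <= r) -> forall a,
  dot m (y a) (y a) <= 2 * (\sum_(j < m) cov p x j j) +
    4 * r * (1 + (\sum_(j < m) cov p x j j) / s2).
Proof.
move=> xr [b i].
have D2 (u v : nat -> R) : dot m (u + v) (u + v) <= 2 * dot m u u + 2 * dot m v v.
  have := dot_ge0 m (u + (-1) \*o v).
  by rewrite !dot_sqrD dotZl !dotZr; lra.
have -> : y (b, i) = signed slope b + (x i + (- (x i j0 / s)) \*o slope).
  apply/funext => j; rewrite /y /pair_step /=; congr (_ + _).
  by rewrite /residual -mulNr.
apply: le_trans (D2 _ _) _.
have -> : dot m (signed slope b) (signed slope b) = dot m slope slope.
  by rewrite /signed dotZl dotZr; case: b; ring.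
have H := D2 (x i) ((- (x i j0 / s)) \*o slope).
rewrite dotZl dotZr in H.
have xj : x i j0 ^+ 2 <= r.
  apply: le_trans (xr i); rewrite /dot (bigD1 (Ordinal j0m))//= -expr2.
  by rewrite lerDl sumr_ge0// => j _; rewrite -expr2 sqr_ge0.
have r0 : 0 <= r by apply: le_trans xj; rewrite sqr_ge0.
have : x i j0 ^+ 2 * dot m slope slope <= r * \sum_(j < m) cov p x j j.
  by rewrite ler_pM ?sqr_ge0 ?dot_ge0// slope_sqr_le.
rewrite -(@ler_pM2r _ s2^-1) ?invr_gt0// => H3.
have H4 : - (x i j0 / s) * (- (x i j0 / s) * dot m slope slope) =
  x i j0 ^+ 2 * dot m slope slope / s2 by rewrite -ss; field; rewrite gt_eqF.
rewrite H4 in H; have := slope_sqr_le; have := xr i.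
rewrite [4 * r * _]mulrDr mulr1.
rewrite (_ : 4 * r * (_ / s2) = 4 * (r * (\sum_(j < m) cov p x j j) / s2)); last by ring.
by lra.
Qed.

(* The law [(q, y)] has the same covariance and an independent fair sign, whose
   contribution along [slope] spreads out. *)
Lemma cutoff_window n (e M K r a v : R) : v = \sum_(j < m) cov p x j j ->
   (0 < n)%N -> 0 < e -> a <= M -> 0 <= K ->
  (forall a, a <= M -> forall u h,
    `|cutoff m a e (u + h) - cutoff m a e u - cutoff1 m a e u h
       - cutoff2 m a e u (fun j k => h j * h k)|
      <= K * (dot m h h * Num.min 1 (Num.sqrt (dot m h h)))) ->
  (forall i, dot m (x i) (x i) <= r) ->
  iter n (avg p x) (cutoff m a e) 0 - iter n (avg p x) (cutoff m (a - 6 * e) e) 0 <=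
  2 * (n%:R * (K * (Num.sqrt r * v +
     Num.sqrt (2 * v + 4 * r * (1 + v / s2)) * v)))
  + 2 * (Num.sqrt (9 * e / (4 * s2)) + 1) / Num.sqrt n%:R.
Proof.
move=> vE n0 e0 aM K0 HK xr.
have close b : b <= M -> `|iter n (avg p x) (cutoff m b e) 0 - iter n (avg q y) (cutoff m b e) 0| <=
   n%:R * (K * (Num.sqrt r * v + Num.sqrt (2 * v + 4 * r * (1 + v / s2)) * v)).
  move=> bM; apply: iter_avg_close => //; first exact: split_weights.
  move=> u.
  have A1 := avg_cutoff p1 HK x0 bM u.
  have A2 := avg_cutoff split_weights HK split_mean bM u.
  (* Equal covariances make the second-order parts coincide, so only the two remainders survive. *)
  have E : cutoff2 m b e u (fun j k => \sum_a q a * (y a j * y a k)) =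
           cutoff2 m b e u (fun j k => \sum_i p i * (x i j * x i k)).
    congr (cutoff2 _ _ _ _); apply/funext => j; apply/funext => k; exact: split_cov.
  rewrite E in A2.
  have B1 : mean_min p x <= Num.sqrt r * v by rewrite vE; apply: mean_min_le.
  have B2 : mean_min q y <= Num.sqrt (2 * v + 4 * r * (1 + v / s2)) * v.
    rewrite vE; have := mean_min_le split_weights (split_bound xr).
    by under [X in _ * X]eq_bigr do rewrite split_cov.
  have B3 : K * mean_min p x + K * mean_min q y <=
     K * (Num.sqrt r * v + Num.sqrt (2 * v + 4 * r * (1 + v / s2)) * v).
    by rewrite -mulrDr ler_wpM2l// lerD.
  rewrite -/(mean_min p x) in A1; rewrite -/(mean_min q y) in A2.
  apply: le_trans B3; move: A1 A2; rewrite !ler_norml => /andP[? ?] /andP[? ?].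
  by apply/andP; split; lra.
have C1 := close a aM; have C2 := close (a - 6 * e) _.
have {}C2 := C2 ltac:(lra).
have C3 : iter n (avg q y) (cutoff m a e) 0 - iter n (avg q y) (cutoff m (a - 6 * e) e) 0 <=
   2 * (Num.sqrt (9 * e / (4 * s2)) + 1) / Num.sqrt n%:R.
  have -> : iter n (avg q y) (cutoff m a e) 0 - iter n (avg q y) (cutoff m (a - 6 * e) e) 0
      = iter n (avg q y) (fun w => cutoff m a e w + -1 * cutoff m (a - 6 * e) e w) 0.
    by rewrite iter_avgD iter_avgZ mulN1r.
  (* The sign averages are moved inside: they act for each fixed value [w] of the residual sum, and
     the concentration bound is uniform in [w]. *)
  rewrite /q /y iter_avg_pair iter_iter_avgC.
  apply: iter_avg_le => // w.
  (* Outside this window of length 9 e the two cutoffs are both 1 or both 0. *)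
  pose window (v : nat -> R) : R := (a - 6 * e <= dot m v v <= a + 3 * e)%R%:R.
  apply: (@le_trans _ _ (iter n (avg coin (signed slope)) window w)).
    apply: le_iter_avg => [|u]; first exact: coin_weights.
    rewrite /window mulN1r.
    have [h1|h1] := leP (a - 6 * e) (dot m u u); last first.
      by rewrite !cutoff_id ?subrr//; lra.
    have [h2|h2] := leP (dot m u u) (a + 3 * e); last first.
      by rewrite !cutoff_out ?subrr//; lra.
    by have := cutoff_ge0 m (a - 6 * e) e u; have := cutoff_le1 m a e u; rewrite /=; lra.
  have ss0 := slope_sqr_ge.
  have sl0 : 0 < dot m slope slope by apply: lt_le_trans ss0.
  apply: le_trans (signed_anticoncentration _ n0 sl0 _) _; first lra.
  rewrite ler_wpM2r ?invr_ge0 ?sqrtr_ge0// ler_wpM2l// lerD2r ler_wsqrtr//.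
  rewrite (_ : a + 3 * e - (a - 6 * e) = 9 * e); last by ring.
  rewrite ler_wpM2l//; first by rewrite mulr_ge0// ltW.
  rewrite ler_pV2 ?inE ?unitfE ?gt_eqF ?mulr_gt0//.
  by rewrite ler_pM2l.
move: C1 C2; rewrite !ler_norml => /andP[? ?] /andP[? ?]; lra.
Qed.

End regression.

(** * Expectations *)

Section mean.
Context d (T : measurableType d) (R : realType) (P : probability T R).
Implicit Types f g : T -> R.

Definition rintegrable f := P.-integrable setT (EFin \o f).
Definition mean f : R := (\int[P]_w f w)%R.

Lemma rintegrable_measurable f : rintegrable f -> measurable_fun setT f.
Proof. by move=> /measurable_int /measurable_EFinP. Qed.

Lemma rintegrableD f g : rintegrable f -> rintegrable g -> rintegrable (fun w => f w + g w).
Proof. by move=> fi gi; exact: (integrableD measurableT fi gi). Qed.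

Lemma rintegrableZ c f : rintegrable f -> rintegrable (fun w => c * f w).
Proof. by move=> fi; exact: (integrableZl measurableT c fi). Qed.

Lemma rintegrableB f g : rintegrable f -> rintegrable g -> rintegrable (fun w => f w - g w).
Proof. by move=> fi gi; exact: (integrableB measurableT fi gi). Qed.

Lemma rintegrable_sum I (s : seq I) (Q : pred I) (f : I -> T -> R) :
  (forall i, Q i -> rintegrable (f i)) -> rintegrable (fun w => \sum_(i <- s | Q i) f i w).
Proof.
move=> fi; have := @integrable_sum _ _ _ P setT measurableT _ s Q (fun i => EFin \o f i) fi.
by apply: eq_integrable => // w _ /=; rewrite sumEFin.
Qed.

Lemma le_rintegrable f g : measurable_fun setT f -> (forall w, `|f w| <= g w) ->
  rintegrable g -> rintegrable f.
Proof.
move=> mf fg; apply: le_integrable => //; first exact/measurable_EFinP.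
move=> w _ /=; rewrite lee_fin; apply: le_trans (fg w) _; exact: ler_norm.
Qed.

Lemma rintegrable_cst c : rintegrable (fun=> c).
Proof. exact: finite_measure_integrable_cst. Qed.

Lemma rintegrable_bounded f c : measurable_fun setT f -> (forall w, `|f w| <= c) -> rintegrable f.
Proof. by move=> mf fc; apply: (le_rintegrable mf fc); exact: rintegrable_cst. Qed.

Lemma rintegrable_norm f : rintegrable f -> rintegrable (fun w => `|f w|).
Proof. exact: integrable_norm. Qed.

Lemma meanE f : rintegrable f -> (\int[P]_w (f w)%:E = (mean f)%:E)%E.
Proof. by move=> fi; rewrite fineK//; exact: integrable_fin_num. Qed.

Lemma meanD f g : rintegrable f -> rintegrable g -> mean (fun w => f w + g w) = mean f + mean g.
Proof. exact: RintegralD. Qed.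

Lemma meanB f g : rintegrable f -> rintegrable g -> mean (fun w => f w - g w) = mean f - mean g.
Proof. exact: RintegralB. Qed.

Lemma meanZ c f : rintegrable f -> mean (fun w => c * f w) = c * mean f.
Proof. by move=> fi; exact: RintegralZl. Qed.

Lemma mean_cst c : mean (fun=> c) = c.
Proof.
rewrite /mean Rintegral_cst//.
rewrite -[RHS]mulr1; congr (_ * _); apply: (congr1 fine (_ : _ = 1%E)).
exact: probability_setT.
Qed.

Lemma le_mean f g : rintegrable f -> rintegrable g -> (forall w, f w <= g w) -> mean f <= mean g.
Proof. by move=> fi gi fg; apply: le_Rintegral => // w _; exact: fg. Qed.

Lemma mean_ge0 f : (forall w, 0 <= f w) -> 0 <= mean f.
Proof. by move=> f0; apply: Rintegral_ge0. Qed.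

Lemma normr_mean f : rintegrable f -> `|mean f| <= mean (fun w => `|f w|).
Proof. by move=> fi; exact: le_normr_Rintegral. Qed.

Lemma mean_sum I (s : seq I) (Q : pred I) (f : I -> T -> R) :
  (forall i, rintegrable (f i)) ->
  mean (fun w => \sum_(i <- s | Q i) f i w) = \sum_(i <- s | Q i) mean (f i).
Proof.
move=> fi; elim: s => [|i s IH].
  by rewrite big_nil -[RHS](mean_cst 0); congr mean; apply/funext => w; rewrite big_nil.
rewrite big_cons -IH; case: ifPn => Qi.
  rewrite -meanD//; last exact: rintegrable_sum.
  by congr mean; apply/funext => w; rewrite big_cons Qi.
by congr mean; apply/funext => w; rewrite big_cons (negbTE Qi).
Qed.

Lemma rintegrable_indic A : measurable A -> rintegrable (\1_A).
Proof. by move=> mA; exact: integrable_indic. Qed.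

Lemma mean_indic A : measurable A -> mean (\1_A) = fine (P A).
Proof. by move=> mA; rewrite /mean /Rintegral integral_indic// setIT. Qed.

Lemma mean_dct (f : nat -> T -> R) (g h : T -> R) :
  (forall n, measurable_fun setT (f n)) -> rintegrable h ->
  (forall n w, `|f n w| <= h w) -> (forall w, f n w @[n --> \oo] --> g w) ->
  rintegrable g /\ mean (f n) @[n --> \oo] --> mean g.
Proof.
move=> mf hi fh fg.
have mg : measurable_fun setT g.
  by apply: (measurable_fun_cvg mf) => w _; exact: fg.
have fg' w : (f n w)%:E @[n --> \oo] --> (g w)%:E.
  by apply: cvg_EFin; [exact: nearW|exact: fg].
have [gi _ C] := @dominated_convergence _ _ _ P setT measurableT
  (fun n => EFin \o f n) (EFin \o g) (EFin \o h)
  (fun n => (measurable_EFinP _ _).2 (mf n)) ((measurable_EFinP _ _).2 mg)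
  (aeW _ (fun w _ => fg' w)) hi
  (aeW _ (fun w n _ => fh n w)).
split=> //; rewrite meanE// in C; exact: fine_cvg C.
Qed.

End mean.

Lemma bigcap_cons (I : choiceType) T (i : I) (s : seq I) (F : I -> set T) :
  \bigcap_(k in [set` i :: s]) F k = F i `&` \bigcap_(k in [set` s]) F k.
Proof.
apply/seteqP; split=> [w H|w [Hi H] k /=].
  split=> [|k ks]; apply: H => /=; first by rewrite mem_head.
  by rewrite in_cons (ks : k \in s) orbT.
by rewrite in_cons => /orP[/eqP ->//|ks]; exact: H.
Qed.

(** * Means of sums of independent finitely valued steps *)

Section finitely_valued.
Context d (T : measurableType d) (R : realType) (P : probability T R).
Context d' (T' : measurableType d') (I : choiceType) (X : I -> {RV P >-> T'}).
Variables (J : finType) (q : T' -> J) (V : zmodType) (v : J -> V) (p : J -> R).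
Hypothesis mq : forall c, measurable (q @^-1` [set c]).
Hypothesis pq : forall i c, P (X i @^-1` (q @^-1` [set c])) = (p c)%:E.

(** The event [B] records the values already fixed. The induction splits the head variable into its
    classes and passes to the intersection of [B] with one class, which is still independent of the
    remaining variables. *)
Lemma mean_independent_sum (s : seq I) (B : set T) : uniq s -> measurable B ->
  (forall A : I -> set T', (forall i, measurable (A i)) ->
    (P (B `&` \bigcap_(i in [set` s]) (X i @^-1` A i)) =
     P B * \prod_(i <- s) P (X i @^-1` A i))%E) ->
  forall (F : V -> R) (u : V),
  let f := fun w => \1_B w * F (u + \sum_(i <- s) v (q (X i w))) in
  rintegrable P f /\ mean P f = fine (P B) * iter (size s) (avg p v) F u.
Proof.
elim: s B => [|i s IH] B us mB HB F u f.
  have -> : f = (fun w => F u * \1_B w).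
    by apply/funext => w; rewrite /f big_nil addr0 mulrC.
  split; first by apply: rintegrableZ; exact: rintegrable_indic.
  by rewrite meanZ ?mean_indic 1?mulrC//; exact: rintegrable_indic.
have /andP[is_ us'] := us.
pose C c := X i @^-1` (q @^-1` [set c]).
have mC c : measurable (C c) by rewrite /C -[X in measurable X]setTI; exact: measurable_funP.
have PBC c : P (B `&` C c) = (P B * (p c)%:E)%E.
  (* Testing with one class at [i] and the whole space elsewhere isolates a single factor of the
     product formula. *)
  pose A k := if k == i then q @^-1` [set c] else setT.
  have mA k : measurable (A k) by rewrite /A; case: ifP.
  have := HB A mA; rewrite bigcap_cons big_cons.
  rewrite {1 3}/A eqxx -/(C c) pq => H.
  rewrite (_ : \bigcap_(k in [set` s]) _ = setT) in H; last first.
    apply/seteqP; split=> // w _ k /= ks; rewrite /A; case: eqP ks => // -> ks.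
    by rewrite ks in is_.
  rewrite setIT in H; rewrite H; congr (_ * _)%E.
  rewrite big1_seq ?mule1// => k /andP[_ ks]; rewrite /A; case: eqP ks => [->|_ _].
    by move=> ks; rewrite ks in is_.
  by rewrite preimage_setT; exact: probability_setT.
have HBC c : forall A : I -> set T', (forall i, measurable (A i)) ->
    (P ((B `&` C c) `&` \bigcap_(i in [set` s]) (X i @^-1` A i)) =
     P (B `&` C c) * \prod_(i <- s) P (X i @^-1` A i))%E.
  move=> A mA; rewrite PBC.
  pose A' k := if k == i then q @^-1` [set c] else A k.
  have mA' k : measurable (A' k) by rewrite /A'; case: ifP.
  have := HB A' mA'; rewrite bigcap_cons big_cons.
  rewrite {1 3}/A' eqxx -/(C c) pq setIA muleA => H.
  rewrite (_ : \bigcap_(k in [set` s]) _ = \bigcap_(k in [set` s]) X k @^-1` A k) in H; last first.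
    apply: eq_bigcapr => k /= ks; rewrite /A'; case: eqP ks => // -> ks.
    by rewrite ks in is_.
  rewrite H; congr (_ * _)%E; apply: eq_big_seq => k ks; rewrite /A'; case: eqP ks => // -> ks.
  by rewrite ks in is_.
pose g c w := \1_(B `&` C c) w * F ((u + v c) + \sum_(k <- s) v (q (X k w))).
have fg : f = (fun w => \sum_c g c w).
  apply/funext => w; rewrite /f [RHS](bigD1 (q (X i w)))//= [X in _ = _ + X]big1 ?addr0.
    have h : \1_(C (q (X i w))) w = 1 :> R by rewrite indicE mem_set.
    by rewrite /g indicI /= h mulr1 big_cons addrA.
  move=> c /eqP cq; rewrite /g indicI /= [\1_(C _) w]indicE memNset ?mulr0 ?mul0r//.
  by move=> /= E; apply: cq.
have IHc c := IH (B `&` C c) us' (measurableI _ _ mB (mC c)) (HBC c) F (u + v c).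
rewrite fg; split; first by apply: rintegrable_sum => c _; exact: (IHc c).1.
rewrite mean_sum => [|c]; last exact: (IHc c).1.
rewrite /= /avg mulr_sumr; apply: eq_bigr => c _.
rewrite (IHc c).2 PBC fineM ?fin_num_measure//.
by rewrite mulrA.
Qed.

Lemma mean_sum_indep (s : seq I) (F : V -> R) (u : V) :
  mutually_independent X -> uniq s ->
  let f := fun w => F (u + \sum_(i <- s) v (q (X i w))) in
  rintegrable P f /\ mean P f = iter (size s) (avg p v) F u.
Proof.
move=> indep us f.
have [|] := @mean_independent_sum s setT us measurableT _ F u.
  move=> A mA; rewrite setTI indep//.
  by rewrite (_ : P setT = 1%E) ?mul1e//; exact: probability_setT.
have -> : (fun w => \1_[set: T] w * F (u + \sum_(i <- s) v (q (X i w)))) = f.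
  by apply/funext => w; rewrite indicT /= mul1r.
move=> fi ->; split=> //.
by rewrite (_ : P setT = 1%E) ?mul1r//; exact: probability_setT.
Qed.

End finitely_valued.

(* Rounding makes the steps finitely valued, so that independence enters only as a
   product formula for finitely many events. *)
Section rounding.
Context {R : realType}.
Implicit Types t : R.

(** Values are clamped to [-N, N], shifted to be nonnegative and read on a grid of mesh 1 / N, hence
    2 N^2 + 1 levels. *)
Definition scaled (N : nat) t : R := (Num.min (Num.max t (- N%:R)) N%:R + N%:R) * N%:R.
Definition level N t : nat := Num.truncn (scaled N t).
Definition unlevel (N k : nat) : R := k%:R / N%:R - N%:R.

Lemma scaled_ge0 N t : 0 <= scaled N t.
Proof.
rewrite /scaled mulr_ge0// -lerBlDr sub0r le_min le_max lexx orbT/=.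
by rewrite (@le_trans _ _ 0)// oppr_le0.
Qed.

Lemma level_lt N t : (level N t < (2 * N * N).+1)%N.
Proof.
rewrite ltnS /level truncn_le_nat -natr1 !natrM.
apply: (@le_lt_trans _ _ (2 * N%:R * N%:R)); last by rewrite ltrDl.
rewrite /scaled ler_wpM2r// (_ : 2 * _ = N%:R + N%:R); last by ring.
by rewrite lerD2r ge_min lexx orbT.
Qed.

Lemma measurable_level N k : measurable [set t | level N t = k].
Proof.
have mf : measurable_fun setT (scaled N).
  apply: measurable_funM => //; apply: measurable_funD => //.
  by apply: measurable_minr => //; exact: measurable_maxr.
have := mf measurableT `[k%:R, k.+1%:R[%classic (measurable_itv _).
rewrite setTI; congr measurable; apply/seteqP; split=> t /=.
  by rewrite in_itv/= -truncn_eq ?scaled_ge0// => /eqP.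
by move=> /eqP; rewrite /level truncn_eq ?scaled_ge0// in_itv.
Qed.

Lemma unlevel_cvg t : unlevel N (level N t) @[N --> \oo] --> t.
Proof.
apply/cvgrPdist_le => e e0.
have [N1 _ HN1] := near_infty_natSinv_lt (PosNum e0).
exists (maxn N1.+1 (Num.truncn `|t|).+1) => // N.
rewrite /= geq_max => /andP[N1N tN].
have N0 : 0 < N%:R :> R by rewrite ltr0n (leq_ltn_trans _ N1N).
have tN' : `|t| <= N%:R.
  by apply: ltW; apply: lt_le_trans (truncnS_gt _) _; rewrite ler_nat.
have sE : scaled N t = (t + N%:R) * N%:R.
  rewrite /scaled; congr ((_ + _) * _).
  move: tN'; rewrite ler_norml => /andP[h1 h2].
  by rewrite (max_idPl h1) (min_idPl h2).
have := truncn_itv (scaled_ge0 N t); rewrite -/(level N t) sE -natr1 => /andP[h1 h2].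
have -> : t - unlevel N (level N t) = ((t + N%:R) * N%:R - (level N t)%:R) / N%:R.
  by rewrite /unlevel; field; rewrite gt_eqF.
have Ni0 : 0 <= N%:R^-1 :> R by rewrite invr_ge0.
rewrite normrM ger0_norm ?subr_ge0// (ger0_norm Ni0).
apply: (@le_trans _ _ (N%:R^-1)); first by rewrite ler_piMl//; lra.
have := HN1 N.-1; rewrite /= => H; case: N N1N {tN tN' sE h1 h2 Ni0} N0 H => // N N1N _ H.
by apply: ltW; apply: H.
Qed.

End rounding.

Section quantization.
Context d' (T' : measurableType d') (R : realType).
Variables (m : nat) (z : T' -> nat -> R).
Hypothesis mz : forall j, (j < m)%N -> measurable_fun setT (z ^~ j).

Definition grid (N : nat) := {ffun 'I_m -> 'I_(2 * N * N).+1}.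
Definition quantize N (x : T') : grid N := [ffun j : 'I_m => inord (level N (z x j))].
(** Coordinates from m on are set to 0; test functions whose modulus of continuity is expressed
    through [dot m] do not see them. *)
Definition dequantize N (c : grid N) : nat -> R :=
  fun j => oapp (fun i => unlevel N (c i)) 0 (insub j).

Lemma measurable_quantize N (c : grid N) : measurable (@quantize N @^-1` [set c]).
Proof.
have -> : @quantize N @^-1` [set c] =
    \bigcap_(j in [set: 'I_m]) [set x | level N (z x j) = c j].
  apply/seteqP; split=> x /=.
    by move=> <- j _ /=; rewrite ffunE inordK ?level_lt.
  move=> H; apply/ffunP => j; rewrite ffunE; apply/val_inj => /=.
  by rewrite inordK ?level_lt//; exact: H.
apply: fin_bigcap_measurable => // j _.
have := mz (ltn_ord j) measurableT (@measurable_level R N (c j)).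
by rewrite setTI.
Qed.

Lemma dequantize_cvg x j : (j < m)%N ->
  dequantize (quantize N x) j @[N --> \oo] --> z x j.
Proof.
move=> jm; rewrite (_ : (fun N => _) = (fun N => unlevel N (level N (z x j)))).
  exact: unlevel_cvg.
apply/funext => N; rewrite /dequantize.
by rewrite (insubT (fun k => (k < m)%N) jm)/= ffunE inordK// level_lt.
Qed.

End quantization.

Lemma cvg_sumr (R : realType) (I : Type) (s : seq I) (g : I -> nat -> R) (l : I -> R) :
  (forall i, g i n @[n --> \oo] --> l i) ->
  \sum_(i <- s) g i n @[n --> \oo] --> \sum_(i <- s) l i.
Proof.
move=> gl; elim: s => [|i s IH].
  rewrite big_nil (_ : (fun n => _) = cst 0); first exact: cvg_cst.
  by apply/funext => n; rewrite big_nil.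
rewrite big_cons (_ : (fun n => _) = (fun n => g i n + \sum_(j <- s) g j n)).
  exact: cvgD (gl i) IH.
by apply/funext => n; rewrite big_cons.
Qed.

Lemma cvg_dist_bound (R : realType) (a b : nat -> R) (l : R) :
  (forall n, `|a n - l| <= b n) -> b n @[n --> \oo] --> 0 -> a n @[n --> \oo] --> l.
Proof.
move=> ab b0; apply/cvgrPdist_le => e e0.
have /cvgrPdist_le/(_ _ e0) H := b0.
apply: filterS H => n; rewrite sub0r normrN => H.
by rewrite distrC (le_trans (ab n))// (le_trans (ler_norm _)).
Qed.

Lemma sum_coord (R : realType) (I : Type) (s : seq I) (F : I -> nat -> R) j :
  (\sum_(i <- s) F i) j = \sum_(i <- s) F i j.
Proof. by elim: s => [|i s IH]; rewrite ?big_nil// !big_cons -IH. Qed.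

Lemma measurable_sqrt (R : realType) : measurable_fun setT (@Num.sqrt R).
Proof. by apply: continuous_measurable_fun; exact: sqrt_continuous. Qed.

Lemma cvg_sqrt (R : realType) (a : nat -> R) (l : R) :
  a n @[n --> \oo] --> l -> Num.sqrt (a n) @[n --> \oo] --> Num.sqrt l.
Proof. by move=> al; apply: (cvg_comp _ (@Num.sqrt R) al); exact: sqrt_continuous. Qed.

Lemma cvg_invn (R : realType) : (n%:R^-1 : R) @[n --> \oo] --> 0.
Proof. by rewrite -cvg_shiftS; exact: cvg_harmonic. Qed.

Lemma cvg_modulus (R : realType) m (K : R) (h : nat -> nat -> R) :
  (forall j, (j < m)%N -> h N j @[N --> \oo] --> 0) ->
  K * (Num.sqrt (dot m (h N) (h N)) + dot m (h N) (h N)) @[N --> \oo] --> 0.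
Proof.
move=> h0.
have D0 : dot m (h N) (h N) @[N --> \oo] --> 0.
  have H : dot m (h N) (h N) @[N --> \oo] --> \sum_(j < m) (0 * 0 : R).
    by apply: cvg_sumr => j; apply: cvgM; exact: h0.
  by rewrite big1 in H => // j _; rewrite mul0r.
rewrite -(mulr0 K) -[X in K * X](addr0 0); apply: cvgMr.
apply: cvgD => //; rewrite -[X in _ --> X]sqrtr0.
exact: cvg_sqrt.
Qed.

(** * Lindeberg replacement for a general step law *)

Section replacement.
Context d (T : measurableType d) (R : realType) (P : probability T R).
Context d' (T' : measurableType d') (X : nat -> {RV P >-> T'}).
Variables (m : nat) (z : T' -> nat -> R).
Hypothesis mz : forall j, (j < m)%N -> measurable_fun setT (z ^~ j).
Hypothesis indep : mutually_independent X.
Hypothesis idist : identically_distributed X.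
Variables (f : (nat -> R) -> R) (K : R).
Hypothesis f01 : forall u, 0 <= f u <= 1.
Hypothesis fK : forall u h : nat -> R,
  `|f (u + h) - f u| <= K * (Num.sqrt (dot m h h) + dot m h h).

Let zN N (x : T') : nat -> R := dequantize R (quantize m z N x).
Let pN N (c : grid m N) : R := fine (P (X 0%N @^-1` (quantize m z N @^-1` [set c]))).

Let pNE N i c : P (X i @^-1` (quantize m z N @^-1` [set c])) = (pN c)%:E.
Proof.
rewrite /pN fineK; first exact: idist (measurable_quantize mz c).
apply: fin_num_measure; rewrite -[X in measurable X]setTI.
exact: measurable_funP (measurable_quantize mz c).
Qed.

Let mean_zN N (s : seq nat) (F : (nat -> R) -> R) u : uniq s ->
  rintegrable P (fun w => F (u + \sum_(i <- s) zN N (X i w))) /\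
  mean P (fun w => F (u + \sum_(i <- s) zN N (X i w))) =
  iter (size s) (avg (@pN N) (@dequantize R m N)) F u.
Proof.
by move=> us; exact: (mean_sum_indep (@dequantize R m N)
  (@measurable_quantize _ _ _ _ _ mz N) (@pNE N) F u indep us).
Qed.

Let weights_pN N : weights (@pN N).
Proof.
split=> [c|]; first by rewrite fine_ge0.
have [_] := @mean_zN N [:: 0%N] (fun=> 1) 0 isT.
by rewrite mean_cst /= /avg => ->; apply: eq_bigr => c _; rewrite mulr1.
Qed.

Let f_bound u : `|f u| <= 1.
Proof. by have /andP[? ?] := f01 u; rewrite ger0_norm. Qed.

Let f_close u v : `|f u - f v| <= K * (Num.sqrt (dot m (u - v) (u - v)) + dot m (u - v) (u - v)).
Proof. by have := fK v (u - v); rewrite [v + _]addrC subrK. Qed.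

(** Since [f] is bounded and continuous in the first m coordinates, rounded sums converge pointwise
    under [f] and dominated convergence applies with the constant 1. *)
Lemma mean_quantized_cvg (s : seq nat) u : uniq s ->
  rintegrable P (fun w => f (u + \sum_(i <- s) z (X i w))) /\
  mean P (fun w => f (u + \sum_(i <- s) zN N (X i w))) @[N --> \oo] -->
  mean P (fun w => f (u + \sum_(i <- s) z (X i w))).
Proof.
move=> us; apply: (@mean_dct _ _ _ P (fun N w => f (u + \sum_(i <- s) zN N (X i w)))
  _ (fun=> 1)) => [N||N w|w].
- exact: rintegrable_measurable (mean_zN N f u us).1.
- exact: rintegrable_cst.
- exact: f_bound.
pose h N : nat -> R := \sum_(i <- s) zN N (X i w) - \sum_(i <- s) z (X i w).
apply: (@cvg_dist_bound _ _ (fun N => K * (Num.sqrt (dot m (h N) (h N)) + dot m (h N) (h N)))).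
  by move=> N; apply: le_trans (f_close _ _) _; rewrite opprD addrACA subrr add0r.
apply: cvg_modulus => j jm.
have H : \sum_(i <- s) zN N (X i w) j @[N --> \oo] --> \sum_(i <- s) z (X i w) j.
  by apply: cvg_sumr => i; exact: dequantize_cvg.
rewrite (_ : (fun N => _) = (fun N => \sum_(i <- s) zN N (X i w) j - \sum_(i <- s) z (X i w) j)).
  set l := \sum_(i <- s) z (X i w) j in H *.
  have : \sum_(i <- s) zN N (X i w) j - l @[N --> \oo] --> l - l.
    by apply: cvgB => //; exact: cvg_cst.
  by rewrite subrr.
apply/funext => N; rewrite -(sum_coord s (fun i => zN N (X i w))).
by rewrite -(sum_coord s (fun i => z (X i w))).
Qed.

(** Bounds the effect on [f] of rounding one step, whatever the base point; the minimum with 1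
    provides a dominating function without any moment assumption. *)
Let gap N w : R :=
  let h := zN N (X 0%N w) - z (X 0%N w) in
  Num.min 1 (K * (Num.sqrt (dot m h h) + dot m h h)).

Hypothesis K0 : 0 <= K.

Lemma gap_cvg : (forall N, rintegrable P (gap N)) /\ mean P (gap N) @[N --> \oo] --> 0.
Proof.
have gap0 N w : 0 <= gap N w.
  by rewrite le_min ler01 mulr_ge0// addr_ge0 ?sqrtr_ge0// dot_ge0.
have gap1 N w : `|gap N w| <= 1 by rewrite ger0_norm// ge_min lexx.
have mgap N : measurable_fun setT (gap N).
  have mD : measurable_fun setT
      (fun w => dot m (zN N (X 0%N w) - z (X 0%N w)) (zN N (X 0%N w) - z (X 0%N w))).
    apply: measurable_sum => j.
    have mj : measurable_fun setT (fun w => (zN N (X 0%N w) - z (X 0%N w)) j).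
      have mz1 : measurable_fun setT (fun w => z (X 0%N w) j).
        by apply: (measurableT_comp (mz (ltn_ord j))).
      have mz2 : measurable_fun setT (fun w => zN N (X 0%N w) j).
        have := rintegrable_measurable (@mean_zN N [:: 0%N] (fun v => v j) 0 isT).1.
        by apply: eq_measurable_fun => w _; rewrite big_seq1 add0r.
      exact: measurable_funB mz2 mz1.
    exact: measurable_funM.
  have mS := measurableT_comp (@measurable_sqrt R) mD.
  apply: measurable_minr => //; apply: measurable_funM => //.
  exact: measurable_funD mS mD.
split=> [N|]; first exact: rintegrable_bounded (gap1 N).
rewrite -(@mean_cst _ _ _ P 0).
apply: (@mean_dct _ _ _ P gap _ (fun=> 1) _ _ gap1 _).2 => //; first exact: rintegrable_cst.
move=> w; pose h N : nat -> R := zN N (X 0%N w) - z (X 0%N w).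
apply: (@cvg_dist_bound _ _ (fun N => K * (Num.sqrt (dot m (h N) (h N)) + dot m (h N) (h N)))).
  by move=> N; rewrite subr0 ger0_norm ?gap0// ge_min lexx orbT.
apply: cvg_modulus => j jm.
have : zN N (X 0%N w) j - z (X 0%N w) j @[N --> \oo] --> z (X 0%N w) j - z (X 0%N w) j.
  by apply: cvgB; [exact: dequantize_cvg|exact: cvg_cst].
by rewrite subrr.
Qed.

(** Rounded steps are finitely valued, so the replacement bound for iterates of [avg] applies at the
    cost of n times the mean gap. With n fixed, this cost disappears as the rounding is refined. *)
Lemma mean_lindeberg (J : finType) (q : J -> R) (y : J -> nat -> R) n delta :
  weights q ->
  (forall u, `|mean P (fun w => f (u + z (X 0%N w))) - avg q y f u| <= delta) ->
  `|mean P (fun w => f (\sum_(0 <= i < n) z (X i w))) - iter n (avg q y) f 0|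
    <= n%:R * delta.
Proof.
move=> q1 fd; have [igap gap_to0] := gap_cvg.
have close N u : `|avg (@pN N) (@dequantize R m N) f u - avg q y f u| <= mean P (gap N) + delta.
  have [i1 E1] := @mean_zN N [:: 0%N] f u isT.
  have [i2 _] := @mean_quantized_cvg [:: 0%N] u isT.
  have e1 : (fun w => f (u + \sum_(i <- [:: 0%N]) zN N (X i w))) =
      (fun w => f (u + zN N (X 0%N w))).
    by apply/funext => w; rewrite big_seq1.
  have e2 : (fun w => f (u + \sum_(i <- [:: 0%N]) z (X i w))) = (fun w => f (u + z (X 0%N w))).
    by apply/funext => w; rewrite big_seq1.
  rewrite e1 in i1 E1; rewrite e2 in i2; rewrite /= in E1.
  rewrite -E1 -(subrKA (mean P (fun w => f (u + z (X 0%N w))))).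
  apply: le_trans (ler_normD _ _) _; apply: lerD (fd u).
  rewrite -meanB//; apply: le_trans (normr_mean _) _; first exact: rintegrableB.
  apply: le_mean => //; first exact/rintegrable_norm/rintegrableB.
  move=> w; rewrite le_min; apply/andP; split.
    have /andP[? ?] := f01 (u + zN N (X 0%N w)); have /andP[? ?] := f01 (u + z (X 0%N w)).
    by rewrite ler_norml; apply/andP; split; lra.
  by apply: le_trans (f_close _ _) _; rewrite opprD addrACA subrr add0r.
have us : uniq (index_iota 0 n) by exact: iota_uniq.
have [_ AN] := mean_quantized_cvg 0 us; move: AN.
have -> : (fun w => f (0 + \sum_(0 <= i < n) z (X i w))) =
    (fun w => f (\sum_(0 <= i < n) z (X i w))).
  by apply/funext => w; rewrite add0r.
set A := mean P _; set B := iter n _ f 0 => AN.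
have AB N : `|mean P (fun w => f (0 + \sum_(0 <= i < n) zN N (X i w))) - B| <=
    n%:R * (mean P (gap N) + delta).
  by rewrite (mean_zN N f 0 us).2 size_iota subn0; exact: iter_avg_close.
have C1 : `|mean P (fun w => f (0 + \sum_(0 <= i < n) zN N (X i w))) - B| @[N --> \oo] --> `|A - B|.
  by apply: cvg_norm; apply: cvgB => //; exact: cvg_cst.
have C2 : n%:R * (mean P (gap N) + delta) @[N --> \oo] --> n%:R * (0 + delta).
  by apply: cvgMr; apply: cvgD => //; exact: cvg_cst.
have := ler_cvg_to C1 C2; rewrite add0r; apply; exact: nearW.
Qed.

End replacement.

(** * Expansion of a cutoff under a square-integrable step *)

Section mean_taylor.
Context d (T : measurableType d) (R : realType) (P : probability T R).
Variables (m : nat) (Y : T -> nat -> R).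
Hypothesis iY : forall j, (j < m)%N -> rintegrable P (Y ^~ j).
Hypothesis Y0 : forall j, (j < m)%N -> mean P (Y ^~ j) = 0.
Hypothesis iYY : forall j k, (j < m)%N -> (k < m)%N -> rintegrable P (fun w => Y w j * Y w k).

Lemma rintegrable_dot : rintegrable P (fun w => dot m (Y w) (Y w)).
Proof. by apply: rintegrable_sum => j _; exact: iYY. Qed.

Lemma rintegrable_min_dot s :
  rintegrable P (fun w => dot m (Y w) (Y w) * Num.min 1 (Num.sqrt (dot m (Y w) (Y w) * s))).
Proof.
have mD := rintegrable_measurable rintegrable_dot.
apply: (le_rintegrable _ _ rintegrable_dot) => [|w].
  apply: measurable_funM => //; apply: measurable_minr => //.
  have mDs : measurable_fun setT (fun w => dot m (Y w) (Y w) * s) by apply: measurable_funM.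
  exact: measurableT_comp (@measurable_sqrt R) mDs.
rewrite ger0_norm.
  by rewrite ler_piMr ?dot_ge0// ge_min lexx.
by rewrite mulr_ge0 ?dot_ge0// le_min ler01 sqrtr_ge0.
Qed.

(** Lindeberg's condition for one square-integrable vector: the integrand is dominated by |Y|^2 and
    tends to 0 pointwise. *)
Lemma mean_min_cvg0 :
  mean P (fun w => dot m (Y w) (Y w) *
    Num.min 1 (Num.sqrt (dot m (Y w) (Y w) / n%:R))) @[n --> \oo] --> 0.
Proof.
have iD := rintegrable_dot; rewrite -(@mean_cst _ _ _ P 0).
apply: (@mean_dct _ _ _ P _ _ (fun w => dot m (Y w) (Y w)) _ iD _ _).2 => [n|n w|w].
- exact: rintegrable_measurable (rintegrable_min_dot _).
- rewrite ger0_norm; first by rewrite ler_piMr ?dot_ge0// ge_min lexx.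
  by rewrite mulr_ge0 ?dot_ge0// le_min ler01 sqrtr_ge0.
set D := dot m (Y w) (Y w).
have D0 : 0 <= D by exact: dot_ge0.
apply: (@cvg_dist_bound _ _ (fun n => D * Num.sqrt (D / n%:R))) => [n|].
  rewrite subr0 ger0_norm ?mulr_ge0// ?le_min ?ler01 ?sqrtr_ge0//.
  by rewrite ler_wpM2l// ge_min lexx orbT.
have C : D * Num.sqrt (D / n%:R) @[n --> \oo] --> D * Num.sqrt (D * 0).
  by apply: cvgMr; apply: cvg_sqrt; apply: cvgMr; exact: cvg_invn.
by rewrite !mulr0 sqrtr0 mulr0 in C.
Qed.

Variables (a e K M : R).
Hypothesis if_ : forall u, rintegrable P (fun w => cutoff m a e (u + Y w)).
Hypothesis aM : a <= M.
Hypothesis HK : forall a, a <= M -> forall u h : nat -> R,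
    `|cutoff m a e (u + h) - cutoff m a e u - cutoff1 m a e u h
       - cutoff2 m a e u (fun j k => h j * h k)|
      <= K * (dot m h h * Num.min 1 (Num.sqrt (dot m h h))).

(** The counterpart of [avg_cutoff] for a law that need not be finitely valued. *)
Lemma mean_cutoff u :
  `|mean P (fun w => cutoff m a e (u + Y w)) - cutoff m a e u
     - cutoff2 m a e u (fun j k => mean P (fun w => Y w j * Y w k))| <=
  K * mean P (fun w => dot m (Y w) (Y w) * Num.min 1 (Num.sqrt (dot m (Y w) (Y w)))).
Proof.
have i1 : rintegrable P (fun w => cutoff1 m a e u (Y w)).
  by apply: rintegrableZ; apply: rintegrable_sum => j _; apply: rintegrableZ; exact: iY.
have E1 : mean P (fun w => cutoff1 m a e u (Y w)) = 0.
  have iu (j : 'I_m) : rintegrable P (fun w => u j * Y w j) by apply: rintegrableZ; exact: iY.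
  rewrite /cutoff1 meanZ; last by apply: rintegrable_sum => j _; exact: iu.
  rewrite mean_sum// big1 ?mulr0// => j _; rewrite meanZ ?Y0 ?mulr0//; exact: iY.
have i2 : rintegrable P (fun w => cutoff2 m a e u (fun j k => Y w j * Y w k)).
  apply: rintegrableD; apply: rintegrableZ; first by apply: rintegrable_sum => j _; exact: iYY.
  by apply: rintegrable_sum => j _; apply: rintegrable_sum => k _; apply: rintegrableZ; exact: iYY.
have E2 : mean P (fun w => cutoff2 m a e u (fun j k => Y w j * Y w k)) =
    cutoff2 m a e u (fun j k => mean P (fun w => Y w j * Y w k)).
  have j1 (j k : 'I_m) : rintegrable P (fun w => u j * u k * (Y w j * Y w k)).
    by apply: rintegrableZ; exact: iYY.
  have j2 (j : 'I_m) : rintegrable P (fun w => \sum_(k < m) u j * u k * (Y w j * Y w k)).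
    by apply: rintegrable_sum => k _; exact: j1.
  have j3 (j : 'I_m) : rintegrable P (fun w => Y w j * Y w j) by exact: iYY.
  rewrite /cutoff2 meanD; try by apply: rintegrableZ; apply: rintegrable_sum.
  rewrite !meanZ; try by apply: rintegrable_sum.
  rewrite !mean_sum//; congr (_ + _ * _); apply: eq_bigr => j _.
  rewrite mean_sum//; apply: eq_bigr => k _.
  by rewrite meanZ//; exact: iYY.
have iR := rintegrable_min_dot 1.
have {}iR : rintegrable P (fun w => dot m (Y w) (Y w) * Num.min 1 (Num.sqrt (dot m (Y w) (Y w)))).
  by move: iR; under eq_fun do rewrite mulr1.
pose g w := cutoff m a e (u + Y w) - cutoff m a e u - cutoff1 m a e u (Y w)
       - cutoff2 m a e u (fun j k => Y w j * Y w k).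
have ic := rintegrable_cst P (cutoff m a e u).
have ig1 := rintegrableB (if_ u) ic; have ig2 := rintegrableB ig1 i1.
have ig : rintegrable P g := rintegrableB ig2 i2.
have -> : mean P (fun w => cutoff m a e (u + Y w)) - cutoff m a e u
     - cutoff2 m a e u (fun j k => mean P (fun w => Y w j * Y w k)) = mean P g.
  by rewrite /g (meanB ig2 i2) (meanB ig1 i1) (meanB (if_ u) ic) mean_cst E1 E2 subr0.
apply: le_trans (normr_mean ig) _; rewrite -meanZ//; apply: le_mean.
- exact: rintegrable_norm.
- exact: rintegrableZ.
- by move=> w; exact: HK.
Qed.

End mean_taylor.

(** * The strong law of large numbers *)

Section iid_means.
Context d (T : measurableType d) (R : realType) (P : probability T R).
Context d' (T' : measurableType d') (X : nat -> {RV P >-> T'}).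
Hypothesis indep : mutually_independent X.
Hypothesis idist : identically_distributed X.
Implicit Types h : T' -> R.

Let law i := distribution P (X i).

Lemma mean_law i h : measurable_fun setT h -> rintegrable P (fun w => h (X i w)) ->
  rintegrable (law i) h /\ mean (law i) h = mean P (fun w => h (X i w)).
Proof.
move=> mh ih; have mE : measurable_fun setT (EFin \o h) by exact/measurable_EFinP.
split; last by rewrite /mean /Rintegral integral_distribution.
exact: (@integrable_pushforward _ _ _ _ _ (X i) (@measurable_funPT _ _ _ _ (X i)) P
   setT (EFin \o h)).
Qed.

Lemma ident_mean i h : measurable_fun setT h -> rintegrable P (fun w => h (X 0%N w)) ->
  rintegrable P (fun w => h (X i w)) /\ mean P (fun w => h (X i w)) = mean P (fun w => h (X 0%N w)).
Proof.
move=> mh ih; have mE : measurable_fun setT (EFin \o h) by exact/measurable_EFinP.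
have eq_law (f : T' -> \bar R) : (\int[law i]_x f x = \int[law 0%N]_x f x)%E.
  by apply: eq_measure_integral => A mA _; exact: idist.
have ii : rintegrable P (fun w => h (X i w)).
  apply/integrableP; split.
    by apply/measurable_EFinP; exact: measurableT_comp.
  have /integrableP[_] := ih; apply: le_lt_trans.
  have mA : measurable_fun setT (abse \o (EFin \o h)) by exact: measurableT_comp.
  rewrite le_eqVlt; apply/orP; left; apply/eqP.
  have E k := @ge0_integral_distribution _ _ _ _ _ P (X k) (abse \o (EFin \o h)) mA
    (fun x => abse_ge0 _).
  by apply: etrans (esym (E i)) _; apply: etrans (eq_law _) (E 0%N).
split=> //; rewrite -(mean_law mh ii).2 -(mean_law mh ih).2.
exact: (congr1 fine (eq_law (EFin \o h))).
Qed.

(** Independence identifies the joint law with the product of the marginals on rectangles;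
    uniqueness of product measures extends this to all events, and Fubini's theorem factors the
    integral. *)
Lemma mean_indep i j h1 h2 : i != j ->
  measurable_fun setT h1 -> rintegrable P (fun w => h1 (X i w)) ->
  measurable_fun setT h2 -> rintegrable P (fun w => h2 (X j w)) ->
  rintegrable P (fun w => h1 (X i w) * h2 (X j w)) /\
  mean P (fun w => h1 (X i w) * h2 (X j w)) =
    mean P (fun w => h1 (X i w)) * mean P (fun w => h2 (X j w)).
Proof.
move=> ij m1 i1 m2 i2.
pose phi w := (X i w, X j w).
have mphi : measurable_fun setT phi by exact: measurable_fun_pair.
pose Phi : {RV P >-> (T' * T')%type} := HB.pack phi (isMeasurableFun.Build _ _ _ _ phi mphi).
pose F (x : T' * T') : R := h1 x.1 * h2 x.2.
have mF : measurable_fun setT F.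
  by apply: measurable_funM; apply: measurableT_comp.
have mEF : measurable_fun setT (EFin \o F) by exact/measurable_EFinP.
have eq_prod (f : T' * T' -> \bar R) :
   (\int[law i \x law j]_x f x = \int[distribution P Phi]_x f x)%E.
  apply: eq_measure_integral => A mA _.
  apply: (@product_measure_unique _ _ _ _ _ (law i) (law j) (distribution P Phi)) => // B C mB mC.
  pose AA k := if k == i then B else C.
  have mAA k : measurable (AA k) by rewrite /AA; case: ifP.
  have := @indep [:: i; j] AA _ mAA.
  rewrite /= inE ij => /(_ isT).
  rewrite !bigcap_cons big_cons big_seq1.
  rewrite (_ : AA i = B); last by rewrite /AA eqxx.
  rewrite (_ : AA j = C); last by rewrite /AA eq_sym (negbTE ij).
  apply: etrans; congr (P _); apply/seteqP; split=> w /=.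
    by move=> [? ?]; split=> //; split.
  by move=> [? [? _]].
have [li1 le1] := mean_law m1 i1; have [li2 le2] := mean_law m2 i2.
have iF : (law i \x law j)%E.-integrable setT (EFin \o F).
  apply/(integrable12ltyP _ _ mEF).
  have E x : (\int[law j]_y `|(F (x, y))%:E| = (mean (law j) (fun y => `|h2 y|) * `|h1 x|)%:E)%E.
    under eq_integral do rewrite /= normrM.
    have iN := rintegrable_norm li2.
    by rewrite (meanE (rintegrableZ `|h1 x| iN)) (meanZ _ iN) mulrC.
  under eq_integral do rewrite E.
  by rewrite (meanE (rintegrableZ _ (rintegrable_norm li1))) ltry.
have E12 := integral12_prod_meas1 iF.
have E x : (\int[law j]_y (F (x, y))%:E = (mean (law j) h2 * h1 x)%:E)%E.
  by rewrite (meanE (rintegrableZ (h1 x) li2)) (meanZ _ li2) mulrC.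
have iP : rintegrable P (fun w => h1 (X i w) * h2 (X j w)).
  apply/integrableP; split; first exact: measurableT_comp mEF mphi.
  have mA : measurable_fun setT (abse \o (EFin \o F)) by exact: measurableT_comp.
  have := @ge0_integral_distribution _ _ _ _ _ P Phi (abse \o (EFin \o F)) mA
    (fun x => abse_ge0 _).
  move=> <-; have /integrableP[_] := iF.
  by apply: le_lt_trans; rewrite le_eqVlt; apply/orP; left; apply/eqP; apply: esym (eq_prod _).
split=> //; rewrite -le1 -le2.
rewrite {1}/mean /Rintegral.
have := @integral_distribution _ _ _ _ _ P Phi (EFin \o F) mEF iP.
move=> <-; rewrite (etrans (esym (eq_prod (EFin \o F))) (esym E12)).
transitivity (fine (\int[law i]_x (mean (law j) h2 * h1 x)%:E)%E).
  by congr fine; apply: eq_integral => x _; exact: E.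
by rewrite (meanE (rintegrableZ _ li1)) (meanZ _ li1) mulrC.
Qed.

(** Centred independent terms are orthogonal, so only the diagonal of the double sum survives. *)
Lemma mean_sqr_sum (h : T' -> R) (N : nat) : measurable_fun setT h ->
  rintegrable P (fun w => h (X 0%N w) ^+ 2) -> mean P (fun w => h (X 0%N w)) = 0 ->
  rintegrable P (fun w => (\sum_(0 <= i < N) h (X i w)) ^+ 2) /\
  mean P (fun w => (\sum_(0 <= i < N) h (X i w)) ^+ 2) =
    N%:R * mean P (fun w => h (X 0%N w) ^+ 2).
Proof.
move=> mh ih2 h0.
have mh2 : measurable_fun setT (fun x => h x ^+ 2) by exact: measurable_funX.
have ih : rintegrable P (fun w => h (X 0%N w)).
  apply: (le_rintegrable _ _ (rintegrableD (rintegrable_cst P 1) ih2)) => [|w].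
    exact: measurableT_comp.
  by rewrite ler_norml; apply/andP; split;
    have := sqr_ge0 (h (X 0%N w) - 1); have := sqr_ge0 (h (X 0%N w) + 1); nra.
have ihi i : rintegrable P (fun w => h (X i w)) := (ident_mean i mh ih).1.
have ii i j : rintegrable P (fun w => h (X i w) * h (X j w)).
  have [<-|ij] := eqVneq i j; last exact: (mean_indep ij mh (ihi i) mh (ihi j)).1.
  exact: (@ident_mean i _ mh2 ih2).1.
have mm i j : mean P (fun w => h (X i w) * h (X j w)) =
    if i == j then mean P (fun w => h (X 0%N w) ^+ 2) else 0.
  case: eqVneq => [<-|ij]; first exact: (@ident_mean i _ mh2 ih2).2.
  rewrite (mean_indep ij mh (ihi i) mh (ihi j)).2.
  by rewrite (ident_mean i mh ih).2 h0 mul0r.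
have -> : (fun w => (\sum_(0 <= i < N) h (X i w)) ^+ 2) =
   (fun w => \sum_(0 <= i < N) \sum_(0 <= j < N) h (X i w) * h (X j w)).
  by apply/funext => w; rewrite expr2 big_distrlr.
split; first by apply: rintegrable_sum => i _; apply: rintegrable_sum => j _; exact: ii.
rewrite mean_sum => [|i]; last by apply: rintegrable_sum => j _; exact: ii.
transitivity (\sum_(0 <= i < N) mean P (fun w => h (X 0%N w) ^+ 2)); last first.
  by rewrite sumr_const_nat subn0 mulr_natl.
rewrite !big_seq; apply: eq_bigr => i; rewrite mem_index_iota => /andP[_ iN].
rewrite mean_sum// (bigD1_seq i) ?iota_uniq ?mem_index_iota//= mm eqxx big1 ?addr0// => j ji.
by rewrite mm eq_sym (negbTE ji).
Qed.

End iid_means.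

(** Bounded partial sums of the means make the sum of the variables integrable, hence almost surely
    finite, and the terms of a convergent series tend to 0. This does the work of Chebyshev's
    inequality and Borel-Cantelli together. *)
Lemma ae_cvg0 d (T : measurableType d) (R : realType) (P : probability T R)
    (xi : nat -> T -> R) (C : R) :
  (forall n, rintegrable P (xi n)) -> (forall n w, 0 <= xi n w) ->
  (forall N, \sum_(0 <= n < N) mean P (xi n) <= C) ->
  {ae P, forall w, xi n w @[n --> \oo] --> 0}.
Proof.
move=> ixi xi0 xiC.
pose S w := (\sum_(0 <= n <oo) (xi n w)%:E)%E.
have mxi n : measurable_fun setT (fun w => (xi n w)%:E).
  by apply/measurable_EFinP; exact: rintegrable_measurable.
have S0 w : (0 <= S w)%E by apply: nneseries_ge0 => n _ _; rewrite lee_fin.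
have mS : measurable_fun setT S by apply: ge0_emeasurable_sum => // n w _ _; rewrite lee_fin.
have iS : P.-integrable setT S.
  apply/integrableP; split=> //.
  under eq_integral do rewrite gee0_abs//.
  rewrite /S integral_nneseries// => [|n w _]; last by rewrite lee_fin.
  apply: (@le_lt_trans _ _ C%:E); last by rewrite ltry.
  apply: lime_le.
    by apply: is_cvg_nneseries => n _ _; apply: integral_ge0 => w _; rewrite lee_fin.
  apply: nearW => N; under eq_bigr do rewrite meanE//.
  by rewrite sumEFin lee_fin.
have := integrable_ae measurableT iS; apply: filterS => w /(_ I) Sfin.
apply: cvg_series_cvg_0; apply: nondecreasing_is_cvgn.
  by apply/nondecreasing_series => n _ _; exact: xi0.
exists (fine (S w)) => _ [N _ <-].
rewrite -lee_fin fineK// /series /= -sumEFin.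
by apply: nneseries_lim_ge => n _ _; rewrite lee_fin.
Qed.

Section interpolation.
Context {R : realType}.

Lemma cvg_sqr0 (a : nat -> R) : a n ^+ 2 @[n --> \oo] --> 0 -> a n @[n --> \oo] --> 0.
Proof.
move=> a0; apply: (@cvg_dist_bound _ _ (fun n => Num.sqrt (a n ^+ 2))) => [n|].
  by rewrite subr0 sqrtr_sqr.
by have := cvg_sqrt a0; rewrite sqrtr0.
Qed.

Lemma sum_inv_sqr N : \sum_(0 <= k < N) (k.+1%:R ^+ 2)^-1 <= 2 - N%:R^-1 :> R.
Proof.
elim: N => [|N IH]; first by rewrite big_nil invr0 subr0.
rewrite big_nat_recr//=; case: N IH => [|N] IH.
  by rewrite big_nil expr1n invr1; lra.
apply: le_trans (lerD IH (lexx _)) _.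
(* The slack 1 / (N + 1) - 1 / (N + 2) - 1 / (N + 2)^2 equals exactly this positive quantity. *)
rewrite -subr_ge0 (_ : _ - _ = (N.+1%:R * N.+2%:R ^+ 2)^-1).
  by rewrite invr_ge0 mulr_ge0// sqr_ge0.
have h2 : N.+2%:R = N.+1%:R + 1 :> R by rewrite natr1.
rewrite h2; field.
by have := ler0n R N => ?; apply/andP; split; apply: lt0r_neq0; lra.
Qed.

(** The nonzero terms form a geometric progression of ratio 1 / 2 whose first term is at most y. *)
Lemma sum_dyadic_below (y : R) N : 0 <= y ->
  \sum_(0 <= n < N) (2 ^+ n)^-1 * (y * (y <= 2 ^+ n)%R%:R) ^+ 2 <= 2 * y.
Proof.
move=> y0.
have p0 n : 0 < 2 ^+ n :> R by rewrite exprn_gt0.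
(* The subtracted y^2 / 2^n is the part of the geometric sum still to come; without it the induction
   does not close. *)
suff H n : \sum_(0 <= k < n.+1) (2 ^+ k)^-1 * (y * (y <= 2 ^+ k)%R%:R) ^+ 2 <=
    if y <= 2 ^+ n then 2 * y - y ^+ 2 / 2 ^+ n else 0.
  apply: (@le_trans _ _ (\sum_(0 <= k < N.+1) (2 ^+ k)^-1 * (y * (y <= 2 ^+ k)%R%:R) ^+ 2)).
    rewrite [leRHS]big_nat_recr//= lerDl mulr_ge0 ?sqr_ge0// invr_ge0 ltW//.
  apply: le_trans (H N) _; case: ifP => _; last by rewrite mulr_ge0.
  by rewrite gerBl divr_ge0 ?sqr_ge0// ltW.
elim: n => [|n IH].
  rewrite big_nat1 expr0 invr1 mul1r mulr1; have [y1|y1] := leP y 1.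
    by rewrite mulr1; nra.
  by rewrite mulr0 expr0n.
rewrite big_nat_recr//=.
have yle : y <= 2 ^+ n -> y <= 2 ^+ n.+1.
  by move=> h; apply: le_trans h _; rewrite exprS; have := p0 n; lra.
have E : (2 ^+ n)^-1 = 2 * (2 ^+ n.+1)^-1 :> R by rewrite exprS; field; rewrite gt_eqF.
have [y2|y2] := leP y (2 ^+ n.+1); rewrite ?mulr1 ?mulr0.
  have [y1|y1] := leP y (2 ^+ n).
    by rewrite y1 in IH; rewrite E in IH; lra.
  rewrite (lt_geF y1) /= in IH.
  have : (2 ^+ n.+1)^-1 * y ^+ 2 <= y.
    by rewrite mulrC ler_pdivrMr// expr2 ler_wpM2l.
  by lra.
have y1 : 2 ^+ n < y by rewrite ltNge; apply/negP => /yle; rewrite leNgt y2.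
by rewrite (lt_geF y1) in IH; rewrite expr0n mulr0 addr0.
Qed.

Lemma sum_dyadic_above (y : R) N : 0 <= y ->
  \sum_(0 <= n < N) 2 ^+ n * (2 ^+ n < y)%R%:R <= 2 * y.
Proof.
(* The second bound 2^N is that of the full geometric sum; at the last power below y it yields the
   bound 2 y. *)
move=> y0; suff : \sum_(0 <= n < N) 2 ^+ n * (2 ^+ n < y)%R%:R <= Num.min (2 * y) (2 ^+ N).
  by rewrite le_min => /andP[].
elim: N => [|N IH]; first by rewrite big_nil le_min mulr_ge0// exprn_ge0.
move: IH; rewrite big_nat_recr//= !le_min => /andP[h1 h2].
have p0 : 0 < 2 ^+ N :> R by rewrite exprn_gt0.
by have [hy|hy] := ltP (2 ^+ N) y; rewrite ?mulr1 ?mulr0 ?addr0 exprS; apply/andP; split; lra.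
Qed.

(** Between consecutive squares a monotone sum is squeezed, and the ratio of consecutive squares
    tends to 1. *)
Lemma cvg_avg_squares (S : nat -> R) (mu : R) : (forall n, 0 <= S n) ->
  {homo S : m n / (m <= n)%N >-> m <= n} ->
  S (k.+1 ^ 2)%N / (k.+1 ^ 2)%:R @[k --> \oo] --> mu ->
  S n / n%:R @[n --> \oo] --> mu.
Proof.
move=> S0 Sh Smu.
pose b k := S (k.+1 ^ 2)%N / (k.+1 ^ 2)%:R.
have h0 : (n.+1%:R^-1 : R) @[n --> \oo] --> 0 by exact: cvg_harmonic.
have U : b k.+1 * (1 + k.+1%:R^-1) ^+ 2 @[k --> \oo] --> mu * (1 + 0) ^+ 2.
  apply: cvgM; first by move: Smu; rewrite -(cvg_shiftS b).
  by apply: cvgM; apply: cvgD => //; exact: cvg_cst.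
have L : b k * (1 - k.+2%:R^-1) ^+ 2 @[k --> \oo] --> mu * (1 - 0) ^+ 2.
  have h1 : (n.+2%:R^-1 : R) @[n --> \oo] --> 0.
    by move: h0; rewrite -(cvg_shiftS (fun n : nat => n.+1%:R^-1 : R)).
  by apply: cvgM => //; apply: cvgM; apply: cvgB => //; exact: cvg_cst.
rewrite addr0 expr1n mulr1 in U; rewrite subr0 expr1n mulr1 in L.
apply/cvgrPdist_le => e e0.
move/cvgrPdist_le/(_ _ e0) : U => [k1 _ U]; move/cvgrPdist_le/(_ _ e0) : L => [k2 _ L].
exists ((maxn k1 k2).+1 ^ 2)%N => // n /= kn.
pose k := (Num.truncn (Num.sqrt n%:R : R)).
have s0 : 0 <= Num.sqrt n%:R :> R by rewrite sqrtr_ge0.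
have /andP[kl ku] := truncn_itv s0; rewrite -/k in kl ku.
have kn1 : (k ^ 2 <= n)%N.
  by rewrite -(ler_nat R) natrX -[leRHS]sqr_sqrtr// lerXn2r ?nnegrE.
have kn2 : (n <= k.+1 ^ 2)%N.
  by rewrite -(ler_nat R) natrX -[leLHS]sqr_sqrtr// lerXn2r ?nnegrE// ltW.
have kk : ((maxn k1 k2).+1 <= k)%N.
  rewrite leqNgt; apply/negP => H.
  have : (k.+1 ^ 2 <= (maxn k1 k2).+1 ^ 2)%N by rewrite leq_exp2r.
  move=> H2.
  have : n%:R < (k.+1 ^ 2)%:R :> R.
    by rewrite natrX -[ltLHS]sqr_sqrtr// ltrXn2r// ?nnegrE// lt_neqAle.
  by rewrite ltr_nat => H3; move: (leq_trans H3 (leq_trans H2 kn)); rewrite ltnn.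
(* From here k is the integer root minus one, so (k + 1)^2 <= n <= (k + 2)^2, in accordance with the
   shift in [b]. *)
case: k kl ku kn1 kn2 kk => // k _ _ kn1 kn2; rewrite ltnS geq_max => /andP[kk1 kk2].
have n0 : 0 < n%:R :> R by rewrite ltr0n (leq_trans _ kn1)// expn_gt0.
have k0 : 0 < k.+1%:R :> R by rewrite ltr0n.
have k20 : 0 < k.+2%:R :> R by rewrite ltr0n.
have E2 : k.+2%:R = k.+1%:R + 1 :> R by rewrite natr1.
have up : S n / n%:R <= b k.+1 * (1 + k.+1%:R^-1) ^+ 2.
  rewrite /b (_ : S _ / _ * _ = S (k.+2 ^ 2)%N / (k.+1 ^ 2)%:R); last first.
    rewrite !natrX E2; field.
    by have := ler0n R k => ?; apply/andP; split; apply: lt0r_neq0; lra.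
  rewrite ler_pM ?invr_ge0 ?ler0n ?Sh//.
  by rewrite lef_pV2 ?posrE ?ltr0n ?expn_gt0 ?ler_nat// (leq_trans _ kn1)// expn_gt0.
have lo : b k * (1 - k.+2%:R^-1) ^+ 2 <= S n / n%:R.
  rewrite /b (_ : S _ / _ * _ = S (k.+1 ^ 2)%N / (k.+2 ^ 2)%:R); last first.
    rewrite !natrX E2; field.
    by have := ler0n R k => ?; apply/andP; split; apply: lt0r_neq0; lra.
  rewrite ler_pM ?invr_ge0 ?ler0n ?Sh//.
  by rewrite lef_pV2 ?posrE ?ltr0n ?expn_gt0 ?ler_nat// (leq_trans _ kn1)// expn_gt0.
have : `|mu - b k.+1 * (1 + k.+1%:R^-1) ^+ 2| <= e := U k kk1.
have : `|mu - b k * (1 - k.+2%:R^-1) ^+ 2| <= e := L k kk2.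
move: up lo; move: (b k.+1 * _) (b k * _) (S n / _) => x1 x2 x3 ? ?.
rewrite !ler_norml => /andP[? ?] /andP[? ?].
by apply/andP; split; lra.
Qed.

End interpolation.

Section slln.
Context d (T : measurableType d) (R : realType) (P : probability T R).
Context d' (T' : measurableType d') (X : nat -> {RV P >-> T'}).
Hypothesis indep : mutually_independent X.
Hypothesis idist : identically_distributed X.
Implicit Types h : T' -> R.

(** The variance of an average of independent terms, with the variance of one term bounded by its
    second moment. *)
Lemma mean_sqr_avg h (c : R) N : measurable_fun setT h -> (forall x, `|h x| <= c) ->
  (0 < N)%N ->
  let mu := mean P (fun w => h (X 0%N w)) in
  let dev w := (\sum_(0 <= i < N) h (X i w)) / N%:R - mu in
  rintegrable P (fun w => dev w ^+ 2) /\
  mean P (fun w => dev w ^+ 2) <= N%:R^-1 * mean P (fun w => h (X 0%N w) ^+ 2).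
Proof.
move=> mh hc N0 mu dev.
have mX f : measurable_fun setT f -> measurable_fun setT (fun w => (f (X 0%N w) : R)).
  by move=> mf; exact: measurableT_comp.
have ih : rintegrable P (fun w => h (X 0%N w)).
  by apply: (@rintegrable_bounded _ _ _ _ _ c) => [|w]; [exact: mX|exact: hc].
have ih2 : rintegrable P (fun w => h (X 0%N w) ^+ 2).
  apply: (@rintegrable_bounded _ _ _ _ _ (c ^+ 2)) => [|w].
    by apply: (mX (fun x => h x ^+ 2)); exact: measurable_funX.
  rewrite normrX lerXn2r ?nnegrE//; exact: le_trans (hc (X 0%N w)).
pose k x := h x - mu.
have mk : measurable_fun setT k by apply: measurable_funB.
have k2E : (fun w => k (X 0%N w) ^+ 2) =
    (fun w => h (X 0%N w) ^+ 2 + ((- 2 * mu) * h (X 0%N w) + mu ^+ 2)).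
  by apply/funext => w; rewrite /k; ring.
have i1 : rintegrable P (fun w => (- 2 * mu) * h (X 0%N w)) by exact: rintegrableZ.
have i2 := rintegrableD i1 (rintegrable_cst P (mu ^+ 2)).
have ik2 : rintegrable P (fun w => k (X 0%N w) ^+ 2) by rewrite k2E; exact: rintegrableD.
have mk2 : mean P (fun w => k (X 0%N w) ^+ 2) <= mean P (fun w => h (X 0%N w) ^+ 2).
  rewrite k2E (meanD ih2 i2) (meanD i1 (rintegrable_cst P _)) (meanZ _ ih) mean_cst.
  by rewrite -/mu; have := sqr_ge0 mu; clear; nra.
have k0 : mean P (fun w => k (X 0%N w)) = 0.
  by rewrite /k meanB ?mean_cst ?subrr//; exact: rintegrable_cst.
have [is_ es] := mean_sqr_sum indep idist N mk ik2 k0.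
have NN : N%:R != 0 :> R by rewrite pnatr_eq0 -lt0n.
pose G w := (N%:R ^+ 2)^-1 * (\sum_(0 <= i < N) k (X i w)) ^+ 2.
have devE : G = (fun w => dev w ^+ 2).
  apply/funext => w; rewrite /G /dev /k sumrB sumr_const_nat subn0 -mulr_natl.
  by field.
suff : rintegrable P G /\ mean P G <= N%:R^-1 * mean P (fun w => h (X 0%N w) ^+ 2).
  by rewrite devE.
split; first exact: rintegrableZ.
rewrite /G meanZ// es mulrA (_ : (N%:R ^+ 2)^-1 * N%:R = N%:R^-1); last by field.
by rewrite ler_wpM2l// invr_ge0.
Qed.

(** Along the squares the mean square errors are summable, and since h is nonnegative its partial
    sums are monotone, which fills the gaps between squares. *)
Lemma slln_bounded h (c : R) : measurable_fun setT h -> (forall x, 0 <= h x <= c) ->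
  {ae P, forall w, (\sum_(0 <= i < n) h (X i w)) / n%:R @[n --> \oo] -->
    mean P (fun w => h (X 0%N w))}.
Proof.
move=> mh hc; set mu := mean P _.
have habs x : `|h x| <= c by have /andP[? ?] := hc x; rewrite ger0_norm.
pose xi k w := ((\sum_(0 <= i < (k.+1 ^ 2)%N) h (X i w)) / (k.+1 ^ 2)%:R - mu) ^+ 2.
have Hk k := @mean_sqr_avg h c (k.+1 ^ 2)%N mh habs (expn_gt0 _ _).
set v := mean P (fun w => h (X 0%N w) ^+ 2) in Hk.
have v0 : 0 <= v by apply: mean_ge0 => w; exact: sqr_ge0.
have : {ae P, forall w, xi k w @[k --> \oo] --> 0}.
  apply: (@ae_cvg0 _ _ _ _ _ (v * 2)) => [k|k w|N].
  - exact: (Hk k).1.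
  - exact: sqr_ge0.
  apply: (@le_trans _ _ (\sum_(0 <= k < N) v * (k.+1%:R ^+ 2)^-1)).
    apply: ler_sum => k _; apply: le_trans (Hk k).2 _.
    by rewrite mulrC natrX.
  rewrite -mulr_sumr ler_wpM2l//; apply: le_trans (sum_inv_sqr N) _.
  by rewrite gerBl invr_ge0.
apply: filterS => w /cvg_sqr0 H.
apply: cvg_avg_squares => [n|m n mn|].
- by apply: sumr_ge0 => i _; have /andP[] := hc (X i w).
- rewrite (big_cat_nat _ mn)//= lerDl; apply: sumr_ge0 => i _.
  by have /andP[] := hc (X i w).
apply: (@cvg_dist_bound _ _
  (fun k => `|(\sum_(0 <= i < (k.+1 ^ 2)%N) h (X i w)) / (k.+1 ^ 2)%:R - mu|)) => //.
have := cvg_norm H; rewrite normr0; exact.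
Qed.

(* Truncation at [2 ^+ n] on the block of length [2 ^ n]: both the truncation errors
   and the variances are summable. *)
Lemma slln_upper h : measurable_fun setT h -> (forall x, 0 <= h x) ->
  rintegrable P (fun w => h (X 0%N w)) ->
  {ae P, forall w, forall e, 0 < e -> \forall n \near \oo,
    \sum_(0 <= i < n) h (X i w) <= n%:R * (2 * (mean P (fun w => h (X 0%N w)) + e))}.
Proof.
move=> mh h0 ih; set M := mean P _.
have M0 : 0 <= M by apply: mean_ge0.
have p0 n : 0 < 2 ^+ n :> R by rewrite exprn_gt0.
pose A n : set T' := [set x | h x <= 2 ^+ n].
have mA n : measurable (A n).
  have := mh measurableT `]-oo, (2 ^+ n)]%classic (measurable_itv _).
  by rewrite setTI; congr measurable; apply/seteqP; split=> x /=; rewrite in_itv.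
pose tr n x : R := h x * \1_(A n) x.
have trE n x : tr n x = h x * (h x <= 2 ^+ n)%R%:R.
  rewrite /tr indicE; have [H|H] := boolP (h x <= 2 ^+ n); first by rewrite mem_set.
  by rewrite memNset// /A /=; exact/negP.
have tr_bd n x : 0 <= tr n x <= 2 ^+ n.
  rewrite trE; have [H|H] := leP (h x) (2 ^+ n); rewrite ?mulr1 ?mulr0.
    by rewrite h0.
  by rewrite lexx ltW.
have tr_le n x : tr n x <= h x.
  by rewrite trE; have [H|H] := leP (h x) (2 ^+ n); rewrite ?mulr1 ?mulr0.
have mtr n : measurable_fun setT (tr n).
  by apply: measurable_funM => //; exact: measurable_indic.
have mX (f : T' -> R) i : measurable_fun setT f -> measurable_fun setT (fun w => f (X i w)).
  by move=> mf; exact: measurableT_comp.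
have itr n : rintegrable P (fun w => tr n (X 0%N w)).
  apply: (le_rintegrable _ _ ih) => [|w]; first exact: mX.
  by have /andP[? _] := tr_bd n (X 0%N w); rewrite ger0_norm.
pose mu n := mean P (fun w => tr n (X 0%N w)).
have muM n : mu n <= M by apply: le_mean.
have tr_abs n x : `|tr n x| <= 2 ^+ n by have /andP[? ?] := tr_bd n x; rewrite ger0_norm.
pose xi n w := ((\sum_(0 <= i < (2 ^ n)%N) tr n (X i w)) / (2 ^ n)%:R - mu n) ^+ 2.
have Hn n := @mean_sqr_avg (tr n) (2 ^+ n) (2 ^ n)%N (mtr n) (tr_abs n) (expn_gt0 _ _).
have itr2 n : rintegrable P (fun w => tr n (X 0%N w) ^+ 2).
  apply: (@rintegrable_bounded _ _ _ _ _ ((2 ^+ n) ^+ 2)) => [|w].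
    by apply: measurable_funX; exact: mX.
  by rewrite normrX lerXn2r ?nnegrE// ?exprn_ge0.
have ae1 : {ae P, forall w, xi n w @[n --> \oo] --> 0}.
  apply: (@ae_cvg0 _ _ _ _ _ (2 * M)) => [n|n w|N].
  - exact: (Hn n).1.
  - exact: sqr_ge0.
  apply: (@le_trans _ _ (\sum_(0 <= n < N) mean P (fun w => (2 ^+ n)^-1 * tr n (X 0%N w) ^+ 2))).
    apply: ler_sum => n _; apply: le_trans (Hn n).2 _.
    by rewrite natrX meanZ.
  rewrite -mean_sum => [|n]; last exact: rintegrableZ.
  rewrite -meanZ//; apply: le_mean => [||w].
  - by apply: rintegrable_sum => n _; exact: rintegrableZ.
  - exact: rintegrableZ.
  by under eq_bigr do rewrite trE; exact: sum_dyadic_below.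
(* Counts the terms of the block that truncation alters; its mean is 2^n times the probability of
   exceeding 2^n, and these means are summable. *)
pose zeta n w := \sum_(0 <= i < (2 ^ n)%N) \1_(~` A n) (X i w) : R.
have mind n : measurable_fun setT (\1_(~` A n) : T' -> R).
  by apply: measurable_indic; exact: measurableC.
have iind n : rintegrable P (fun w => \1_(~` A n) (X 0%N w)).
  apply: (@rintegrable_bounded _ _ _ _ _ 1) => [|w]; first exact: mX.
  by rewrite indicE; case: (_ \in _); rewrite ?normr1 ?normr0.
have iindi n i := ident_mean idist i (mind n) (iind n).
have ae2 : {ae P, forall w, zeta n w @[n --> \oo] --> 0}.
  apply: (@ae_cvg0 _ _ _ _ _ (2 * M)) => [n|n w|N].
  - by apply: rintegrable_sum => i _; exact: (iindi n i).1.
  - by apply: sumr_ge0.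
  apply: (@le_trans _ _ (\sum_(0 <= n < N) mean P (fun w => 2 ^+ n * \1_(~` A n) (X 0%N w)))).
    apply: ler_sum => n _; rewrite /zeta mean_sum => [|i]; last exact: (iindi n i).1.
    under eq_bigr do rewrite (iindi n _).2.
    by rewrite sumr_const_nat subn0 (meanZ _ (iind n)) -natrX mulr_natl.
  rewrite -mean_sum => [|n]; last exact: rintegrableZ.
  rewrite -meanZ//; apply: le_mean => [||w].
  - by apply: rintegrable_sum => n _; exact: rintegrableZ.
  - exact: rintegrableZ.
  apply: le_trans (sum_dyadic_above N (h0 (X 0%N w))); apply: ler_sum => n _.
  apply: ler_wpM2l; first by rewrite ltW.
  rewrite indicE ler_nat; have [H|H] := boolP (X 0%N w \in _) => //.
  by move: H; rewrite inE /= => /negP; rewrite -ltNge => ->.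
move: ae1 ae2; apply: filterS2 => w /cvg_sqr0 H1 H2 e e0.
move/cvgrPdist_le/(_ _ e0) : H1 => [n1 _ H1].
have half0 : 0 < 2^-1 :> R by rewrite invr_gt0.
move/cvgrPdist_le/(_ _ half0) : H2 => [n2 _ H2].
have key n : (maxn n1 n2 <= n)%N ->
    \sum_(0 <= i < (2 ^ n)%N) h (X i w) <= 2 ^+ n * (M + e).
  rewrite geq_max => /andP[nn1 nn2].
  have zi i : (i < 2 ^ n)%N -> h (X i w) <= 2 ^+ n.
    (* A single exceedance would make the count [zeta] at least 1, against the eventual bound 1 /
       2. *)
    move=> i2; rewrite leNgt; apply/negP => hi.
    have : `|0 - zeta n w| <= 2^-1 := H2 n nn2.
    rewrite sub0r normrN /zeta (bigD1_seq i) ?mem_index_iota ?iota_uniq//=.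
    have -> : \1_(~` A n) (X i w) = 1 :> R.
      by rewrite indicE mem_set//= /A /=; apply/negP; rewrite -ltNge.
    rewrite ger0_norm; last by rewrite addr_ge0// sumr_ge0.
    have : 0 <= \sum_(0 <= j < (2 ^ n)%N | j != i) \1_(~` A n) (X j w) :> R by rewrite sumr_ge0.
    by lra.
  have : `|0 - ((\sum_(0 <= i < (2 ^ n)%N) tr n (X i w)) / (2 ^ n)%:R - mu n)| <= e := H1 n nn1.
  have -> : \sum_(0 <= i < (2 ^ n)%N) tr n (X i w) = \sum_(0 <= i < (2 ^ n)%N) h (X i w).
    rewrite !big_seq; apply: eq_bigr => i; rewrite mem_index_iota => /andP[_ i2].
    by rewrite trE zi// mulr1.
  rewrite sub0r normrN ler_norml => /andP[_ H].
  have := muM n => muMn.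
  have {}H : (\sum_(0 <= i < (2 ^ n)%N) h (X i w)) / (2 ^ n)%:R <= M + e by lra.
  by move: H; rewrite natrX ler_pdivrMr// mulrC.
exists (2 ^ (maxn n1 n2))%N => // n /= nn.
have n0 : (0 < n)%N by apply: leq_trans nn; rewrite expn_gt0.
have /andP[l1 l2] := trunc_log_bounds (isT : (1 < 2)%N) n0.
set k := trunc_log 2 n in l1 l2.
have kk : (maxn n1 n2 <= k.+1)%N.
  rewrite leqNgt; apply/negP => H.
  have : (2 ^ k.+1 <= 2 ^ maxn n1 n2)%N by rewrite leq_exp2l// ltnW.
  by move=> H2'; have := leq_trans l2 (leq_trans H2' nn); rewrite ltnn.
(* Extending a sum of nonnegative terms to the next power of 2 is the source of the factor 2. *)
apply: (@le_trans _ _ (\sum_(0 <= i < (2 ^ k.+1)%N) h (X i w))).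
  rewrite [leRHS](big_cat_nat _ (ltnW l2))//= lerDl; exact: sumr_ge0.
apply: le_trans (key _ kk) _.
have Me : 0 <= M + e by rewrite addr_ge0// ltW.
have kn : 2 ^+ k <= n%:R :> R by rewrite -natrX ler_nat.
by have := ler_wpM2r Me kn; rewrite exprS; lra.
Qed.

(** The part of h below level k obeys the bounded law, while the excess has mean [t k] tending to 0,
    so an upper bound that is off by a factor 2 suffices for it. *)
Lemma slln_ge0 h : measurable_fun setT h -> (forall x, 0 <= h x) ->
  rintegrable P (fun w => h (X 0%N w)) ->
  {ae P, forall w, (\sum_(0 <= i < n) h (X i w)) / n%:R @[n --> \oo] -->
    mean P (fun w => h (X 0%N w))}.
Proof.
move=> mh h0 ih; set M := mean P _.
pose lo (k : nat) x : R := Num.min (h x) k%:R.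
pose hi (k : nat) x : R := h x - lo k x.
have mlo k : measurable_fun setT (lo k) by apply: measurable_minr.
have mhi k : measurable_fun setT (hi k) by apply: measurable_funB.
have lo_bd k x : 0 <= lo k x <= k%:R by rewrite le_min h0 ler0n ge_min lexx orbT.
have lo_le k x : lo k x <= h x by rewrite ge_min lexx.
have hi0 k x : 0 <= hi k x by rewrite subr_ge0.
have ilo k : rintegrable P (fun w => lo k (X 0%N w)).
  apply: (@rintegrable_bounded _ _ _ _ _ k%:R) => [|w]; first exact: measurableT_comp.
  by have /andP[? ?] := lo_bd k (X 0%N w); rewrite ger0_norm.
have ihi k : rintegrable P (fun w => hi k (X 0%N w)) := rintegrableB ih (ilo k).
pose t k := mean P (fun w => hi k (X 0%N w)).
have tE k : t k = M - mean P (fun w => lo k (X 0%N w)) := meanB ih (ilo k).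
have t0 : t k @[k --> \oo] --> 0.
  rewrite -(@mean_cst _ _ _ P 0).
  apply: (@mean_dct _ _ _ P _ _ (fun w => h (X 0%N w)) _ ih _ _).2 => [k|k w|w].
  - exact: rintegrable_measurable (ihi k).
  - rewrite ger0_norm ?hi0// /hi lerBlDr lerDl.
    by have /andP[] := lo_bd k (X 0%N w).
  apply/cvgrPdist_le => e e0.
  exists (Num.truncn (h (X 0%N w))).+1 => // k /= hk.
  rewrite /hi /lo (min_idPl _) ?subrr ?subr0 ?normr0 ?ltW//.
  by apply: lt_le_trans (truncnS_gt _) _; rewrite ler_nat.
have ae1 := ae_foralln (fun k => slln_bounded (mlo k) (lo_bd k)).
have ae2 := ae_foralln (fun k => slln_upper (mhi k) (hi0 k) (ihi k)).
move: ae1 ae2; apply: filterS2 => w H1 H2.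
apply/cvgrPdist_le => e e0.
(* The bounded part costs e / 6, and the excess at most 2 (t k + e / 6) <= 4 e / 6. *)
have e6 : 0 < e / 6 by rewrite divr_gt0.
move/cvgrPdist_le/(_ _ e6) : t0 => [k _ tk].
have {}tk : `|0 - t k| <= e / 6 := tk k (leqnn k).
have {}H1 := H1 k; move/cvgrPdist_le/(_ _ e6) : H1 => H1.
have {}H2 := H2 k _ e6; rewrite -/(t k) in H2.
near=> n.
have n0 : 0 < n%:R :> R by rewrite ltr0n; near: n; exists 1%N.
have h1 : `|mean P (fun w => lo k (X 0%N w)) - (\sum_(0 <= i < n) lo k (X i w)) / n%:R| <= e / 6.
  by near: n.
have h2 : \sum_(0 <= i < n) hi k (X i w) <= n%:R * (2 * (t k + e / 6)).
  by near: n.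
have {}h2 : (\sum_(0 <= i < n) hi k (X i w)) / n%:R <= 2 * (t k + e / 6).
  by rewrite ler_pdivrMr// mulrC.
have h3 : 0 <= (\sum_(0 <= i < n) hi k (X i w)) / n%:R by rewrite divr_ge0// sumr_ge0.
have E : (\sum_(0 <= i < n) h (X i w)) / n%:R =
    (\sum_(0 <= i < n) lo k (X i w)) / n%:R + (\sum_(0 <= i < n) hi k (X i w)) / n%:R.
  rewrite -mulrDl -big_split; congr (_ / _); apply: eq_bigr => i _.
  by rewrite /= /hi addrCA subrr addr0.
have t00 : 0 <= t k by apply: mean_ge0.
have := tE k; move: tk h1; rewrite E sub0r normrN !ler_norml => /andP[_ ?] /andP[? ?] ?.
by apply/andP; split; lra.
Unshelve. all: by end_near. Qed.

End slln.

(** * Norm, coordinates and measurability in [l2] *)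

Section l2_facts.
Variable R : realType.
Implicit Types x y : l2 R.

Lemma dot_seriesE m x : dot m x x = series (fun k => x k ^+ 2) m.
Proof. by rewrite /dot /series /= big_mkord; apply: eq_bigr => j _; rewrite expr2. Qed.

Lemma l2_cvg x : cvgn (series (fun k => x k ^+ 2)).
Proof. exact/asboolP/(l2_coordP x). Qed.

Lemma l2_norm_sqr x : `|x| ^+ 2 = limn (series (fun k => x k ^+ 2)).
Proof.
rewrite -[`|x|]/(l2_norm x) /l2_norm sqr_sqrtr// /l2_sqnorm.
by apply: limr_ge; [exact: l2_cvg|apply: nearW => n; rewrite -dot_seriesE dot_ge0].
Qed.

Lemma dot_le_norm m x : dot m x x <= `|x| ^+ 2.
Proof.
rewrite l2_norm_sqr dot_seriesE; apply: nondecreasing_cvgn_le; last exact: l2_cvg.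
by apply/nondecreasing_series => k _ _; exact: sqr_ge0.
Qed.

Lemma dot_cvg_norm x : dot m x x @[m --> \oo] --> `|x| ^+ 2.
Proof.
rewrite l2_norm_sqr (_ : (fun m => _) = series (fun k => x k ^+ 2)); first exact: l2_cvg.
by apply/funext => m; rewrite dot_seriesE.
Qed.

Lemma coord_le_norm k x : `|x k| <= `|x|.
Proof.
rewrite -(@ler_pXn2r _ 2) ?nnegrE// real_normK ?num_real//.
apply: le_trans (dot_le_norm k.+1 x).
by rewrite /dot big_ord_recr/= expr2 lerDr; exact: dot_ge0.
Qed.

(** Valued in [R^o] so as to be one of the linear functionals against which the weak expectation is
    tested. *)
Definition coord (k : nat) (x : l2 R) : R^o := x k.

Lemma coord_linear k : linear (coord k).
Proof. by []. Qed.

HB.instance Definition _ k := @GRing.isLinear.Build R (l2 R) R^o _ (coord k) (coord_linear k).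

Lemma coord_continuous k : continuous (coord k).
Proof.
move=> x; apply/(@cvgrPdist_le R R^o _ _ (nbhs_filter x)) => e e0.
have /cvgrPdist_le/(_ _ e0) : id y @[y --> x] --> x by exact: cvg_id.
apply: filterS => y /= xy; have -> : coord k x - coord k y = coord k (x - y) by rewrite raddfB.
exact: le_trans (coord_le_norm k _) xy.
Qed.

Lemma continuous_l2_measurable (f : l2 R -> R) : continuous f -> measurable_fun setT f.
Proof.
move=> /continuousP cf; apply: (measurability _ (RGenOpens.measurableE R)).
move=> _ [_ [a [b ->] <-]]; rewrite setTI; apply: sub_sigma_algebra.
exact/cf/interval_open.
Qed.

Lemma measurable_coord k : measurable_fun setT (fun x : l2 R => x k).
Proof. exact: (continuous_l2_measurable (@coord_continuous k)). Qed.

Lemma measurable_norm_sqr : measurable_fun setT (fun x : l2 R => `|x| ^+ 2).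
Proof.
apply: measurable_funX; apply: continuous_l2_measurable.
exact: norm_continuous.
Qed.

End l2_facts.

Lemma slln d (T : measurableType d) (R : realType) (P : probability T R)
    d' (T' : measurableType d') (X : nat -> {RV P >-> T'}) (h : T' -> R) :
  mutually_independent X -> identically_distributed X ->
  measurable_fun setT h -> rintegrable P (fun w => h (X 0%N w)) ->
  {ae P, forall w, (\sum_(0 <= i < n) h (X i w)) / n%:R @[n --> \oo] -->
    mean P (fun w => h (X 0%N w))}.
Proof.
move=> indep idist mh ih.
pose p x : R := Num.max (h x) 0; pose q x : R := Num.max (- h x) 0.
have mp : measurable_fun setT p by apply: measurable_maxr.
have mq : measurable_fun setT q by apply: measurable_maxr => //; exact: measurable_funN.
have p0 x : 0 <= p x by rewrite le_max lexx orbT.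
have q0 x : 0 <= q x by rewrite le_max lexx orbT.
have pqE x : h x = p x - q x.
  have := le_total 0 (h x); rewrite /p /q => /orP[h0|h0].
    by rewrite (max_idPl h0) (max_idPr _) ?subr0// oppr_le0.
  by rewrite (max_idPr h0) (max_idPl _) ?opprK ?add0r// oppr_ge0.
have pqn x : p x + q x = `|h x|.
  have := le_total 0 (h x); rewrite /p /q => /orP[h0|h0].
    by rewrite (ger0_norm h0) (max_idPl h0) (max_idPr _) ?addr0// oppr_le0.
  by rewrite (ler0_norm h0) (max_idPr h0) (max_idPl _) ?add0r// oppr_ge0.
have ip : rintegrable P (fun w => p (X 0%N w)).
  apply: (le_rintegrable _ _ (rintegrable_norm ih)) => [|w]; first exact: measurableT_comp.
  by rewrite ger0_norm// -pqn lerDl.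
have iq : rintegrable P (fun w => q (X 0%N w)).
  apply: (le_rintegrable _ _ (rintegrable_norm ih)) => [|w]; first exact: measurableT_comp.
  by rewrite ger0_norm// -pqn lerDr.
have -> : mean P (fun w => h (X 0%N w)) =
    mean P (fun w => p (X 0%N w)) - mean P (fun w => q (X 0%N w)).
  by rewrite -meanB//; congr mean; apply/funext => w; rewrite -pqE.
move: (slln_ge0 indep idist mp p0 ip) (slln_ge0 indep idist mq q0 iq).
apply: filterS2 => w H1 H2.
rewrite (_ : (fun n => _) = (fun n => (\sum_(0 <= i < n) p (X i w)) / n%:R -
    (\sum_(0 <= i < n) q (X i w)) / n%:R)); first exact: cvgB.
apply/funext => n; rewrite -mulrBl -sumrB; congr (_ / _).
by apply: eq_bigr => i _; exact: pqE.
Qed.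

Section moments.
Context (R : realType) d (T : measurableType d) (P : probability T R) (Z : nat -> {RV P >-> l2 R}).
Hypothesis Z_indep : mutually_independent Z.
Hypothesis Z_idist : identically_distributed Z.
Hypothesis Z_mean : has_expectation P (Z 0%N) 0.
Hypothesis Z_sqnorm : ('E_P[fun w => (`|Z 0%N w| ^+ 2)%R] < +oo)%E.

Lemma rintegrable_norm_sqr : rintegrable P (fun w => `|Z 0%N w| ^+ 2).
Proof.
apply/integrableP; split.
  by apply/measurable_EFinP; exact: (measurableT_comp (@measurable_norm_sqr R)).
apply: le_lt_trans Z_sqnorm; rewrite unlock le_eqVlt; apply/orP; left; apply/eqP.
by apply: eq_integral => w _; rewrite gee0_abs// lee_fin sqr_ge0.
Qed.

Lemma rintegrable_coordM j k : rintegrable P (fun w => Z 0%N w j * Z 0%N w k).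
Proof.
apply: (le_rintegrable _ _ rintegrable_norm_sqr) => [|w].
  by apply: measurable_funM; exact: (measurableT_comp (@measurable_coord R _)).
rewrite normrM expr2 ler_pM//; exact: coord_le_norm.
Qed.

Lemma mean_coord j : rintegrable P (fun w => Z 0%N w j) /\ mean P (fun w => Z 0%N w j) = 0.
Proof.
have [i E] := @Z_mean (@coord R j) (@coord_continuous R j).
split; first exact: i.
have E0 : coord j (0 : l2 R) = 0 by exact: raddf0.
by move: E; rewrite unlock => /(congr1 fine) E; rewrite -[RHS]E0; exact: E.
Qed.

Definition covariance_coord j k := mean P (fun w => Z 0%N w j * Z 0%N w k).

(** Finiteness of the trace of the covariance is what makes the variance beyond coordinate m
    small. *)
Lemma covariance_cvg :
  \sum_(j < m) covariance_coord j j @[m --> \oo] --> mean P (fun w => `|Z 0%N w| ^+ 2).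
Proof.
have -> : (fun m => \sum_(j < m) covariance_coord j j) =
    (fun m => mean P (fun w => dot m (Z 0%N w) (Z 0%N w))).
  by apply/funext => m; rewrite /dot mean_sum// => j; exact: rintegrable_coordM.
apply: (@mean_dct _ _ _ P _ _ (fun w => `|Z 0%N w| ^+ 2) _ rintegrable_norm_sqr _ _).2 => [m|m w|w].
- by apply: rintegrable_measurable; apply: rintegrable_sum => j _; exact: rintegrable_coordM.
- by rewrite ger0_norm ?dot_ge0// dot_le_norm.
- exact: dot_cvg_norm.
Qed.

(** Countably many strong laws hold simultaneously outside one null set. The bootstrap is then
    studied along a single fixed sequence with these three properties. *)
Lemma good_sample : {ae P, forall w,
  [/\ forall j, (\sum_(0 <= i < n) Z i w j) / n%:R @[n --> \oo] --> (0 : R),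
    forall j k, (\sum_(0 <= i < n) Z i w j * Z i w k) / n%:R @[n --> \oo] --> covariance_coord j k &
    (\sum_(0 <= i < n) `|Z i w| ^+ 2) / n%:R @[n --> \oo] --> mean P (fun w => `|Z 0%N w| ^+ 2)]}.
Proof.
have a1 j := @slln _ _ _ P _ _ Z (fun x : l2 R => x j) Z_indep Z_idist
  (@measurable_coord R j) (mean_coord j).1.
have a2 j k := @slln _ _ _ P _ _ Z (fun x : l2 R => x j * x k) Z_indep Z_idist
  (measurable_funM (@measurable_coord R j) (@measurable_coord R k)) (rintegrable_coordM j k).
have a3 := @slln _ _ _ P _ _ Z (fun x : l2 R => `|x| ^+ 2) Z_indep Z_idist
  (@measurable_norm_sqr R) rintegrable_norm_sqr.
move: (ae_foralln a1) (ae_foralln (fun j => ae_foralln (a2 j))) a3.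
apply: filterS3 => w H1 H2 H3; split=> //.
by move=> j; have := H1 j; rewrite (mean_coord j).2.
Qed.

End moments.

(** * Bootstrap and sample laws *)

Section pointwise.
Context {R : realType}.
Implicit Types v : nat -> R.

(** Its mean under the law of a sum is the distribution function at x of the squared norm. *)
Definition in_ball d (x : R) v : R := (dot d v v <= x)%R%:R.

Lemma dot_mono m d v : (m <= d)%N -> dot m v v <= dot d v v.
Proof.
move=> /subnK <-; rewrite addnC /dot big_split_ord /= lerDl.
by apply: sumr_ge0 => j _; rewrite -expr2 sqr_ge0.
Qed.

Lemma in_ball_le_cutoff m d x e v : (m <= d)%N -> 0 < e ->
  in_ball d x v <= cutoff m x e v.
Proof.
move=> md e0; rewrite /in_ball; have [H|H] := leP (dot d v v) x; last exact: cutoff_ge0.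
by rewrite cutoff_id// (le_trans (dot_mono v md)).
Qed.

(** The shift 6 e is 3 e + 3 e: the cutoff is 0 once the first m coordinates reach x - 3 e, so it
    can exceed the indicator only if the remaining coordinates contribute at least 3 e, and a
    pointwise form of Markov's inequality pays for that. *)
Lemma cutoff_le_in_ball m d x e v : (m <= d)%N -> 0 < e ->
  cutoff m (x - 6 * e) e v <= in_ball d x v + (3 * e)^-1 * (dot d v v + -1 * dot m v v).
Proof.
move=> md e0; have e3 : 0 < 3 * e by rewrite mulr_gt0.
have D := dot_mono v md.
have H0 : 0 <= (3 * e)^-1 * (dot d v v + -1 * dot m v v).
  by rewrite mulr_ge0 ?invr_ge0 ?(ltW e3)//; lra.
rewrite /in_ball; have [H|H] := leP (dot d v v) x.
  by apply: le_trans (cutoff_le1 _ _ _ _) _; rewrite lerDl.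
rewrite add0r; have [H2|H2] := leP (x - 3 * e) (dot m v v).
  by rewrite cutoff_out//; lra.
apply: le_trans (cutoff_le1 _ _ _ _) _.
by rewrite mulrC ler_pdivlMr// mul1r; lra.
Qed.

(** A pointwise form of Markov's inequality, for the thresholds that the uniform expansion does not
    reach. *)
Lemma outside_le d x v : 0 < x -> 1 <= in_ball d x v + x^-1 * dot d v v.
Proof.
move=> x0; rewrite /in_ball; have [H|H] := leP (dot d v v) x.
  by rewrite lerDl mulr_ge0 ?dot_ge0// invr_ge0 ltW.
by rewrite add0r mulrC ler_pdivlMr// mul1r ltW.
Qed.

(** Cross terms vanish by centring, so second moments add. *)
Lemma iter_avg_dot (I : finType) (p : I -> R) (x : I -> nat -> R) d n u :
  weights p -> (forall j, (j < d)%N -> \sum_i p i * x i j = 0) ->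
  iter n (avg p x) (fun v => dot d v v) u =
  dot d u u + n%:R * \sum_(j < d) cov p x j j.
Proof.
move=> p1 x0; elim: n u => [|n IH] u; first by rewrite mul0r addr0.
rewrite iterS {1}/avg; under eq_bigr do rewrite IH dot_sqrD.
have E1 : \sum_i p i * dot d u (x i) = 0.
  transitivity (\sum_(j < d) u j * \sum_i p i * x i j).
    under [RHS]eq_bigr do rewrite mulr_sumr.
    rewrite exchange_big; apply: eq_bigr => i _; rewrite mulr_sumr.
    by apply: eq_bigr => j _; rewrite mulrCA.
  by rewrite big1// => j _; rewrite x0 ?mulr0.
have E2 : \sum_i p i * dot d (x i) (x i) = \sum_(j < d) cov p x j j.
  by rewrite /cov exchange_big; apply: eq_bigr => i _; rewrite mulr_sumr.
set t := \sum_(j < d) cov p x j j in E2 *.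
transitivity (\sum_i (p i * (dot d u u + n%:R * t) + (2 * (p i * dot d u (x i)) +
    p i * dot d (x i) (x i)))).
  by apply: eq_bigr => i _; ring.
rewrite !big_split /= -mulr_suml p1.2 -mulr_sumr E1 E2.
by rewrite -[n.+1%:R]natr1; ring.
Qed.

End pointwise.

Section empirical.
Context {R : realType}.
Variable z : nat -> nat -> R.

Definition smean n j : R := (\sum_(0 <= i < n) z i j) / n%:R.
Definition unif n (i : 'I_n) : R := n%:R^-1.
Definition bstep n (i : 'I_n) (j : nat) : R := (z i j - smean n j) / Num.sqrt n%:R.
Definition scov n j k : R := (\sum_(0 <= i < n) z i j * z i k) / n%:R - smean n j * smean n k.

Lemma unif_weights n : (0 < n)%N -> weights (@unif n).
Proof.
move=> n0; split=> [i|]; first by rewrite invr_ge0.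
by rewrite /unif sumr_const card_ord -[_ *+ n]mulr_natl mulfV// pnatr_eq0 -lt0n.
Qed.

Let sqrtn_neq0 n : (0 < n)%N -> Num.sqrt n%:R != 0 :> R.
Proof. by move=> n0; rewrite gt_eqF// sqrtr_gt0 ltr0n. Qed.

Lemma bstep_mean n j : (0 < n)%N -> \sum_(i < n) unif i * bstep i j = 0.
Proof.
move=> n0; have nn : n%:R != 0 :> R by rewrite pnatr_eq0 -lt0n.
rewrite /unif /bstep -mulr_sumr -mulr_suml sumrB sumr_const card_ord.
rewrite /smean big_mkord -[_ *+ n]mulr_natl.
set S := \sum_(i < n) _; rewrite (_ : S - _ = 0) ?mul0r ?mulr0//.
by field.
Qed.

Lemma bstep_cov n j k : (0 < n)%N -> cov (@unif n) (@bstep n) j k = n%:R^-1 * scov n j k.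
Proof.
move=> n0; have nn : n%:R != 0 :> R by rewrite pnatr_eq0 -lt0n.
rewrite /cov /unif -mulr_sumr; congr (_ * _).
have sn := sqrtn_neq0 n0.
have sq : Num.sqrt n%:R ^+ 2 = n%:R :> R by rewrite sqr_sqrtr.
transitivity ((\sum_(i < n) (z i j * z i k - smean n k * z i j - smean n j * z i k
   + smean n j * smean n k)) / n%:R).
  rewrite mulr_suml; apply: eq_bigr => i _; rewrite /bstep.
  by move: sn sq; move: (Num.sqrt n%:R) => s sn <-; field.
rewrite big_split /= !sumrB -2!mulr_sumr sumr_const card_ord -[_ *+ n]mulr_natl.
rewrite /scov (big_mkord xpredT (fun i => z i j * z i k)).
have E l : \sum_(i < n) z i l = n%:R * smean n l.
  by rewrite /smean big_mkord; field.
rewrite !E; field; exact: nn.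
Qed.

Definition maxstep m n : R := \big[Num.max/0]_(i < n) dot m (@bstep n i) (@bstep n i).

Lemma maxstep_ge m n (i : 'I_n) : dot m (bstep i) (bstep i) <= maxstep m n.
Proof. exact: le_bigmax. Qed.

Lemma maxstep_le m n e : 0 <= e ->
  (forall i : 'I_n, dot m (bstep i) (bstep i) <= e) -> maxstep m n <= e.
Proof. by move=> e0 H; apply/bigmax_leP. Qed.

Lemma maxstep_ge0 m n : 0 <= maxstep m n.
Proof. by rewrite /maxstep; apply/bigmax_geP; left. Qed.

End empirical.

Local Notation boot z n f := (iter n (avg (@unif _ n) (@bstep _ z n)) f 0).

Lemma ae_measure_eq d (T : measurableType d) (R : realType) (P : probability T R) (A B : set T) :
  measurable A -> measurable B -> {ae P, forall w, A w <-> B w} -> P A = P B.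
Proof.
move=> mA mB [N [mN N0 HN]].
have sub C D : measurable C -> measurable D -> C `<=` D `|` N -> (P C <= P D)%E.
  move=> mC mD CD; apply: (@le_trans _ _ (P (D `|` N))).
    by apply: le_measure; rewrite ?inE//; exact: measurableU.
  by rewrite measureU0.
have AB w : ~ N w -> (A w <-> B w) by move=> nN; apply: contrapT => H; exact/nN/HN.
by apply/eqP; rewrite eq_le; apply/andP; split; apply: sub => // w H;
  have [?|nN] := pselect (N w); [right| left; apply/AB | right | left; apply/AB].
Qed.

Lemma prob_le_mean d (T : measurableType d) (R : realType) (P : probability T R)
    (S : T -> R) (x : R) : measurable_fun setT S ->
  measurable [set w | S w <= x] /\
  P [set w | S w <= x] = (mean P (fun w => (S w <= x)%R%:R))%:E.
Proof.
move=> mS.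
have mA : measurable [set w | S w <= x].
  have := mS measurableT `]-oo, x]%classic (measurable_itv _).
  by rewrite setTI; congr measurable; apply/seteqP; split=> w /=; rewrite in_itv.
split=> //.
have -> : (fun w => (S w <= x)%R%:R) = \1_[set w | S w <= x] :> (T -> R).
  apply/funext => w; rewrite indicE; have [H|H] := boolP (S w <= x).
    by rewrite mem_set.
  by rewrite memNset//=; exact/negP.
by rewrite mean_indic// fineK// fin_num_measure.
Qed.

(** * The bootstrap law as an iterate of [avg] *)

Section bootstrap_law.
Context (R : realType) d (T : measurableType d) (P : probability T R) (n' : nat).
Let n := n'.+1.
Variable idx : 'I_n -> {RV P >-> nat}.
Hypothesis idx_indep : mutually_independent idx.
Hypothesis idx_unif : forall k, uniform_index n (idx k).
Variable z : nat -> nat -> R.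

Let midx k (A : set nat) : measurable (idx k @^-1` A).
Proof. by rewrite -[X in measurable X]setTI; exact: (@measurable_funPT _ _ _ _ (idx k)). Qed.

(** Only the masses of the points 0, ..., n - 1 are prescribed; they add up to 1, so any other value
    has probability 0. *)
Lemma idx_lt k : {ae P, forall w, (idx k w < n)%N}.
Proof.
pose F l := idx k @^-1` [set l].
have E : P (idx k @^-1` [set l | (l < n)%N]) = 1%E.
  have -> : idx k @^-1` [set l | (l < n)%N] = \big[setU/set0]_(l < n) F l.
    rewrite -(@bigcup_mkord _ n F); apply/seteqP; split=> w /= H; first by exists (idx k w).
    by case: H => l /= ln ->.
  rewrite measure_bigsetU//; last first.
    - apply/trivIsetP => i j _ _ /eqP ij; apply/seteqP; split=> w //= -[Hi Hj].
      by apply: ij; rewrite -(Hi : idx k w = i) -(Hj : idx k w = j).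
    - by move=> l; exact: midx.
  transitivity ((\sum_(l < n) (n%:R^-1 : R)%:E)%E).
    by apply: eq_bigr => l _; exact: idx_unif (ltn_ord l).
  by rewrite sumEFin sumr_const card_ord -[_ *+ n]mulr_natl mulfV// pnatr_eq0.
have mE := midx k [set l | (l < n)%N].
apply/(negligibleP P (measurableC mE)).
apply: etrans (probability_setC P mE) _.
by apply: etrans (congr1 (fun x => 1 - x)%E E) _; rewrite subee.
Qed.

(** An out-of-range index receives a default value under [inord], which changes events only by a
    null set. *)
Lemma idx_inord k (c : 'I_n) :
  P (idx k @^-1` ((inord : nat -> 'I_n) @^-1` [set c])) = (@unif R n c)%:E.
Proof.
rewrite -(idx_unif k (ltn_ord c)); apply: ae_measure_eq; try exact: midx.
move: (idx_lt k); apply: filterS => w wn /=; split=> [<-|->].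
  by rewrite inordK.
by rewrite inord_val.
Qed.

Lemma bootstrap_mean (F : (nat -> R) -> R) :
  rintegrable P (fun w => F (\sum_k bstep z (inord (idx k w) : 'I_n))) /\
  mean P (fun w => F (\sum_k bstep z (inord (idx k w) : 'I_n))) =
  boot z n F.
Proof.
have := @mean_sum_indep _ _ _ P _ _ _ idx _ (inord : nat -> 'I_n) _ (@bstep R z n) (@unif R n)
  (fun c => I) idx_inord (index_enum 'I_n) F 0 idx_indep (index_enum_uniq _).
have -> : size (index_enum 'I_n) = n by rewrite -[RHS](card_ord n) cardT enumT.
by under eq_fun do rewrite add0r.
Qed.

End bootstrap_law.

Lemma euclidean_norm_sqr (R : realType) m (x : 'rV[R]_m) :
  euclidean_norm x ^+ 2 = \sum_(j < m) x ord0 j ^+ 2.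
Proof. by rewrite sqr_sqrtr// sumr_ge0// => j _; rewrite sqr_ge0. Qed.

Lemma arith_meanE (R : realType) m n (x : 'I_n -> 'rV[R]_m) j :
  arith_mean x ord0 j = n%:R^-1 * \sum_(i < n) x i ord0 j.
Proof. by rewrite mxE summxE. Qed.

Lemma scaled_mean_sqr (R : realType) n (S : R) : (0 < n)%N ->
  n%:R * (n%:R^-1 * S) ^+ 2 = (S / Num.sqrt n%:R) ^+ 2.
Proof.
move=> n0; have nn : n%:R != 0 :> R by rewrite pnatr_eq0 -lt0n.
by rewrite [RHS]exprMn exprVn sqr_sqrtr//; field.
Qed.

Section statistics.
Context (R : realType) (T Tstar : Type) (dim : nat -> nat).
Variables (Z : nat -> T -> l2 R) (idx : forall n, 'I_n -> Tstar -> nat).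

(** The bootstrap step at an arbitrary natural index: the statistic is defined for every value of
    the index variables, whereas [bstep] requires an index below n. *)
Definition nstep (z : nat -> nat -> R) n (l j : nat) : R :=
  (z l j - smean z n j) / Num.sqrt n%:R.

Lemma W_statE n w ws : (0 < n)%N ->
  let S := \sum_(k < n) nstep (fun i => l2_coord (Z i w)) n (idx k ws) in
  W_stat dim Z idx n w ws = dot (dim n) S S.
Proof.
move=> n0 S; rewrite /W_stat euclidean_norm_sqr mulr_sumr; apply: eq_bigr => j _.
rewrite arith_meanE scaled_mean_sqr// -expr2; congr (_ ^+ 2).
rewrite /S sum_coord mulr_suml; apply: eq_bigr => k _.
rewrite /nstep /smean !mxE summxE big_mkord; congr (_ * _); congr (_ - _).
by rewrite mulrC; congr (_ * _); apply: eq_bigr => i _; rewrite mxE.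
Qed.

Lemma V_statE n w : (0 < n)%N ->
  let S := \sum_(0 <= i < n) (fun j => Z i w j / Num.sqrt n%:R) in
  V_stat dim Z n w = dot (dim n) S S.
Proof.
move=> n0 S; rewrite /V_stat euclidean_norm_sqr mulr_sumr; apply: eq_bigr => j _.
rewrite arith_meanE scaled_mean_sqr// -expr2; congr (_ ^+ 2).
rewrite /S sum_coord big_mkord mulr_suml; apply: eq_bigr => k _.
by rewrite mxE.
Qed.

End statistics.

Section bootstrap_probability.
Context (R : realType) d (Ts : measurableType d) (Ps : probability Ts R) (T : Type).
Variables (dim : nat -> nat) (Z : nat -> T -> l2 R).
Variable idx : forall n : nat, 'I_n -> {RV Ps >-> nat}.
Hypothesis idx_indep : forall n, mutually_independent (@idx n).
Hypothesis idx_unif : forall n (k : 'I_n), uniform_index n (@idx n k).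

Lemma bootstrap_prob n w x : (0 < n)%N ->
  Ps [set ws | W_stat dim Z idx n w ws <= x] =
  (iter n (avg (@unif R n) (@bstep R (fun i => l2_coord (Z i w)) n)) (in_ball (dim n) x) 0)%:E.
Proof.
case: n => // n _; set z := fun i => l2_coord (Z i w).
have [i1 <-] := bootstrap_mean (@idx_indep n.+1) (@idx_unif n.+1) z (in_ball (dim n.+1) x).
pose S1 ws : nat -> R := \sum_(k < n.+1) nstep z n.+1 (@idx n.+1 k ws).
pose S2 ws : nat -> R := \sum_(k < n.+1) bstep z (inord (@idx n.+1 k ws) : 'I_n.+1).
have midx k (f : nat -> R) : measurable_fun setT (fun ws => f (@idx n.+1 k ws)).
  move=> _ B mB; exact: (@measurable_funPT _ _ _ _ (@idx n.+1 k) measurableT (f @^-1` B) I).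
have mS1 : measurable_fun setT (fun ws => dot (dim n.+1) (S1 ws) (S1 ws)).
  apply: measurable_sum => j.
  have mj : measurable_fun setT (fun ws => S1 ws j).
    have -> : (fun ws => S1 ws j) = (fun ws => \sum_(k < n.+1) nstep z n.+1 (@idx n.+1 k ws) j).
      by apply/funext => ws; rewrite /S1 sum_coord.
    by apply: measurable_sum => k; exact: (midx k (fun l => nstep z n.+1 l j)).
  exact: measurable_funM.
have mS2 : measurable_fun setT (fun ws => dot (dim n.+1) (S2 ws) (S2 ws)).
  apply: measurable_sum => j.
  have mj : measurable_fun setT (fun ws => S2 ws j).
    have -> : (fun ws => S2 ws j) =
        (fun ws => \sum_(k < n.+1) bstep z (inord (@idx n.+1 k ws) : 'I_n.+1) j).
      by apply/funext => ws; rewrite /S2 sum_coord.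
    by apply: measurable_sum => k; exact: (midx k (fun l => bstep z (inord l : 'I_n.+1) j)).
  exact: measurable_funM.
have [mA1 _] := prob_le_mean Ps x mS1; have [mA2 E2] := prob_le_mean Ps x mS2.
rewrite -E2.
have -> : [set ws | W_stat dim Z idx n.+1 w ws <= x] =
    [set ws | dot (dim n.+1) (S1 ws) (S1 ws) <= x].
  by apply/seteqP; split=> ws /=; rewrite W_statE.
(* The statistic is written with [nstep] and the iterate of [avg] with [bstep] after [inord]; the
   two agree when all indices are in range, hence almost surely. *)
apply: ae_measure_eq => //.
have : {ae Ps, forall ws, forall k : nat, (k < n.+1)%N -> (@idx n.+1 (inord k) ws < n.+1)%N}.
  apply: ae_foralln => k; move: (idx_lt (@idx_unif n.+1) (inord k)).
  by apply: filterS => ws.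
apply: filterS => ws H.
rewrite /= (_ : S1 ws = S2 ws)//.
apply: eq_bigr => k _; apply/funext => j; rewrite /nstep /bstep inordK//.
by have := H k (ltn_ord k); rewrite inord_val.
Qed.

End bootstrap_probability.

(** * Limits along one fixed sequence of data, with [q i] in the role of the squared norm *)

Section empirical_limits.
Context {R : realType}.
Variables (z : nat -> nat -> R) (q : nat -> R) (C : nat -> nat -> R) (B : R).
Hypothesis z_mean : forall j, (\sum_(0 <= i < n) z i j) / n%:R @[n --> \oo] --> (0 : R).
Hypothesis z_cov : forall j k,
  (\sum_(0 <= i < n) z i j * z i k) / n%:R @[n --> \oo] --> C j k.
Hypothesis q_mean : (\sum_(0 <= i < n) q i) / n%:R @[n --> \oo] --> B.
Hypothesis zq : forall m i, dot m (z i) (z i) <= q i.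

Let q0 i : 0 <= q i. Proof. exact: le_trans (dot_ge0 0 _) (zq 0 i). Qed.

Lemma scov_cvg j k : scov z n j k @[n --> \oo] --> C j k.
Proof.
have : scov z n j k @[n --> \oo] --> C j k - 0 * 0.
  by apply: cvgB => //; apply: cvgM; exact: z_mean.
by rewrite mulr0 subr0.
Qed.

Definition tot_scov m n := \sum_(j < m) scov z n j j.

Lemma tot_scov_cvg m : tot_scov m n @[n --> \oo] --> \sum_(j < m) C j j.
Proof. by apply: cvg_sumr => j; exact: scov_cvg. Qed.

(** With a n the average of the first n terms, q n / (n + 1) equals a (n + 1) - a n + a n / (n + 1),
    which tends to 0 when the averages converge. *)
Lemma terms_small e : 0 < e -> \forall n \near \oo, forall i, (i < n)%N -> q i <= e * n%:R.
Proof.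
move=> e0; pose a n := (\sum_(0 <= i < n) q i) / n%:R.
have h : q n / n.+1%:R @[n --> \oo] --> 0.
  have -> : (fun n => q n / n.+1%:R) = (fun n => a n.+1 - a n + a n * n.+1%:R^-1).
    apply/funext => -[|n]; rewrite /a.
      by rewrite big_nil big_nat1 mul0r !subr0 mul0r addr0.
    rewrite [in RHS]big_nat_recr//=; set S := \sum_(0 <= i < n.+1) q i.
    rewrite -[n.+2%:R]natr1; field.
    by have := ler0n R n => ?; apply/andP; split; apply: lt0r_neq0; lra.
  have : a n.+1 - a n + a n * n.+1%:R^-1 @[n --> \oo] --> B - B + B * 0.
    apply: cvgD; last by apply: cvgM => //; exact: cvg_harmonic.
    by apply: cvgB => //; move: q_mean; rewrite -(cvg_shiftS a).
  by rewrite subrr mulr0 addr0.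
move/cvgrPdist_le/(_ _ e0) : h => [i0 _ h].
pose Q := \sum_(0 <= i < i0) q i.
exists (maxn 1 (Num.truncn (Q / e)).+1) => // n /=; rewrite geq_max => /andP[n0 Qn] i i_n.
(* Late indices use this limit; the finitely many early ones are bounded by their fixed total
   [Q]. *)
have [ii|ii] := leqP i0 i.
  have : `|0 - q i / i.+1%:R| <= e := h i ii.
  rewrite sub0r normrN ger0_norm ?divr_ge0// ler_pdivrMr ?ltr0n// => H.
  by apply: le_trans H _; rewrite ler_pM2l// ler_nat.
apply: (@le_trans _ _ Q).
  rewrite /Q (bigD1_seq i) ?mem_index_iota ?iota_uniq//= lerDl.
  by apply: sumr_ge0.
rewrite mulrC -ler_pdivrMr//; apply: ltW; apply: lt_le_trans (truncnS_gt _) _.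
by rewrite ler_nat.
Qed.

(** By |z i - mean|^2 <= 2 |z i|^2 + 2 |mean|^2, each part contributes at most e / 2 after division
    by n. This uniform smallness is what yields Lindeberg's condition for the bootstrap steps. *)
Lemma maxstep_cvg m : maxstep z m n @[n --> \oo] --> 0.
Proof.
apply/cvgrPdist_le => e e0.
have e4 : 0 < e / 4 by rewrite divr_gt0.
have sm : dot m (smean z n) (smean z n) @[n --> \oo] --> \sum_(j < m) (0 * 0 : R).
  by apply: cvg_sumr => j; apply: cvgM; exact: z_mean.
rewrite big1 in sm => [|j _]; last by rewrite mul0r.
move/cvgrPdist_le/(_ _ e4) : sm => sm.
have ts := terms_small e4.
near=> n.
have n0 : (0 < n)%N by near: n; exists 1%N.
have nR : 0 < n%:R :> R by rewrite ltr0n.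
have h1 : `|0 - dot m (smean z n) (smean z n)| <= e / 4 by near: n.
have h2 : forall i, (i < n)%N -> q i <= e / 4 * n%:R by near: n.
rewrite sub0r normrN ger0_norm ?maxstep_ge0//.
apply: maxstep_le => [|i]; first exact: ltW.
have -> : bstep z i = ((Num.sqrt n%:R)^-1) \*o (z i + (-1) \*o smean z n).
  apply/funext => j; rewrite /bstep /= mulrC; congr (_ * _).
  by rewrite -[in LHS]mulN1r.
rewrite dotZl dotZr mulrA -expr2 exprVn sqr_sqrtr// dot_sqrD !dotZl !dotZr.
have := dot_ge0 m (z i + smean z n); rewrite dot_sqrD.
have := h2 i (ltn_ord i); have := zq m i.
move: h1; rewrite sub0r normrN ger0_norm ?dot_ge0//.
move: (dot m (z i) (z i)) (dot m (z i) _) (dot m (smean _ _) _) => x1 x2 x3 ? ? ? ?.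
rewrite mulrC ler_pdivrMr//.
have n1 : 1 <= n%:R :> R by rewrite ler1n.
by have : e <= e * n%:R; [rewrite ler_peMr// ltW|lra].
Unshelve. all: by end_near. Qed.

(** The right side is free of d, so the tail estimate survives a growing dimension; the squared
    means of the coordinates from m on only lower the left side. *)
Lemma tot_scov_le m d n : (0 < n)%N -> (m <= d)%N ->
  tot_scov d n - tot_scov m n <=
  (\sum_(0 <= i < n) q i) / n%:R - \sum_(j < m) (\sum_(0 <= i < n) z i j * z i j) / n%:R.
Proof.
move=> n0 md; rewrite /tot_scov.
have E k : \sum_(j < k) scov z n j j =
    (\sum_(0 <= i < n) dot k (z i) (z i)) / n%:R - dot k (smean z n) (smean z n).
  rewrite /scov sumrB; congr (_ - _).
  by rewrite -mulr_suml; congr (_ / _); rewrite exchange_big.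
have E2 : \sum_(j < m) (\sum_(0 <= i < n) z i j * z i j) / n%:R =
    (\sum_(0 <= i < n) dot m (z i) (z i)) / n%:R.
  by rewrite -mulr_suml; congr (_ / _); rewrite exchange_big.
rewrite !E E2.
have : (\sum_(0 <= i < n) dot d (z i) (z i)) / n%:R <= (\sum_(0 <= i < n) q i) / n%:R.
  by rewrite ler_wpM2r ?invr_ge0// ler_sum.
have := dot_mono (smean z n) md.
by lra.
Qed.

Lemma tot_scov_le_mean d n : (0 < n)%N -> tot_scov d n <= (\sum_(0 <= i < n) q i) / n%:R.
Proof.
move=> n0; have := tot_scov_le n0 (leq0n d).
by rewrite /tot_scov !big_ord0 !subr0.
Qed.

(** The covariance of one step is [scov] divided by n, so the powers of n in [cutoff_window] cancel.
    The replacement error vanishes with the largest step, and of the rest only the concentration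
    term survives. *)
Lemma bootstrap_window m j0 e M eta : 0 < e -> (j0 < m)%N -> 0 < C j0 j0 -> 0 < eta ->
  \forall n \near \oo, forall a, a <= M ->
    boot z n (cutoff m a e) -
    boot z n (cutoff m (a - 6 * e) e) <=
    2 * Num.sqrt (9 * e / (4 * C j0 j0)) + eta.
Proof.
move=> e0 j0m C0 eta0.
have [K K0 HK] := cutoff_taylor m M e0.
pose r n := maxstep z m n; pose V n := tot_scov m n; pose c n := scov z n j0 j0.
pose u n : R := 2 * (K * (Num.sqrt (r n) * V n +
     Num.sqrt (2 * (V n / n%:R) + 4 * r n * (1 + V n / c n)) * V n)) +
   2 * (Num.sqrt (9 * e / (4 * c n)) + (Num.sqrt n%:R)^-1).
have lim : u n @[n --> \oo] --> 2 * Num.sqrt (9 * e / (4 * C j0 j0)).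
  have r0 := @maxstep_cvg m; have VT := @tot_scov_cvg m; have cC := @scov_cvg j0 j0.
  have C0' : C j0 j0 != 0 by rewrite gt_eqF.
  set t := \sum_(j < m) C j j in VT.
  have s0 : (Num.sqrt n%:R)^-1 @[n --> \oo] --> (0 : R).
    have := cvg_sqrt (@cvg_invn R); rewrite sqrtr0.
    by under eq_cvg do rewrite sqrtrV//.
  have L : u n @[n --> \oo] --> 2 * (K * (Num.sqrt 0 * t +
     Num.sqrt (2 * (t * 0) + 4 * 0 * (1 + t / C j0 j0)) * t)) +
   2 * (Num.sqrt (9 * e / (4 * C j0 j0)) + 0).
    have k (b : R) : (fun _ : nat => b) @ \oo --> b by exact: cvg_cst.
    apply: cvgD; apply: cvgM => //.
      apply: cvgM => //; apply: cvgD.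
        by apply: cvgM => //; exact: cvg_sqrt.
      apply: cvgM => //; apply: cvg_sqrt; apply: cvgD.
        by apply: cvgM => //; apply: cvgM => //; exact: cvg_invn.
      apply: cvgM; first by apply: cvgM.
      by apply: cvgD => //; apply: cvgM => //; exact: cvgV.
    apply: cvgD => //; apply: cvg_sqrt; apply: cvgM => //; apply: cvgV.
      by rewrite mulf_neq0.
    exact: cvgM.
  by move: L; rewrite sqrtr0 !(mul0r, mulr0, addr0) sqrtr0 !(mul0r, mulr0, addr0, add0r).
have cC := @scov_cvg j0 j0.
near=> n => a aM.
have n0 : (0 < n)%N by near: n; exists 1%N.
have nR : 0 < n%:R :> R by rewrite ltr0n.
have c0 : 0 < c n by near: n; apply: (cvgr_gt (C j0 j0) cC).
have un : u n <= 2 * Num.sqrt (9 * e / (4 * C j0 j0)) + eta.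
  apply: ltW; near: n; apply: (cvgr_lt _ lim); by rewrite ltrDl.
apply: le_trans un.
have covE j k : cov (@unif R n) (@bstep R z n) j k = n%:R^-1 * scov z n j k by exact: bstep_cov.
have s20 : 0 < cov (@unif R n) (@bstep R z n) j0 j0 by rewrite covE mulr_gt0 ?invr_gt0.
have VE : \sum_(j < m) cov (@unif R n) (@bstep R z n) j j = V n / n%:R.
  by rewrite mulrC mulr_sumr; apply: eq_bigr => j _; exact: covE.
have HK1 b : b <= M -> forall v h : nat -> R,
    `|cutoff m b e (v + h) - cutoff m b e v - cutoff1 m b e v h
       - cutoff2 m b e v (fun j k => h j * h k)|
      <= K * (dot m h h * Num.min 1 (Num.sqrt (dot m h h))).
  by move=> bM v h; case: (HK b bM v h (fun _ _ => 0)).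
have H := cutoff_window (unif_weights n0) (fun j _ => bstep_mean z j n0) j0m s20
  erefl n0 e0 aM K0 HK1 (@maxstep_ge R z m n).
apply: le_trans H _; rewrite VE covE -/(c n).
have sn : Num.sqrt n%:R != 0 :> R by rewrite gt_eqF// sqrtr_gt0.
have nn : n%:R != 0 :> R by rewrite gt_eqF.
have cn : c n != 0 by rewrite gt_eqF.
rewrite le_eqVlt; apply/orP; left; apply/eqP; rewrite /u.
have -> : V n / n%:R / (n%:R^-1 * c n) = V n / c n by field; rewrite nn cn.
have -> : 9 * e / (4 * (n%:R^-1 * c n)) = 9 * e / (4 * c n) * n%:R by field; rewrite nn cn.
rewrite sqrtrM; last by rewrite divr_ge0// mulr_ge0 ?ltW.
move: (Num.sqrt (9 * e / _)) (Num.sqrt (r n)) (Num.sqrt (2 * _ + _)) sn => x1 x2 x3 sn.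
by field; rewrite sn nn.
Unshelve. all: by end_near. Qed.

End empirical_limits.

(** * Means of cutoffs under the sample law and the bootstrap law *)

Section comparison.
Context (R : realType) d (T : measurableType d) (P : probability T R) (Z : nat -> {RV P >-> l2 R}).
Hypothesis Z_indep : mutually_independent Z.
Hypothesis Z_idist : identically_distributed Z.
Hypothesis Z_mean : has_expectation P (Z 0%N) 0.
Hypothesis Z_sqnorm : ('E_P[fun w => (`|Z 0%N w| ^+ 2)%R] < +oo)%E.

Let C := covariance_coord Z.

Variables (z : nat -> nat -> R) (q : nat -> R) (B : R).
Hypothesis z_mean : forall j, (\sum_(0 <= i < n) z i j) / n%:R @[n --> \oo] --> (0 : R).
Hypothesis z_cov : forall j k,
  (\sum_(0 <= i < n) z i j * z i k) / n%:R @[n --> \oo] --> C j k.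
Hypothesis q_mean : (\sum_(0 <= i < n) q i) / n%:R @[n --> \oo] --> B.
Hypothesis zq : forall m i, dot m (z i) (z i) <= q i.

Definition pstep n (x : l2 R) : nat -> R := fun j => x j / Num.sqrt n%:R.

Lemma measurable_pstep n j : measurable_fun setT (pstep n ^~ j).
Proof. by apply: measurable_funM => //; exact: measurable_coord. Qed.

Lemma pstepM n x j k : pstep n x j * pstep n x k = n%:R^-1 * (x j * x k).
Proof. by rewrite /pstep mulrACA -expr2 exprVn sqr_sqrtr// mulrC. Qed.

Lemma dot_pstep m n x : dot m (pstep n x) (pstep n x) = dot m x x / n%:R.
Proof. by rewrite mulrC /dot mulr_sumr; apply: eq_bigr => j _; exact: pstepM. Qed.

(** Per step the two laws differ by at most [D n] / n, made of the Lindeberg remainders of both laws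
    and the distance between empirical and true covariance. Over n steps this adds up to [D n],
    which tends to 0 and does not involve a. *)
Lemma cutoff_close m e M eta : 0 < e -> 0 < eta ->
  \forall n \near \oo, forall a, a <= M ->
    (rintegrable P (fun w => cutoff m a e (\sum_(0 <= i < n) pstep n (Z i w))) /\
    `|mean P (fun w => cutoff m a e (\sum_(0 <= i < n) pstep n (Z i w))) -
     boot z n (cutoff m a e)| <= eta).
Proof.
move=> e0 eta0; have [K K0 HK] := cutoff_taylor m M e0.
pose rho n := mean P (fun w => dot m (Z 0%N w) (Z 0%N w) *
    Num.min 1 (Num.sqrt (dot m (Z 0%N w) (Z 0%N w) / n%:R))).
pose D n := K * (rho n + Num.sqrt (maxstep z m n) * tot_scov z m n +
   \sum_(j < m) \sum_(k < m) `|C j k - scov z n j k|).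
have iY j : rintegrable P (fun w => Z 0%N w j) := (mean_coord Z_mean j).1.
have iYY j k : rintegrable P (fun w => Z 0%N w j * Z 0%N w k) by exact: rintegrable_coordM.
have lim : D n @[n --> \oo] --> 0.
  have L : D n @[n --> \oo] --> K * (0 + Num.sqrt 0 * (\sum_(j < m) C j j) +
    \sum_(j < m) \sum_(k < m) `|C j k - C j k|).
    apply: cvgM; first exact: cvg_cst.
    apply: cvgD; first apply: cvgD.
    - exact: (@mean_min_cvg0 _ _ _ P m (fun w => Z 0%N w) (fun j k _ _ => iYY j k)).
    - apply: cvgM; first by apply: cvg_sqrt; exact: (maxstep_cvg z_mean q_mean zq).
      exact: (tot_scov_cvg z_mean z_cov).
    - apply: cvg_sumr => j; apply: cvg_sumr => k; apply: cvg_norm; apply: cvgB.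
        exact: cvg_cst.
      exact: (scov_cvg z_mean z_cov).
  move: L; rewrite sqrtr0 mul0r addr0 big1 ?addr0 ?mulr0// => j _.
  by rewrite big1// => k _; rewrite subrr normr0.
near=> n => a aM.
have n0 : (0 < n)%N by near: n; exists 1%N.
have nR : 0 < n%:R :> R by rewrite ltr0n.
have Deta : D n <= eta by apply: ltW; near: n; apply: (cvgr_lt _ lim).
have mz j : (j < m)%N -> measurable_fun setT (pstep n ^~ j) by move=> _; exact: measurable_pstep.
have f01 u : 0 <= cutoff m a e u <= 1 by rewrite cutoff_ge0 cutoff_le1.
have fK (u h : nat -> R) : `|cutoff m a e (u + h) - cutoff m a e u| <=
    K * (Num.sqrt (dot m h h) + dot m h h) by case: (HK a aM u h (fun _ _ => 0)).
have HK1 b : b <= M -> forall v h : nat -> R,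
    `|cutoff m b e (v + h) - cutoff m b e v - cutoff1 m b e v h
       - cutoff2 m b e v (fun j k => h j * h k)|
      <= K * (dot m h h * Num.min 1 (Num.sqrt (dot m h h))).
  by move=> bM v h; case: (HK b bM v h (fun _ _ => 0)).
have isum (s : seq nat) u : uniq s ->
    rintegrable P (fun w => cutoff m a e (u + \sum_(i <- s) pstep n (Z i w))).
  by move=> us; exact: (mean_quantized_cvg mz Z_indep Z_idist f01 fK u us).1.
have if_ u : rintegrable P (fun w => cutoff m a e (u + pstep n (Z 0%N w))).
  by have := isum [:: 0%N] u isT; under eq_fun do rewrite big_seq1.
split.
  by have := isum (index_iota 0 n) 0 (iota_uniq _ _); under eq_fun do rewrite add0r.
have local u : `|mean P (fun w => cutoff m a e (u + pstep n (Z 0%N w))) -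
    avg (@unif R n) (@bstep R z n) (cutoff m a e) u| <= n%:R^-1 * D n.
  have jY j : (j < m)%N -> rintegrable P (fun w => pstep n (Z 0%N w) j).
    move=> _; have := rintegrableZ (Num.sqrt n%:R)^-1 (iY j).
    by under eq_fun do rewrite mulrC.
  have Y0 j : (j < m)%N -> mean P (fun w => pstep n (Z 0%N w) j) = 0.
    move=> _; rewrite -[RHS](mulr0 (Num.sqrt n%:R)^-1) -(mean_coord Z_mean j).2 -meanZ//.
    by congr mean; apply/funext => w; rewrite mulrC.
  have jYY j k : (j < m)%N -> (k < m)%N ->
      rintegrable P (fun w => pstep n (Z 0%N w) j * pstep n (Z 0%N w) k).
    move=> _ _; under eq_fun do rewrite pstepM.
    exact: rintegrableZ.
  have A1 := mean_cutoff jY Y0 jYY if_ aM HK1 u.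
  have A2 := avg_cutoff (unif_weights n0) HK1 (fun j _ => bstep_mean z j n0) aM u.
  have A3 := mean_min_le (unif_weights n0) (@maxstep_ge R z m n).
  have VE : \sum_(j < m) cov (@unif R n) (@bstep R z n) j j = n%:R^-1 * tot_scov z m n.
    by rewrite mulr_sumr; apply: eq_bigr => j _; exact: bstep_cov.
  rewrite VE in A3.
  have RE : mean P (fun w => dot m (pstep n (Z 0%N w)) (pstep n (Z 0%N w)) *
      Num.min 1 (Num.sqrt (dot m (pstep n (Z 0%N w)) (pstep n (Z 0%N w))))) = n%:R^-1 * rho n.
    rewrite /rho -meanZ; last first.
      exact: (@rintegrable_min_dot _ _ _ P m (fun w => Z 0%N w) (fun j k _ _ => iYY j k)).
    by congr mean; apply/funext => w; rewrite !dot_pstep mulrAC mulrA mulrC mulrA; ring.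
  rewrite RE in A1.
  have CE : cutoff2 m a e u (fun j k => mean P (fun w => pstep n (Z 0%N w) j * pstep n (Z 0%N w) k))
      = cutoff2 m a e u (fun j k => n%:R^-1 * C j k).
    congr (cutoff2 _ _ _ _); apply/funext => j; apply/funext => k.
    rewrite /C /covariance_coord -meanZ//; congr mean; apply/funext => w; exact: pstepM.
  have SE : cutoff2 m a e u
      (fun j k => \sum_(i < n) @unif R n i * (@bstep R z n i j * @bstep R z n i k))
      = cutoff2 m a e u (fun j k => n%:R^-1 * scov z n j k).
    congr (cutoff2 _ _ _ _); apply/funext => j; apply/funext => k; exact: bstep_cov.
  rewrite CE in A1; rewrite SE in A2.
  have A4 : `|cutoff2 m a e u (fun j k => n%:R^-1 * C j k) -
      cutoff2 m a e u (fun j k => n%:R^-1 * scov z n j k)| <=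
      K * (n%:R^-1 * \sum_(j < m) \sum_(k < m) `|C j k - scov z n j k|).
    rewrite cutoff2B.
    case: (HK a aM u 0 (fun j k => n%:R^-1 * C j k - n%:R^-1 * scov z n j k)) => _ H _.
    apply: le_trans H _; rewrite ler_wpM2l// mulr_sumr ler_sum// => j _.
    rewrite mulr_sumr ler_sum// => k _.
    by rewrite -mulrBr normrM ger0_norm// invr_ge0.
  have A5 : K * mean_min m (@unif R n) (@bstep R z n) <=
      K * (Num.sqrt (maxstep z m n) * (n%:R^-1 * tot_scov z m n)) by rewrite ler_wpM2l.
  rewrite -/(mean_min m (@unif R n) (@bstep R z n)) in A2.
  rewrite /D; move: A1 A2 A4 A5.
  move: (mean P _) (avg _ _ _ _) (cutoff m a e u).
  move: (cutoff2 _ _ _ _ _) (cutoff2 _ _ _ _ _) => x1 x2 x3 x4 x5.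
  rewrite !ler_norml => /andP[? ?] /andP[? ?] /andP[? ?] ?.
  by apply/andP; split; lra.
have := @mean_lindeberg _ _ _ P _ _ Z m (pstep n) mz Z_indep Z_idist (cutoff m a e) K f01 fK K0
  _ (@unif R n) (@bstep R z n) n _ (unif_weights n0) local.
by rewrite mulrA mulfV ?mul1r ?gt_eqF// => H; apply: le_trans H Deta.
Unshelve. all: by end_near. Qed.

End comparison.

(** The pointwise inequalities are averaged; the Markov term turns into the empirical variance of
    the coordinates from m to d. *)
Lemma boot_sandwich (R : realType) (z : nat -> nat -> R) n m d x e :
  (0 < n)%N -> (m <= d)%N -> 0 < e ->
  [/\ boot z n (in_ball d x) <= boot z n (cutoff m x e),
      boot z n (cutoff m (x - 6 * e) e) <=
        boot z n (in_ball d x) + (3 * e)^-1 * (tot_scov z d n - tot_scov z m n) &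
      boot z n (fun v => dot d v v) = tot_scov z d n].
Proof.
move=> n0 md e0; have w := @unif_weights R n n0.
have D k : boot z n (fun v => dot k v v) = tot_scov z k n.
  rewrite iter_avg_dot//; last by move=> j _; exact: bstep_mean.
  rewrite /dot big1 ?add0r => [|j _]; last by rewrite mul0r.
  rewrite mulr_sumr; apply: eq_bigr => j _.
  by rewrite bstep_cov// mulrA mulfV ?mul1r// pnatr_eq0 -lt0n.
split=> //.
  by apply: (le_iter_avg _ w) => v; exact: in_ball_le_cutoff.
rewrite -!D.
have -> : boot z n (fun v => dot d v v) - boot z n (fun v => dot m v v) =
    boot z n (fun v => dot d v v + -1 * dot m v v).
  by rewrite iter_avgD iter_avgZ mulN1r.
rewrite -iter_avgZ -iter_avgD.
by apply: (le_iter_avg _ w) => v; exact: cutoff_le_in_ball.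
Qed.

(** * Uniform closeness of the two distribution functions *)

Section sample_law.
Context (R : realType) d (T : measurableType d) (P : probability T R) (Z : nat -> {RV P >-> l2 R}).
Hypothesis Z_indep : mutually_independent Z.
Hypothesis Z_idist : identically_distributed Z.
Hypothesis Z_mean : has_expectation P (Z 0%N) 0.
Hypothesis Z_sqnorm : ('E_P[fun w => (`|Z 0%N w| ^+ 2)%R] < +oo)%E.

Let C := covariance_coord Z.
Let B := mean P (fun w => `|Z 0%N w| ^+ 2).

Definition scaled_sum n w : nat -> R := \sum_(0 <= i < n) pstep n (Z i w).

Lemma measurable_scaled_sum n j : measurable_fun setT (fun w => scaled_sum n w j).
Proof.
rewrite (_ : (fun w => _) = (fun w => \sum_(0 <= i < n) pstep n (Z i w) j)); last first.
  by apply/funext => w; rewrite /scaled_sum sum_coord.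
by apply: measurable_sum => i; apply: (measurableT_comp (@measurable_pstep R n j)).
Qed.

Lemma measurable_dot_scaled_sum n m :
  measurable_fun setT (fun w => dot m (scaled_sum n w) (scaled_sum n w)).
Proof.
by apply: measurable_sum => j; apply: measurable_funM; exact: measurable_scaled_sum.
Qed.

Lemma mean_dot_scaled_sum n m : (0 < n)%N ->
  rintegrable P (fun w => dot m (scaled_sum n w) (scaled_sum n w)) /\
  mean P (fun w => dot m (scaled_sum n w) (scaled_sum n w)) = \sum_(j < m) C j j.
Proof.
move=> n0; have nR : n%:R != 0 :> R by rewrite pnatr_eq0 -lt0n.
have H j : rintegrable P (fun w => scaled_sum n w j * scaled_sum n w j) /\
    mean P (fun w => scaled_sum n w j * scaled_sum n w j) = C j j.
  have [i E] := @mean_sqr_sum _ _ _ P _ _ Z Z_indep Z_idist (fun x : l2 R => x j) n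
    (@measurable_coord R j) (rintegrable_coordM Z_sqnorm j j) (mean_coord Z_mean j).2.
  rewrite (_ : (fun w => _) = (fun w => n%:R^-1 * (\sum_(0 <= i < n) Z i w j) ^+ 2)); last first.
    apply/funext => w; rewrite /scaled_sum sum_coord -mulr_suml -expr2 exprMn exprVn.
    by rewrite sqr_sqrtr// mulrC.
  split; first exact: rintegrableZ.
  by rewrite meanZ// E mulrA mulVf// mul1r.
split; first by apply: rintegrable_sum => j _; exact: (H j).1.
by rewrite mean_sum => [|j]; [apply: eq_bigr => j _; exact: (H j).2|exact: (H j).1].
Qed.

Lemma rintegrable_in_ball n m x : rintegrable P (fun w => in_ball m x (scaled_sum n w)).
Proof.
have [mA _] := prob_le_mean P x (measurable_dot_scaled_sum n m).
rewrite (_ : (fun w => _) = \1_[set w | dot m (scaled_sum n w) (scaled_sum n w) <= x]).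
  exact: rintegrable_indic.
apply/funext => w; rewrite indicE /in_ball; have [H|H] := boolP (_ <= x).
  by rewrite mem_set.
by rewrite memNset//=; exact/negP.
Qed.

Lemma sample_sandwich n m k x e :
  (0 < n)%N -> (m <= k)%N -> 0 < e ->
  (forall a, a <= x -> rintegrable P (fun w => cutoff m a e (scaled_sum n w))) ->
  mean P (fun w => in_ball k x (scaled_sum n w)) <=
    mean P (fun w => cutoff m x e (scaled_sum n w)) /\
  mean P (fun w => cutoff m (x - 6 * e) e (scaled_sum n w)) <=
    mean P (fun w => in_ball k x (scaled_sum n w)) +
     (3 * e)^-1 * (\sum_(j < k) C j j - \sum_(j < m) C j j).
Proof.
move=> n0 mk e0 ic.
have iw := rintegrable_in_ball n k x.
split.
  by apply: le_mean => // [|w]; [exact: ic|exact: in_ball_le_cutoff].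
have [i1 E1] := mean_dot_scaled_sum m n0; have [i2 E2] := mean_dot_scaled_sum k n0.
rewrite -E1 -E2.
have i3 := rintegrableZ (-1) i1.
have -> : mean P (fun w => dot k (scaled_sum n w) (scaled_sum n w)) -
    mean P (fun w => dot m (scaled_sum n w) (scaled_sum n w)) =
    mean P (fun w => dot k (scaled_sum n w) (scaled_sum n w) +
      -1 * dot m (scaled_sum n w) (scaled_sum n w)).
  by rewrite meanD// meanZ// mulN1r.
rewrite -meanZ; last exact: rintegrableD.
rewrite -meanD//; last by apply: rintegrableZ; exact: rintegrableD.
apply: le_mean => [||w]; first by apply: ic; lra.
  by apply: rintegrableD => //; apply: rintegrableZ; exact: rintegrableD.
exact: cutoff_le_in_ball.
Qed.

Lemma covariance_ge0 j : 0 <= C j j.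
Proof. by apply: mean_ge0 => w; rewrite -expr2 sqr_ge0. Qed.

Lemma covariance_sum_le k : \sum_(j < k) C j j <= B.
Proof.
have E : \sum_(j < k) C j j = mean P (fun w => dot k (Z 0%N w) (Z 0%N w)).
  by rewrite /dot mean_sum// => j; exact: rintegrable_coordM.
rewrite E; apply: le_mean => [||w]; last exact: dot_le_norm.
  by apply: rintegrable_sum => j _; exact: rintegrable_coordM.
exact: rintegrable_norm_sqr.
Qed.

Variable z : nat -> nat -> R.
Variable q : nat -> R.
Hypothesis z_mean : forall j, (\sum_(0 <= i < n) z i j) / n%:R @[n --> \oo] --> (0 : R).
Hypothesis z_cov : forall j k,
  (\sum_(0 <= i < n) z i j * z i k) / n%:R @[n --> \oo] --> C j k.
Hypothesis q_mean : (\sum_(0 <= i < n) q i) / n%:R @[n --> \oo] --> B.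
Hypothesis zq : forall m i, dot m (z i) (z i) <= q i.
Variable dim : nat -> nat.
Hypothesis dim_oo : dim n @[n --> \oo] --> \oo.

(** For x <= [M] either indicator is bounded by the cutoff at x, which is lowered to the cutoff at x
    - 6 e on the bootstrap side, and this in turn is bounded by the other indicator; no window bound
    for the sample law enters. For x > [M] both distribution functions lie within eta of 1. *)
Lemma laws_close j0 eta : 0 < C j0 j0 -> 0 < eta ->
  \forall n \near \oo, forall x,
    `|boot z n (in_ball (dim n) x) -
      mean P (fun w => in_ball (dim n) x (scaled_sum n w))| <= eta.
Proof.
move=> C0 eta0; set c := C j0 j0 in C0.
have B0 : 0 <= B by apply: mean_ge0 => w; rewrite sqr_ge0.
(* Chosen so that the concentration term of the window bound is 2 eta / 16. *)
pose e := 4 * c / 9 * (eta / 16) ^+ 2.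
have e0 : 0 < e by rewrite mulr_gt0 ?exprn_gt0 ?divr_gt0 ?mulr_gt0.
have sqE : Num.sqrt (9 * e / (4 * c)) = eta / 16.
  have -> : 9 * e / (4 * c) = (eta / 16) ^+ 2 by rewrite /e; field; rewrite gt_eqF.
  by rewrite sqrtr_sqr ger0_norm// divr_ge0 ?(ltW eta0).
(* Beyond this level Markov's inequality makes both tails at most (B + 1) / x <= eta; the extra 1
   leaves room for the empirical second moment, which only converges to [B]. *)
pose M := (B + 1) / eta.
have M0 : 0 < M by rewrite divr_gt0//; lra.
have eta8 : 0 < eta / 8 by rewrite divr_gt0.
have t16 : 0 < 3 * e * (eta / 16) by rewrite !mulr_gt0 ?divr_gt0.
have t8 : 0 < 3 * e * (eta / 8) by rewrite !mulr_gt0 ?divr_gt0.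
have tail t : t <= 3 * e * (eta / 8) -> (3 * e)^-1 * t <= eta / 8.
  by move=> H; rewrite mulrC ler_pdivrMr ?mulr_gt0// mulrC.
(* The discarded variance gets divided by 3 e, so [m] is chosen after [e]; it also has to include
   the coordinate [j0]. *)
have [m [j0m Cm]] : exists m, (j0 < m)%N /\ B - \sum_(j < m) C j j <= 3 * e * (eta / 16).
  move/cvgrPdist_le/(_ _ t16) : (covariance_cvg Z_sqnorm) => [N _ H].
  exists (maxn N j0.+1); split; first by rewrite leq_maxr.
  exact: le_trans (ler_norm _) (H _ (leq_maxl _ _)).
have tl : (\sum_(0 <= i < n) q i) / n%:R - \sum_(j < m) (\sum_(0 <= i < n) z i j * z i j) / n%:R
    @[n --> \oo] --> B - \sum_(j < m) C j j.
  by apply: cvgB => //; apply: cvg_sumr.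
have cc := @cutoff_close _ _ _ P Z Z_indep Z_idist Z_mean Z_sqnorm z q B
  z_mean z_cov q_mean zq m e M (eta / 8) e0 eta8.
have bw := @bootstrap_window R z q C B z_mean z_cov q_mean zq m j0 e M (eta / 8) e0 j0m C0 eta8.
near=> n => x.
have n0 : (0 < n)%N by near: n; exists 1%N.
have md : (m <= dim n)%N by near: n; exact: (dim_oo (nbhs_infty_ge m)).
have qn : (\sum_(0 <= i < n) q i) / n%:R <= B + 1.
  by apply: ltW; near: n; apply: (cvgr_lt _ q_mean); rewrite ltrDl.
have tn : (\sum_(0 <= i < n) q i) / n%:R - \sum_(j < m) (\sum_(0 <= i < n) z i j * z i j) / n%:R
    <= 3 * e * (eta / 8).
  by apply: ltW; near: n; apply: (cvgr_lt _ tl); lra.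
have ccn : forall a, a <= M -> rintegrable P (fun w => cutoff m a e (scaled_sum n w)) /\
    `|mean P (fun w => cutoff m a e (scaled_sum n w)) -
     boot z n (cutoff m a e)| <= eta / 8 by near: n.
have bwn : forall a, a <= M ->
    boot z n (cutoff m a e) -
    boot z n (cutoff m (a - 6 * e) e) <=
    2 * Num.sqrt (9 * e / (4 * c)) + eta / 8 by near: n.
rewrite sqE in bwn.
have [b1 b2 b3] := boot_sandwich z x n0 md e0.
have tG := tot_scov_le zq n0 md.
have tG1 := tot_scov_le_mean zq (dim n) n0.
have tF := covariance_sum_le (dim n).
have wt := @unif_weights R n n0.
have [xM|Mx] := leP x M.
  have xM' : x - 6 * e <= M by lra.
  have [a1 a2] := sample_sandwich n0 md e0 (fun a ax => (ccn a (le_trans ax xM)).1).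
  have [_ c1] := ccn _ xM; have [_ c2] := ccn _ xM'; have w1 := bwn _ xM.
  have T1 := tail _ (le_trans tG tn).
  have T2 : (3 * e)^-1 * (\sum_(j < dim n) C j j - \sum_(j < m) C j j) <= eta / 8.
    by apply: tail; lra.
  move: c1 c2; rewrite !ler_norml => /andP[c11 c12] /andP[c21 c22].
  move: a1 a2 b1 b2 T1 T2 w1 c11 c12 c21 c22.
  clear - eta0.
  move: (mean P _) (mean P _) (mean P _) (iter n _ _ _) (iter n _ _ _) (iter n _ _ _).
  move: ((3 * e)^-1 * _) ((3 * e)^-1 * _) => ? ? ? ? ? ? ? ? *.
  by apply/andP; split; lra.
have x0 : 0 < x by exact: lt_trans Mx.
have xB : x^-1 * (B + 1) <= eta.
  rewrite mulrC ler_pdivrMr// mulrC -ler_pdivrMr//; exact: ltW.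
have xi0 : 0 <= x^-1 by rewrite invr_ge0 ltW.
have [iD ED] := mean_dot_scaled_sum (dim n) n0.
have F1 : 1 <= mean P (fun w => in_ball (dim n) x (scaled_sum n w)) + x^-1 * \sum_(j < dim n) C j j.
  rewrite -ED -meanZ// -meanD//; first last.
  - exact: rintegrableZ.
  - exact: rintegrable_in_ball.
  rewrite -[leLHS](mean_cst P 1); apply: le_mean => [||w]; first exact: rintegrable_cst.
    by apply: rintegrableD; [exact: rintegrable_in_ball|exact: rintegrableZ].
  exact: outside_le.
have F2 : mean P (fun w => in_ball (dim n) x (scaled_sum n w)) <= 1.
  rewrite -[leRHS](mean_cst P 1); apply: le_mean => [||w]; first exact: rintegrable_in_ball.
    exact: rintegrable_cst.
  by rewrite /in_ball lern1 leq_b1.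
have G1 : 1 <= boot z n (in_ball (dim n) x) + x^-1 * tot_scov z (dim n) n.
  rewrite -b3 -iter_avgZ -iter_avgD; apply: (iter_avg_ge _ wt) => v; exact: outside_le.
have G2 : boot z n (in_ball (dim n) x) <= 1.
  by apply: (iter_avg_le _ wt) => v; rewrite /in_ball lern1 leq_b1.
have H1 : x^-1 * tot_scov z (dim n) n <= x^-1 * (B + 1).
  by rewrite ler_wpM2l// (le_trans tG1).
have H2 : x^-1 * \sum_(j < dim n) C j j <= x^-1 * (B + 1).
  by rewrite ler_wpM2l// (le_trans tF)// lerDl.
move: F1 F2 G1 G2 (le_trans H1 xB) (le_trans H2 xB); clear - eta0.
move: (mean P _) (iter n _ _ _) (x^-1 * _) (x^-1 * _) => ? ? ? ? *.
by rewrite ler_norml; apply/andP; split; lra.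
Unshelve. all: by end_near. Qed.

End sample_law.

Lemma mean_sqr_eq0 d (T : measurableType d) (R : realType) (P : probability T R)
    (f : T -> R) : rintegrable P (fun w => f w ^+ 2) -> mean P (fun w => f w ^+ 2) = 0 ->
  {ae P, forall w, f w = 0}.
Proof.
move=> i m0; have E := meanE i; rewrite m0 in E.
have mf := (measurable_EFinP _ _).2 (rintegrable_measurable i).
have := (ae_eq_integral_abs P measurableT mf).1.
have -> : (\int[P]_(x in setT) `|(EFin \o (fun w => (f w ^+ 2)%R)) x| = 0)%E.
  rewrite -[RHS]E; apply: eq_integral => w _.
  by rewrite [X in `|X|%E]/= gee0_abs// lee_fin sqr_ge0.
move=> /(_ erefl); apply: filterS => w /(_ I) [] /eqP.
by rewrite sqrf_eq0 => /eqP.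
Qed.

(** * The case in which all variances vanish *)

Section degenerate.
Context (R : realType) d (T : measurableType d) (P : probability T R) (Z : nat -> {RV P >-> l2 R}).
Hypothesis Z_idist : identically_distributed Z.
Hypothesis Z_sqnorm : ('E_P[fun w => (`|Z 0%N w| ^+ 2)%R] < +oo)%E.

(** Equality in law carries the zero second moments to every index i, and countably many null sets
    are united. *)
Lemma degenerate_sample : (forall j, covariance_coord Z j j = 0) ->
  {ae P, forall w i j, Z i w j = 0}.
Proof.
move=> C0; have H i j : {ae P, forall w, Z i w j = 0}.
  have [ib E] := @ident_mean _ _ _ P _ _ Z Z_idist i (fun x : l2 R => x j * x j)
    (measurable_funM (@measurable_coord R j) (@measurable_coord R j))
    (rintegrable_coordM Z_sqnorm j j).
  by apply: mean_sqr_eq0; [exact: ib | exact: etrans E (C0 j)].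
by have := ae_foralln (fun i => ae_foralln (H i)).
Qed.

Lemma degenerate_scaled_sum n m x : {ae P, forall w i j, Z i w j = 0} ->
  mean P (fun w => in_ball m x (scaled_sum Z n w)) = (0 <= x)%R%:R.
Proof.
move=> Z0.
have [mA EA] := prob_le_mean P x (measurable_dot_scaled_sum Z n m).
have [mB EB] := prob_le_mean P x (measurable_cst (0 : R)).
apply: (@EFin_inj R); rewrite /in_ball -EA.
rewrite -[RHS](congr1 EFin (mean_cst P (0 <= x)%R%:R)) -EB.
apply: ae_measure_eq => //; move: Z0; apply: filterS => w Z0 /=.
rewrite /dot big1// => j _; rewrite /scaled_sum sum_coord big1 ?mul0r// => i _.
by rewrite /pstep Z0 mul0r.
Qed.

Lemma degenerate_boot (z : nat -> nat -> R) n m x : (0 < n)%N -> (forall i j, z i j = 0) ->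
  boot z n (in_ball m x) = (0 <= x)%R%:R.
Proof.
move=> n0 z0.
have b0 i : @bstep R z n i = 0.
  apply/funext => j; rewrite /bstep /smean z0 big1 ?mul0r ?subrr ?mul0r//.
have -> : avg (@unif R n) (@bstep R z n) = id.
  apply/funext => g; apply/funext => u; rewrite /avg.
  under eq_bigr do rewrite b0 addr0.
  by rewrite -mulr_suml (unif_weights n0).2 mul1r.
have -> : iter n id (in_ball m x) = in_ball m x by elim: (n) => //= k ->.
by rewrite /in_ball /dot big1// => j _; rewrite mul0r.
Qed.

End degenerate.

(** The supremum is taken in the extended reals, so it has to be shown eventually finite before its
    real limit makes sense. *)
Lemma ereal_sup_cvg0 (R : realType) (f : nat -> R -> R) :
  (forall eta, 0 < eta -> \forall n \near \oo, forall x, `|f n x| <= eta) ->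
  ereal_sup (range (fun x => `|(f n x)%:E|%E)) @[n --> \oo] --> 0%E.
Proof.
move=> H.
have s0 n : (0 <= ereal_sup (range (fun x => `|(f n x)%:E|)))%E.
  by apply: le_trans (abse_ge0 (f n 0)%:E) (ereal_sup_ubound _); exists 0.
have sb eta : 0 < eta -> \forall n \near \oo,
    (ereal_sup (range (fun x => `|(f n x)%:E|)) <= eta%:E)%E.
  move=> /H; apply: filterS => n Hn; apply: ge_ereal_sup => _ [x _ <-].
  by rewrite abse_EFin lee_fin.
apply/fine_cvgP; split.
  have := sb 1 ltr01; apply: filterS => n Hn.
  rewrite ge0_fin_numE//; apply: le_lt_trans Hn _; exact: ltry.
apply/cvgrPdist_le => eta eta0; have := sb eta eta0; apply: filterS => n Hn.
have S := ge0_fin_numE (s0 n); have fS : ereal_sup (range (fun x => `|(f n x)%:E|%E)) \is a fin_num.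
  by rewrite S; apply: le_lt_trans Hn _; exact: ltry.
rewrite sub0r normrN ger0_norm; last exact/fine_ge0/s0.
by move: Hn; rewrite -{1}(fineK fS) lee_fin.
Qed.

Theorem corollary3 (R : realType)
  (disp : measure_display) (Omega : measurableType disp)
  (P : probability Omega R)
  (disps : measure_display) (Omegas : measurableType disps)
  (Ps : probability Omegas R)
  (dim : nat -> nat) (Z : nat -> {RV P >-> l2 R})
  (idx : forall n : nat, 'I_n -> {RV Ps >-> nat})
  (dim_gt0 : forall n, (0 < dim n)%N)
  (dim_oo : dim n @[n --> \oo] --> \oo)
  (Z_indep : mutually_independent Z)
  (Z_idist : identically_distributed Z)
  (Z_mean : has_expectation P (Z 0%N) 0)
  (Z_sqnorm : ('E_P[fun w => (`|Z 0%N w| ^+ 2)%R] < +oo)%E)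
  (idx_indep : forall n, mutually_independent (@idx n))
  (idx_unif : forall n (k : 'I_n), uniform_index n (@idx n k)) :
  {ae P, forall w : Omega,
    ereal_sup (range (fun x : R =>
      `|Ps [set ws | (W_stat dim Z idx n w ws <= x)%R]
        - P [set w' | (V_stat dim Z n w' <= x)%R]|%E)) @[n --> \oo] --> 0%E}.
Proof.
pose f w n x := boot (fun i => l2_coord (Z i w)) n (in_ball (dim n) x) -
  mean P (fun w' => in_ball (dim n) x (scaled_sum Z n w')).
suff : {ae P, forall w, forall eta, 0 < eta ->
    \forall n \near \oo, forall x, `|f w n x| <= eta}.
  apply: filterS => w /ereal_sup_cvg0 H.
  (* The identities for both statistics hold for n > 0 only, and the limit does not see n = 0. *)
  apply: cvg_trans H; apply: near_eq_cvg; exists 1%N => // n n0.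
  congr ereal_sup; congr (_ @` _); apply/funext => x.
  have E1 := bootstrap_prob dim (fun i => Z i) idx_indep idx_unif w x n0.
  have [_ E2] := prob_le_mean P x (measurable_dot_scaled_sum Z n (dim n)).
  rewrite /f EFinB -E1 /in_ball -E2; congr (`|_ - P _|)%E.
  by apply/seteqP; split=> w' /=; rewrite V_statE.
have [[j0 Cj0]|C0] := pselect (exists j, 0 < covariance_coord Z j j).
  move: (good_sample Z_indep Z_idist Z_mean Z_sqnorm); apply: filterS => w [H1 H2 H3] eta eta0.
  apply: (laws_close Z_indep Z_idist Z_mean Z_sqnorm H1 H2 H3 _ dim_oo Cj0 eta0).
  by move=> m i; exact: dot_le_norm.
have Z0 : {ae P, forall w i j, Z i w j = 0}.
  apply: degenerate_sample => // j; apply/eqP; rewrite eq_le covariance_ge0 andbT leNgt.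
  by apply/negP => Cj; apply: C0; exists j.
move: (Z0); apply: filterS => w Zw eta eta0; exists 1%N => // n n0 x.
by rewrite /f degenerate_boot// degenerate_scaled_sum// subrr normr0 ltW.
Qed.
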